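(* In $\mathbb{R}^2$ with polar coordinates $(r,\theta)$, let $v_0=r^2g(\theta)$ be a blow-up solution at the origin of $$L_{\alpha,\beta}v=\tfrac12\chi_{\{v>0\}}\ \text{in }B_1(0),\qquad v\ge0\ \text{in }B_1(0),\qquad 0\in FB(v),$$ and assume that there exist $\theta_1,\theta_2\in(0,\pi)$ such that $g(\theta)=0$ for all $\theta\in[0,\pi-\theta_1]\cup[\pi+\theta_2,2\pi]$. Then $$g(\theta)=\begin{cases}\frac1{8\alpha}\big[1-\cos(2\theta_1)\cos(2\theta)+\sin(2\theta_1)\sin(2\theta)\big]&\pi-\theta_1\le\theta\le\pi\\[2pt] \frac1{8\beta}\big[1-\cos(2\theta_2)\cos(2\theta)-\sin(2\theta_2)\sin(2\theta)\big]&\pi\le\theta\le\pi+\theta_2\\[2pt] 0&\text{otherwise,}\end{cases}$$ $$\theta_2=\begin{cases}\theta_1+\frac\pi2&0<\theta_1<\frac\pi2\\ \theta_1-\frac\pi2&\frac\pi2<\theta_1<\pi\end{cases}\qquad\text{and}\qquad \cos(2\theta_1)=\frac{\beta-\alpha}{\beta+\alpha}.$$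
   Context: The constants $\alpha,\beta$ satisfy $0<\lambda\le\alpha,\beta\le\Lambda$ for fixed ellipticity constants $\lambda,\Lambda$. $L_{\alpha,\beta}:=D_ja^{ij}(x)D_i$ on $\mathbb{R}^2$ with $a^{ij}(x)=\alpha\delta^{ij}$ for $x_2>0$ (i.e. $\theta\in(0,\pi)$) and $a^{ij}(x)=\beta\delta^{ij}$ for $x_2<0$ (i.e. $\theta\in(\pi,2\pi)$), where $\delta^{ij}$ is the Kronecker delta. Equations are meant weakly: for $u\in W^{1,2}(\Omega)$ and $h\in L^2(\Omega)$, $L_{\alpha,\beta}u=h$ in $\Omega$ means $-\int_\Omega a^{ij}D_iu\,D_j\phi=\int_\Omega h\phi$ for all $\phi\in W^{1,2}_0(\Omega)$. $B_1(0)$ is the open unit ball centered at the origin, $\chi_D$ is the characteristic function of $D$, and $FB(v):=\partial\{v>0\}\cap\partial\{v=0\}$. A blow-up solution at the origin is a limit $v_0$ (a.e. in $\mathbb{R}^2$) of a sequence $v_m(x)=v(\rho_mx)/\rho_m^2$ with $0<\rho_m\to0$, where $v$ solves the problem $L_{\alpha,\beta}v=\tfrac12\chi_{\{v>0\}}$ in $B_1(0)$, $v\ge0$ in $B_1(0)$, $0\in FB(v)$.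
   Formalization: Adds α ≠ β (for α = β, half-plane solutions with arbitrary θ1 are counterexamples) and takes θ1, θ2 to be the angles for which the given set is exactly the zero set of g (larger θ1 would break the formula); v and v0 are taken as their continuous representatives. *)

(* Defs.v *)
From HB Require Import structures.
From mathcomp Require Import all_boot all_order all_algebra.
From mathcomp Require Import all_classical all_reals all_analysis.

Set Implicit Arguments.
Unset Strict Implicit.
Unset Printing Implicit Defensive.

Import Order.TTheory GRing.Theory Num.Theory.
Import numFieldNormedType.Exports.

Local Open Scope classical_set_scope.
Local Open Scope ring_scope.

Section Plane.
Variable R : realType.
Implicit Types (Om D : set (R * R)) (u v h phi : R * R -> R).
Implicit Types (p q : 'I_2 -> R * R -> R).

(* [R * R] with the measurable structure carried by [lebesgue_measure]; it has
   the same measurable sets as the one inferred for [R * R], but another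
   display. *)
Local Notation plane := (measurableTypeR R * measurableTypeR R)%type.

Definition leb2 : {measure set plane -> \bar R} :=
  (@lebesgue_measure R \x @lebesgue_measure R)%E.

(* The norm of [R * R] in the library is the sup norm, hence the explicit
   Euclidean ball. *)
Definition unit_disk : set (R * R) := [set x | x.1 ^+ 2 + x.2 ^+ 2 < 1].

Definition basis_vec (i : 'I_2) : R * R := if i == 0 then (1, 0) else (0, 1).

Definition partial (i : 'I_2) u : R * R -> R := fun x => 'D_(basis_vec i) u x.

(* C^infinity on the whole plane: every iterated partial derivative is
   (Frechet) differentiable everywhere. *)
Definition smooth u := forall (s : seq 'I_2) (x : R * R),
  differentiable (foldr partial u s) x.

Definition test_function Om phi :=
  [/\ smooth phi,
      compact (closure [set x | phi x != 0]) &
      closure [set x | phi x != 0] `<=` Om].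

Definition L2 Om u :=
  measurable_fun (Om : set plane) u /\ leb2.-integrable Om (fun x => (u x ^+ 2)%:E).

(* [u] is in W^{1,2}(Om) with weak gradient [p]; [p] is unique up to
   modification on a null set. *)
Definition W12 Om u p :=
  [/\ L2 Om u,
      forall i, L2 Om (p i) &
      forall i phi, test_function Om phi ->
        (\int[leb2]_(x in Om) (u x * partial i phi x)) =
        - (\int[leb2]_(x in Om) (p i x * phi x))].

(* W^{1,2}_0(Om) is the closure of the test functions in W^{1,2}(Om). *)
Definition W12_0 Om phi q :=
  W12 Om phi q /\
  exists2 f : nat -> R * R -> R,
    (forall k, test_function Om (f k)) &
    (fun k => (\int[leb2]_(x in Om) ((f k x - phi x) ^+ 2)) +
       \sum_(i < 2)
         (\int[leb2]_(x in Om) ((partial i (f k) x - q i x) ^+ 2)))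
      @ \oo --> (0 : R).

(* D_j (a^{ij} D_i u) = h in Om *)
Definition weak_solution Om (a : 'I_2 -> 'I_2 -> R * R -> R) u h :=
  L2 Om h /\
  exists2 p, W12 Om u p &
    forall phi q, W12_0 Om phi q ->
      - (\int[leb2]_(x in Om)
           (\sum_(i < 2) \sum_(j < 2) a i j x * p i x * q j x)) =
      (\int[leb2]_(x in Om) (h x * phi x)).

(* The value on the null set x_2 = 0 is irrelevant. *)
Definition coef (alpha beta : R) (i j : 'I_2) (x : R * R) : R :=
  (if 0 < x.2 then alpha else beta) * (i == j)%:R.

Definition bdry D : set (R * R) := closure D `\` interior D.

Definition positivity_set Om v : set (R * R) := [set x | Om x /\ 0 < v x].
Definition zero_set Om v : set (R * R) := [set x | Om x /\ v x = 0].
Definition free_boundary Om v : set (R * R) :=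
  bdry (positivity_set Om v) `&` bdry (zero_set Om v).

(* An element of W^{1,2} is a class modulo null sets, whereas the free boundary
   is a topological notion: solutions are taken in their continuous
   representative, which exists by De Giorgi-Nash-Moser. *)
Definition obstacle_solution (alpha beta : R) v :=
  [/\ forall x, unit_disk x -> {for x, continuous v},
      weak_solution unit_disk (coef alpha beta) v
        (fun x => 2^-1 * \1_(positivity_set unit_disk v) x),
      forall x, unit_disk x -> 0 <= v x &
      free_boundary unit_disk v 0].

(* As for solutions, the a.e. limit [v0] is the continuous representative.
   For fixed [x], the points [rho m *: x] are in the disk for large [m], so the
   values of [v] outside of the disk play no role. *)
Definition blowup_at_origin (alpha beta : R) (v0 : R * R -> R) :=
  continuous v0 /\
  exists v (rho : nat -> R),
    [/\ obstacle_solution alpha beta v,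
        forall m, 0 < rho m,
        rho @ \oo --> (0 : R) &
        {ae leb2, forall x,
          (fun m => v (rho m *: x) / rho m ^+ 2) @ \oo --> v0 x}].

End Plane.

(* Main.v *)
Require Import Defs.
From mathcomp Require Import all_boot all_order all_algebra.
From mathcomp Require Import all_classical all_reals all_analysis.
From mathcomp Require Import measurable_realfun.
From mathcomp Require Import ring lra.
Import Order.TTheory GRing.Theory Num.Theory.
Import numFieldNormedType.Exports.
Local Open Scope classical_set_scope.
Local Open Scope ring_scope.
Set Implicit Arguments.
Unset Strict Implicit.
Unset Printing Implicit Defensive.

(** The blow-up [v0] inherits from its polar form the homogeneity of degree two,
    and from the equation of [v] the equation of the obstacle problem. On each
    side of the axis the coefficient is constant, and a nonnegative homogeneous
    solution of the one-phase problem in a half-plane that vanishes near one of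
    the two boundary rays is either zero or a multiple of the squared distance
    to a half-plane ([half_plane_solution]). One angle is thus left on each
    side. They are found from two conditions at a point of the axis: continuity,
    and the balance of the fluxes [a * D_2 v0] and [b * D_2 v0] from above and
    from below ([blowup_transmission]). Trigonometry turns these two equations
    into the formula for [cos (2 * theta1)] and the relation between the angles
    ([angles_of_transmission]); this is where [alpha != beta] enters. The
    alternative [v0 = 0] is excluded by nondegeneracy ([blowup_nonzero]).

    No regularity theory is used for the weak equation. It is tested against
    one explicit family of functions, [kphi s t y], smooth truncations of the
    logarithm of the squared distance to [y], whose Laplacian is the difference
    [kout - kin] of two nonnegative kernels of equal mass: [kout] is bounded,
    while [kin] concentrates at [y] when [t] tends to 0. A one-sided bound of
    the Laplacian is by definition the inequality that this family sees
    ([lap_le], [lap_ge]). Such bounds survive pointwise limits of uniformly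
    bounded functions; they imply mean value inequalities ([sub_mean_value],
    [growth_annulus]) and the comparison with quadratic polynomials at points of
    contact ([touch_above], [touch_below]), and the classification in the
    half-plane follows from comparison alone.

    Across the interface the useful function is
    [fold a b v x = a * v (x.1, |x.2|) + b * v (x.1, - |x.2|)]. Test functions
    that are even in [x.2] have no normal derivative on the axis, and for those
    the coefficient may be moved in front of [v] before integrating by parts a
    second time ([neumann_identity]); so [fold a b v] solves a Poisson equation
    on the whole disk, with a right-hand side between 0 and 1 ([lap_eq_fold]).
    The quadratic growth of [v] at the free boundary point ([fold_growth]), its
    nondegeneracy, and the balance of the fluxes of [v0], which says that
    [fold a b v0] has no kink along the axis ([no_kink]), are all read off this
    equation. *)

(** * Smooth functions on the plane *)

Section SmoothClosure.
Variable R : realType.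
Implicit Types (u w : R * R -> R) (i : 'I_2).

Lemma partialE i u x : differentiable u x -> partial i u x = 'd u x (basis_vec R i).
Proof. by move=> ?; rewrite /partial deriveE. Qed.

Lemma partial_cst i (c : R) x : partial i (fun=> c) x = 0.
Proof. exact: derive_cst. Qed.

Lemma partialD i u w x : differentiable u x -> differentiable w x ->
  partial i (fun y => u y + w y) x = partial i u x + partial i w x.
Proof. by move=> du dw; rewrite /partial deriveD//; apply: diff_derivable. Qed.

Lemma partialM i u w x : differentiable u x -> differentiable w x ->
  partial i (fun y => u y * w y) x = u x * partial i w x + w x * partial i u x.
Proof. by move=> du dw; rewrite /partial deriveM//; apply: diff_derivable. Qed.

Lemma partialV i u x : differentiable u x -> u x != 0 ->
  partial i (fun y => (u y)^-1) x = - (u x)^-1 * (u x)^-1 * partial i u x.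
Proof.
move=> du ux; rewrite /partial deriveV//; last exact: diff_derivable.
by rewrite /GRing.scale/= -exprVn; ring.
Qed.

Lemma partial_comp i (f : R -> R) (df : R) u x : differentiable u x ->
  is_derive (u x) 1 f df ->
  differentiable (f \o u) x /\ partial i (fun y => f (u y)) x = df * partial i u x.
Proof.
move=> du dfu.
have dF : differentiable f (u x) by apply/derivable1_diffP; exact: ex_derive.
have dfuE : differentiable (f \o u) x by exact: differentiable_comp.
split=> //; rewrite -[fun y => _]/(f \o u) partialE// diff_comp//= partialE//.
rewrite diff1E// derive1E derive_val.
by rewrite /= [LHS]mulrC.
Qed.

Lemma differentiable_fst (x : R * R) : differentiable (fst : R * R -> R) x.
Proof. by apply: linear_differentiable => ?; exact: cvg_fst. Qed.

Lemma differentiable_snd (x : R * R) : differentiable (snd : R * R -> R) x.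
Proof. by apply: linear_differentiable => ?; exact: cvg_snd. Qed.

Lemma partial_fst i x : partial i (fst : R * R -> R) x = (i == 0)%:R.
Proof.
rewrite partialE; last exact: differentiable_fst.
rewrite diff_lin ; last by move=> ?; exact: cvg_fst.
by rewrite /= /basis_vec; case: (i == 0).
Qed.

Lemma partial_snd i x : partial i (snd : R * R -> R) x = (i != 0)%:R.
Proof.
rewrite partialE; last exact: differentiable_snd.
rewrite diff_lin ; last by move=> ?; exact: cvg_snd.
by rewrite /= /basis_vec; case: (i == 0).
Qed.

(** Smoothness up to finite order, by which sums and products can be treated
    by induction: the partial derivatives of a product are products of
    functions of lower order. *)
Definition smooth_upto n u :=
  forall (s : seq 'I_2) x, (size s <= n)%N -> differentiable (foldr (@partial R) u s) x.

Lemma smooth_uptoS n u : smooth_upto n.+1 u <->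
  (forall x, differentiable u x) /\ forall i, smooth_upto n (partial i u).
Proof.
split=> [h|[h1 h2] s].
  split=> [x|i s x sn]; first exact: (h [::]).
  by have := h (rcons s i) x; rewrite size_rcons foldr_rcons; exact.
case/lastP: s => [|s i] x; first by move=> _; exact: h1.
by rewrite size_rcons foldr_rcons; exact: h2.
Qed.

Lemma smooth_upto0 u : smooth_upto 0 u <-> forall x, differentiable u x.
Proof.
split=> [h x|h [|//] x _]; [exact: (h [::])|exact: h].
Qed.

Lemma smooth_uptoP u : smooth u <-> forall n, smooth_upto n u.
Proof.
split=> [h n s x _|h s x]; [exact: h|exact: (h (size s))].
Qed.

Lemma smooth_uptoW n u : smooth_upto n.+1 u -> smooth_upto n u.
Proof. by move=> h s x sn; apply: h; exact: leqW. Qed.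

Lemma smooth_diff u : smooth u -> forall x, differentiable u x.
Proof. by move=> h; exact: (h [::]). Qed.

Lemma smooth_partial i u : smooth u -> smooth (partial i u).
Proof. by move=> h s x; have := h (rcons s i) x; rewrite foldr_rcons. Qed.

(** A way to prove smoothness by computing first derivatives only, when these
    are built from functions already known to be smooth. *)
Lemma smooth_step u : (forall x, differentiable u x) ->
  (forall i, smooth (partial i u)) -> smooth u.
Proof.
move=> h1 h2 s; case/lastP: s => [|s i] x; first exact: h1.
by rewrite foldr_rcons; exact: h2.
Qed.

Lemma smooth_upto_cst n (c : R) : smooth_upto n (fun=> c).
Proof.
elim: n c => [|n ih] c.
  by apply/smooth_upto0 => x; exact: differentiable_cst.
apply/smooth_uptoS; split=> [x|i]; first exact: differentiable_cst.
rewrite (_ : partial i _ = fun=> 0)//.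
by apply/funext => x; exact: partial_cst.
Qed.

Lemma smooth_cst (c : R) : smooth (fun _ : R * R => c).
Proof. apply/smooth_uptoP => n; exact: smooth_upto_cst. Qed.

Lemma smooth_fst : smooth (fst : R * R -> R).
Proof.
apply: smooth_step => [x|i]; first exact: differentiable_fst.
by rewrite (_ : partial i _ = fun=> (i == 0)%:R);
  [exact: smooth_cst|apply/funext => x; exact: partial_fst].
Qed.

Lemma smooth_snd : smooth (snd : R * R -> R).
Proof.
apply: smooth_step => [x|i]; first exact: differentiable_snd.
by rewrite (_ : partial i _ = fun=> (i != 0)%:R);
  [exact: smooth_cst|apply/funext => x; exact: partial_snd].
Qed.

Lemma smooth_uptoD n u w : smooth_upto n u -> smooth_upto n w ->
  smooth_upto n (fun x => u x + w x).
Proof.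
elim: n u w => [|n ih] u w.
  by move=> /smooth_upto0 hu /smooth_upto0 hw; apply/smooth_upto0 => x;
    exact: differentiableD.
move=> /smooth_uptoS[du hu] /smooth_uptoS[dw hw]; apply/smooth_uptoS.
split=> [x|i]; first exact: differentiableD.
rewrite (_ : partial i _ = fun x => partial i u x + partial i w x).
  exact: ih.
by apply/funext => x; rewrite partialD.
Qed.

Lemma smooth_uptoM n u w : smooth_upto n u -> smooth_upto n w ->
  smooth_upto n (fun x => u x * w x).
Proof.
elim: n u w => [|n ih] u w.
  by move=> /smooth_upto0 hu /smooth_upto0 hw; apply/smooth_upto0 => x;
    exact: differentiableM.
move=> hu' hw'; have hun := smooth_uptoW hu'; have hwn := smooth_uptoW hw'.
move: hu' hw' => /smooth_uptoS[du hu] /smooth_uptoS[dw hw]; apply/smooth_uptoS.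
split=> [x|i]; first exact: differentiableM.
rewrite (_ : partial i _ = fun x => u x * partial i w x + w x * partial i u x).
  by apply: smooth_uptoD; exact: ih.
by apply/funext => x; rewrite partialM.
Qed.

Lemma smoothD u w : smooth u -> smooth w -> smooth (fun x => u x + w x).
Proof.
by move=> /smooth_uptoP hu /smooth_uptoP hw; apply/smooth_uptoP => n; exact: smooth_uptoD.
Qed.

Lemma smoothM u w : smooth u -> smooth w -> smooth (fun x => u x * w x).
Proof.
by move=> /smooth_uptoP hu /smooth_uptoP hw; apply/smooth_uptoP => n; exact: smooth_uptoM.
Qed.

Lemma smoothZ (c : R) u : smooth u -> smooth (fun x => c * u x).
Proof. by move=> hu; apply: smoothM => //; exact: smooth_cst. Qed.

Lemma smoothN u : smooth u -> smooth (fun x => - u x).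
Proof.
move=> hu; rewrite (_ : (fun x => - u x) = fun x => (-1) * u x); first exact: smoothZ.
by apply/funext => x; rewrite mulN1r.
Qed.

Lemma smoothB u w : smooth u -> smooth w -> smooth (fun x => u x - w x).
Proof. by move=> hu hw; apply: smoothD => //; exact: smoothN. Qed.

Lemma smooth_sqr u : smooth u -> smooth (fun x => u x ^+ 2).
Proof.
move=> hu; rewrite (_ : (fun x => u x ^+ 2) = fun x => u x * u x); first exact: smoothM.
by apply/funext => x; rewrite expr2.
Qed.

(** By induction on the order: the partial derivatives of [1 / u] are those
    of [u] multiplied by [- (1 / u) * (1 / u)]. *)
Lemma smoothV u : (forall x, u x != 0) -> smooth u -> smooth (fun x => (u x)^-1).
Proof.
move=> u0 /smooth_uptoP hu; apply/smooth_uptoP => n.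
elim: n => [|n ih].
  apply/smooth_upto0 => x; apply: differentiableV => //.
  exact: (smooth_upto0 _).1 (hu 0%N) x.
have [du hu'] := (smooth_uptoS _ _).1 (hu n.+1).
apply/smooth_uptoS; split=> [x|i]; first exact: differentiableV.
rewrite (_ : partial i _ = fun x => (-1 * (u x)^-1) * (u x)^-1 * partial i u x).
  by apply: smooth_uptoM => //; do 2 (apply: smooth_uptoM => //); exact: smooth_upto_cst.
by apply/funext => x; rewrite partialV// mulN1r.
Qed.

Lemma smooth_continuous u : smooth u -> continuous u.
Proof. by move=> hu x; apply: differentiable_continuous; exact: smooth_diff. Qed.

End SmoothClosure.

(** * Lebesgue measure on the plane *)

Section PlaneMeasure.
Variable R : realType.
Local Notation plane := (measurableTypeR R * measurableTypeR R)%type.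
Local Notation mu := (@leb2 R).
Local Notation leb := (@lebesgue_measure R).

(** The topology has a countable base of boxes. *)
Lemma open_plane_measurable (A : set (R * R)) : open A -> measurable (A : set plane).
Proof.
move=> oA.
pose box (q : (rat * rat) * (rat * rat)) : set plane :=
  [set` `](ratr q.1.1 : R), ratr q.1.2[] `*` [set` `](ratr q.2.1 : R), ratr q.2.2[].
pose F q := if `[< box q `<=` A >] then box q else set0.
suff -> : A = \bigcup_q F q.
  apply: countable_bigcupT_measurable => [|q]; first exact: countableP.
  rewrite /F; case: ifP => // _.
  by apply: measurableX; exact: measurable_itv.
apply/seteqP; split => [x Ax|x [q _]]; last first.
  by rewrite /F; case: ifPn => // /asboolP; apply.
have /nbhs_ballP[e /= e0 xeA] : nbhs x A by apply: open_nbhs_nbhs.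
have lo (y : R) : y - e < y by rewrite ltrBlDr ltrDl.
have hi (y : R) : y < y + e by rewrite ltrDl.
have [a1 Ha1] := rat_in_itvoo (lo x.1); have [b1 Hb1] := rat_in_itvoo (hi x.1).
have [a2 Ha2] := rat_in_itvoo (lo x.2); have [b2 Hb2] := rat_in_itvoo (hi x.2).
move: Ha1 Hb1 Ha2 Hb2; rewrite !in_itv/= => /andP[a1l a1u] /andP[b1l b1u]
  /andP[a2l a2u] /andP[b2l b2u].
exists ((a1, b1), (a2, b2)) => //; rewrite /F asboolT.
  by split; rewrite /= in_itv/= ?a1u ?a2u.
move=> y [/=]; rewrite !in_itv/= => /andP[y1l y1u] /andP[y2l y2u]; apply: xeA.
by split => /=; rewrite /ball/= ltr_norml; apply/andP; split; lra.
Qed.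

Lemma continuous_plane_measurable (f : R * R -> R) :
  continuous f -> measurable_fun (setT : set plane) f.
Proof.
move=> cf; apply: (measurability _ (RGenOpens.measurableE R)).
move=> _ [_ [a [b ->] <-]]; rewrite setTI; apply: open_plane_measurable.
by move/continuousP : cf; apply; exact: interval_open.
Qed.

Lemma smooth_measurable (D : set plane) (f : R * R -> R) :
  smooth f -> measurable_fun D f.
Proof.
move=> sf; apply: (@measurable_funS _ _ _ _ setT) => //.
exact: continuous_plane_measurable (smooth_continuous sf).
Qed.

Definition box (x : R * R) (r : R) : set (R * R) :=
  [set y | x.1 - r <= y.1 <= x.1 + r /\ x.2 - r <= y.2 <= x.2 + r].

Lemma boxE x r : box x r =
  [set` `[x.1 - r, x.1 + r]] `*` [set` `[x.2 - r, x.2 + r]].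
Proof. by apply/seteqP; split => y [/=]; rewrite ?in_itv/=. Qed.

Lemma measurable_box x r : measurable (box x r : set plane).
Proof. by rewrite boxE; apply: measurableX; exact: measurable_itv. Qed.

Lemma leb2_box x r : 0 <= r -> mu (box x r) = ((2 * r) ^+ 2)%:E.
Proof.
move=> r0; rewrite boxE.
have /= -> := product_measure1E (lebesgue_measure : {measure set (measurableTypeR R) -> \bar R})
  (lebesgue_measure : {measure set (measurableTypeR R) -> \bar R})
  (measurable_itv `[x.1 - r, x.1 + r]) (measurable_itv `[x.2 - r, x.2 + r]).
rewrite !lebesgue_measure_itv/= !lte_fin.
have [->|rn0] := eqVneq r 0.
  by rewrite !addr0 !subr0 !ltxx /= ?mule0 mulr0 expr0n.
have r1 : 0 < r by rewrite lt_neqAle eq_sym rn0.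
have rr (y : R) : (y - r < y + r) = true by apply/idP; lra.
by rewrite !rr -!EFinB -EFinM; congr EFin; ring.
Qed.

Lemma compact_box x r : compact (box x r).
Proof. by rewrite boxE; apply: compact_setX; exact: segment_compact. Qed.

Lemma leb2_line : mu [set x : R * R | x.2 = 0] = 0%E.
Proof.
rewrite (_ : [set x : R * R | x.2 = 0] = setT `*` [set 0]); last first.
  by apply/seteqP; split => y /=; [|case].
have /= -> := product_measure1E (lebesgue_measure : {measure set (measurableTypeR R) -> \bar R})
  (lebesgue_measure : {measure set (measurableTypeR R) -> \bar R})
  (measurableT) (measurable_set1 (0 : R)).
by rewrite lebesgue_measure_set1 mule0.
Qed.

Lemma ae_off_line : {ae mu, forall x : plane, x.2 != 0}.
Proof.
exists [set x : R * R | x.2 = 0]; split => //.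
- rewrite (_ : [set x : R * R | x.2 = 0] = setT `*` [set 0]).
    by apply: measurableX.
  by apply/seteqP; split => y /=; [|case].
- exact: leb2_line.
- by move=> x /= /negP; rewrite negbK => /eqP.
Qed.

Lemma bounded_integrable (D : set plane) (f : R * R -> R) (b C : R) : measurable D ->
  D `<=` box 0 b -> measurable_fun D f -> (forall x, D x -> `|f x| <= C) ->
  mu.-integrable D (EFin \o f).
Proof.
move=> mD Db mf fC.
have muD : (mu D < +oo)%E.
  have [b0|b0] := ltP b 0.
    rewrite (_ : D = set0) ?measure0//; apply/seteqP; split => // x /Db[/andP[h1 h2] _].
    by have := le_trans h1 h2; lra.
  apply: (@le_lt_trans _ _ (mu (box 0 b))).
    by apply: le_measure => //; rewrite inE//; exact: measurable_box.
  by rewrite leb2_box// ltry.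
apply: measurable_bounded_integrable => //; exists C; split=> [|M CM x Dx].
  exact: num_real.
exact: le_trans (fC _ Dx) (ltW CM).
Qed.

(** The two factors may differ, so that dilations and the reflection in an
    axis are both instances. *)
Definition stretch (s : R * R) (x : R * R) : R * R := (s.1 * x.1, s.2 * x.2).

Lemma measurable_stretch s : measurable_fun (setT : set plane) (stretch s : plane -> plane).
Proof.
by apply: measurable_fun_pair => /=; apply: measurable_funM => //.
Qed.

Lemma leb_scale (s : R) (A : set (measurableTypeR R)) : s != 0 -> measurable A ->
  leb A = (`|s|%:E * leb ((fun x : R => (s * x)%R) @^-1` A))%E.
Proof.
move=> s0 mA.
have ms : measurable_fun setT ((fun x => s * x) : measurableTypeR R -> measurableTypeR R).
  exact: measurable_funM.
pose sm : measurableTypeR R -> measurableTypeR R := fun x => s * x.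
unshelve epose (m' := (mscale (NngNum (normr_ge0 s)) (pushforward leb sm) :
  {measure set (measurableTypeR R) -> \bar R})); first exact: ms.
apply: (@lebesgue_measure_unique R m') => //.
have m'E B : m' B = (`|s|%:E * leb (sm @^-1` B))%E by [].
move=> _ [[a b]] _ <-; rewrite m'E /sm.
have sp : 0 < `|s| by rewrite normr_gt0.
rewrite lebesgue_measure_itv/= lte_fin.
have [s1|s1] := ltP 0 s.
  rewrite (_ : _ @^-1` _ = [set` `]a / s, b / s]]); last first.
    apply/seteqP; split => x /=; rewrite !in_itv/=.
      by rewrite ltr_pdivrMr// ler_pdivlMr// !(mulrC x).
    by rewrite ltr_pdivrMr// ler_pdivlMr// !(mulrC x).
  rewrite lebesgue_measure_itv/= lte_fin ltr_pM2r ?invr_gt0//.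
  case: ifP => _; last by rewrite mule0.
  rewrite -!EFinB -EFinM gtr0_norm//; congr EFin; field.
  exact: s0.
have {}s1 : s < 0 by rewrite lt_neqAle s0.
rewrite (_ : _ @^-1` _ = [set` `[b / s, a / s[]); last first.
  apply/seteqP; split => x /=; rewrite !in_itv/= ltr_ndivlMr// ler_ndivrMr// !(mulrC x).
    by rewrite andbC.
  by rewrite andbC.
rewrite lebesgue_measure_itv/= lte_fin ltr_nM2r ?invr_lt0//.
case: ifP => _; last by rewrite mule0.
rewrite -!EFinB -EFinM ltr0_norm//; congr EFin; field.
exact: s0.
Qed.

Lemma leb2_stretch (s : R * R) (A : set plane) : s.1 != 0 -> s.2 != 0 -> measurable A ->
  mu A = (`|s.1 * s.2|%:E * mu (stretch s @^-1` A))%E.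
Proof.
move=> s1 s2 mA.
pose sm : plane -> plane := stretch s.
unshelve epose (m' := (mscale (NngNum (normr_ge0 (s.1 * s.2))) (pushforward mu sm) :
  {measure set plane -> \bar R})); first exact: measurable_stretch.
apply: (@product_measure_unique _ _ (measurableTypeR R) (measurableTypeR R) R
 lebesgue_measure lebesgue_measure m') => //.
have m'E B : m' B = (`|s.1 * s.2|%:E * mu (sm @^-1` B))%E by [].
move=> B C mB mC; rewrite m'E /sm.
have mp (t : R) (E : set (measurableTypeR R)) : measurable E -> measurable ((fun x : R => (t * x)%R) @^-1` E : set (measurableTypeR R)).
  move=> mE; rewrite -[X in measurable X]setTI.
  by have := @measurable_funM _ (measurableTypeR R) R setT (cst t) id; apply.
rewrite (_ : stretch s @^-1` (B `*` C) = ((fun x : R => s.1 * x) @^-1` B) `*` ((fun x : R => s.2 * x) @^-1` C))//.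
have /= -> := product_measure1E (lebesgue_measure : {measure set (measurableTypeR R) -> \bar R})
  (lebesgue_measure : {measure set (measurableTypeR R) -> \bar R}) (mp s.1 _ mB) (mp s.2 _ mC).
by rewrite (leb_scale s1 mB) (leb_scale s2 mC) normrM EFinM muleACA.
Qed.

End PlaneMeasure.

(** * Dilations, dominated convergence and integrability *)

Section Integrals.
Variable R : realType.
Local Notation plane := (measurableTypeR R * measurableTypeR R)%type.
Local Notation mu := (@leb2 R).
Implicit Types (D : set plane) (f g : R * R -> R).

Lemma ge0_integral_stretch (s : R * R) D (f : plane -> \bar R) :
  s.1 != 0 -> s.2 != 0 -> measurable D -> measurable_fun D f ->
  (forall x, D x -> 0 <= f x)%E ->
  (\int[mu]_(x in D) f x =
   `|s.1 * s.2|%:E * \int[mu]_(x in stretch s @^-1` D) f (stretch s x))%E.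
Proof.
move=> s1 s2 mD mf f0.
pose sm : plane -> plane := stretch s.
have msm : measurable_fun setT sm by exact: measurable_stretch.
unshelve epose (pm := (pushforward mu sm : {measure set plane -> \bar R})).
  exact: msm.
have pE : (\int[pm]_(x in D) f x = \int[mu]_(x in sm @^-1` D) (f \o sm) x)%E.
  apply: (@ge0_integral_pushforward _ _ _ _ R sm msm mu D f mD mf).
  by move=> x; rewrite inE; exact: f0.
rewrite -[X in (_ * X)%E]pE.
have <- := @ge0_integral_mscale _ plane R pm D mD (NngNum (normr_ge0 (s.1 * s.2))) f mf f0.
by apply: eq_measure_integral => A mA _; exact: leb2_stretch.
Qed.

Lemma measurable_stretch_preimage s D : measurable D -> measurable (stretch s @^-1` D : set plane).
Proof.
move=> mD; rewrite -[X in measurable X]setTI.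
exact: (measurable_stretch s).
Qed.

Lemma measurable_fun_stretch s D f : measurable_fun D f -> measurable D ->
  measurable_fun (stretch s @^-1` D : set plane) (fun x => f (stretch s x)).
Proof.
move=> mf mD; apply: (measurable_comp mD) => //.
- by move=> _ [x Dx <-].
- by apply: measurable_funTS; exact: measurable_stretch.
Qed.

Lemma integrable_stretch s D f : s.1 != 0 -> s.2 != 0 -> measurable D ->
  mu.-integrable D (EFin \o f) ->
  mu.-integrable (stretch s @^-1` D) (EFin \o (fun x => f (stretch s x))).
Proof.
move=> s1 s2 mD /integrableP[mf foo]; apply/integrableP; split.
  by apply/measurable_EFinP; apply: measurable_fun_stretch => //; exact/measurable_EFinP.
move: foo; rewrite (@ge0_integral_stretch s)//; last exact: measurableT_comp.
have c0 : 0 < `|s.1 * s.2| by rewrite normr_gt0 mulf_neq0.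
have aux (J : \bar R) : (0 <= J -> `|s.1 * s.2|%:E * J < +oo -> J < +oo)%E.
  by case: J => [r| |]//; rewrite ?ltry// gt0_muley// lte_fin.
by apply: aux; exact: integral_ge0.
Qed.

Lemma Rintegral_stretch s D f : s.1 != 0 -> s.2 != 0 -> measurable D ->
  mu.-integrable D (EFin \o f) ->
  \int[mu]_(x in D) f x =
  `|s.1 * s.2| * \int[mu]_(x in stretch s @^-1` D) f (stretch s x).
Proof.
move=> s1 s2 mD fi; have fsi := integrable_stretch s1 s2 mD fi.
have mf := measurable_int _ fi.
have mDs := measurable_stretch_preimage s mD.
rewrite /Rintegral integralE [in RHS]integralE.
rewrite (@ge0_integral_stretch s _ (fun x => (EFin \o f)^\+%E x))//; last exact: measurable_funepos.
rewrite (@ge0_integral_stretch s _ (fun x => (EFin \o f)^\-%E x))//; last exact: measurable_funeneg.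
have ip := integrable_pos_fin_num mDs fsi.
have im := integrable_neg_fin_num mDs fsi.
have pE x : (EFin \o f)^\+%E (stretch s x) = (EFin \o (fun x => f (stretch s x)))^\+%E x.
  by have /(congr1 (@^~ x)) /= <- := funepos_comp (EFin \o f) (stretch s).
have mE x : (EFin \o f)^\-%E (stretch s x) = (EFin \o (fun x => f (stretch s x)))^\-%E x.
  by have /(congr1 (@^~ x)) /= <- := funeneg_comp (EFin \o f) (stretch s).
have -> : (\int[mu]_(x in stretch s @^-1` D) (EFin \o f)^\+%E (stretch s x) =
  \int[mu]_(x in stretch s @^-1` D) (EFin \o (fun x => f (stretch s x)))^\+%E x)%E.
  by apply: eq_integral => x _; exact: pE.
have -> : (\int[mu]_(x in stretch s @^-1` D) (EFin \o f)^\-%E (stretch s x) =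
  \int[mu]_(x in stretch s @^-1` D) (EFin \o (fun x => f (stretch s x)))^\-%E x)%E.
  by apply: eq_integral => x _; exact: mE.
rewrite -muleBr//; last by apply: fin_num_adde_defl; rewrite fin_numN; exact: im.
by rewrite fineM//= fin_numB; apply/andP; split; [exact: ip|exact: im].
Qed.

Lemma ae_stretch s (P : plane -> Prop) : s.1 != 0 -> s.2 != 0 ->
  {ae mu, forall x, P x} -> {ae mu, forall x, P (stretch s x)}.
Proof.
move=> s1 s2 [N [mN N0 PN]]; exists (stretch s @^-1` N); split.
- exact: measurable_stretch_preimage.
- have := leb2_stretch s1 s2 mN; rewrite N0 => /esym/eqP; rewrite mule_eq0.
  by rewrite eqe normr_eq0 mulf_eq0 (negbTE s1) (negbTE s2)/= => /eqP.
- by move=> x Px; apply: PN.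
Qed.

Lemma Rdominated_convergence D (fn : nat -> R * R -> R) f g : measurable D ->
  (forall n, measurable_fun D (fn n)) -> measurable_fun D f ->
  {ae mu, forall x, D x -> fn n x @[n --> \oo] --> f x} ->
  mu.-integrable D (EFin \o g) ->
  (forall n x, D x -> `|fn n x| <= g x) ->
  mu.-integrable D (EFin \o f) /\
  \int[mu]_(x in D) fn n x @[n --> \oo] --> \int[mu]_(x in D) f x.
Proof.
move=> mD mfn mf fnf gi fng.
have [fi _ cv] := @dominated_convergence _ _ _ mu D mD (fun n x => (fn n x)%:E)
  (fun x => (f x)%:E) (fun x => (g x)%:E)
  (fun n => (measurable_EFinP _ _).2 (mfn n)) ((measurable_EFinP _ _).2 mf)
  ltac:(apply: filterS fnf => x h Dx; apply: cvg_EFin; [exact: nearW|exact: h]) gi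
  ltac:(by apply: aeW => x n Dx; rewrite lee_fin fng).
split => //; apply: fine_cvg.
by rewrite fineK; [exact: cv|exact: integrable_fin_num].
Qed.

Lemma eq_Rintegral_ae D f g : measurable D -> measurable_fun D f -> measurable_fun D g ->
  {ae mu, forall x, D x -> f x = g x} ->
  \int[mu]_(x in D) f x = \int[mu]_(x in D) g x.
Proof.
move=> mD mf mg fg; rewrite /Rintegral; congr fine; apply: ae_eq_integral => //.
- exact/measurable_EFinP.
- exact/measurable_EFinP.
- by apply: filterS fg => x h Dx /=; rewrite h.
Qed.

Lemma integrable_mulr_bounded D f g C : measurable D -> mu.-integrable D (EFin \o f) ->
  measurable_fun D g -> (forall x, D x -> `|g x| <= C) ->
  mu.-integrable D (EFin \o (fun x => f x * g x)).
Proof.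
move=> mD fi mg gC.
have mf : measurable_fun D f by apply/measurable_EFinP; exact: measurable_int fi.
apply: (@le_integrable _ _ _ _ _ mD _ (EFin \o (fun x => C * `|f x|))).
- by apply/measurable_EFinP; exact: measurable_funM.
- move=> x Dx /=; rewrite lee_fin normrM mulrC; apply: le_trans (ler_norm _).
  by rewrite ler_wpM2r// gC.
- have /(integrableZl mD C) := integrable_norm fi.
  by apply: eq_integrable => // x _; rewrite /= EFinM.
Qed.

Lemma integrable_compact_support D f b : measurable D -> continuous f ->
  (forall x, ~ box 0 b x -> f x = 0) -> mu.-integrable D (EFin \o f).
Proof.
move=> mD cf f0; apply: (@integrableS _ _ _ _ setT) => //.
have [C Cf] : exists C, forall x, box 0 b x -> `|f x| <= C.
  have /compact_bounded[M [_ Mf]] : compact (f @` box 0 b).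
    apply: continuous_compact; last exact: compact_box.
    exact: continuous_subspaceT.
  by exists (M + 1) => x bx; apply: (Mf (M + 1)); [rewrite ltrDl|exists x].
rewrite (_ : EFin \o f = (EFin \o f) \_ (box 0 b)).
  apply/(integrable_mkcond _ (measurable_box _ _)).
  apply: (@bounded_integrable _ _ _ b C); [exact: measurable_box|by []| |by []].
  by apply: (@measurable_funS _ _ _ _ setT) => //; exact: continuous_plane_measurable.
apply/funext => x; rewrite patchE; case: ifPn => // /negP; rewrite inE => /f0 /= ->.
by [].
Qed.

End Integrals.

(** * Integration by parts against test functions *)

Section ByParts.
Variable R : realType.
Local Notation plane := (measurableTypeR R * measurableTypeR R)%type.
Local Notation mu := (@leb2 R).
Local Notation leb := (@lebesgue_measure R).
Implicit Types (D : set plane) (f g u : R * R -> R).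

Lemma is_derive_slice1 u t y : differentiable u (t, y) ->
  is_derive t 1 (fun t => u (t, y)) (partial 0 u (t, y)).
Proof.
move=> du.
have E : (fun h : R => h^-1 *: (((fun t => u (t, y)) \o shift t) (h *: (1 : R)) - u (t, y))) =
  (fun h : R => h^-1 *: ((u \o shift (t, y)) (h *: basis_vec R 0) - u (t, y))).
  apply/funext => h /=; congr (_ *: (u _ - _)).
  by rewrite /basis_vec/=; congr pair; rewrite /= scaler0 add0r.
have d0 : derivable u (t, y) (basis_vec R 0) by exact: diff_derivable.
split; last by rewrite /partial /derive E.
by rewrite /derivable E.
Qed.

Lemma is_derive_slice2 u t y : differentiable u (t, y) ->
  is_derive y 1 (fun y => u (t, y)) (partial 1 u (t, y)).
Proof.
move=> du.
have E : (fun h : R => h^-1 *: (((fun y => u (t, y)) \o shift y) (h *: (1 : R)) - u (t, y))) =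
  (fun h : R => h^-1 *: ((u \o shift (t, y)) (h *: basis_vec R 1) - u (t, y))).
  apply/funext => h /=; congr (_ *: (u _ - _)).
  by rewrite /basis_vec/=; congr pair; rewrite /= scaler0 add0r.
have d0 : derivable u (t, y) (basis_vec R 1) by exact: diff_derivable.
split; last by rewrite /partial /derive E.
by rewrite /derivable E.
Qed.

(** The fundamental theorem of calculus on a segment that contains the
    support. *)
Lemma integral_derive_compact (f df : R -> R) (b : R) : 0 < b ->
  (forall t : R, is_derive t 1 f (df t)) -> continuous df ->
  (forall t : R, ~ (- b <= t <= b) -> f t = 0) ->
  (forall t : R, ~ (- b <= t <= b) -> df t = 0) ->
  (\int[leb]_t (df t)%:E = 0)%E.
Proof.
move=> b0 fdf cdf f0 df0.
have cf : continuous f.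
  by move=> t; apply: differentiable_continuous; apply/derivable1_diffP; exact: ex_derive.
pose B := b + 1.
have -> : (\int[leb]_t (df t)%:E = \int[leb]_(t in `[(- B)%R, B]) (df t)%:E)%E.
  rewrite [in RHS]integral_mkcond; apply: eq_integral => t _.
  rewrite patchE; case: ifPn => // /negP; rewrite inE /= in_itv/= => h.
  by rewrite df0// => /andP[h1 h2]; apply: h; rewrite /B; apply/andP; split; lra.
rewrite (@continuous_FTC2 _ df f).
- by rewrite !f0 ?subee// /B => /andP[h1 h2]; lra.
- by rewrite /B; lra.
- exact: continuous_subspaceT.
- split; first by move=> t _; exact: ex_derive.
  + by apply: cvg_at_right_filter; exact: cf.
  + by apply: cvg_at_left_filter; exact: cf.
- by move=> t _; rewrite derive1E derive_val.
Qed.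

Lemma continuous_pair2 (T : topologicalType) (f g : T -> R) (x : T) :
  {for x, continuous f} -> {for x, continuous g} ->
  {for x, continuous (fun y => (f y, g y) : R * R)}.
Proof.
move=> cf cg.
exact: (@cvg_pair _ _ _ (nbhs x) (nbhs (f x)) (nbhs (g x)) _ _ _ f g cf cg).
Qed.

Lemma box0P b (x : R * R) : box 0 b x <-> (- b <= x.1 <= b /\ - b <= x.2 <= b).
Proof.
have E1 : (0 : R * R).1 = 0 by []. have E2 : (0 : R * R).2 = 0 by [].
by rewrite /box /mkset E1 E2 !add0r.
Qed.

(** Fubini reduces the claim to one variable. *)
Lemma integral_partial_compact i u (b : R) : smooth u ->
  (forall x, ~ box 0 b x -> u x = 0) -> (forall x, ~ box 0 b x -> partial i u x = 0) ->
  \int[mu]_x partial i u x = 0.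
Proof.
move=> su u0 pu0; set c := `|b| + 1.
have c0 : 0 < c by rewrite ltr_wpDl.
have bc : b <= c by rewrite (le_trans (ler_norm _))// lerDl.
have ofbox (x : R * R) : ~ (- c <= x.1 <= c) \/ ~ (- c <= x.2 <= c) -> ~ box 0 b x.
  move=> h /box0P[/andP[h1 h2] /andP[h3 h4]].
  by case: h; apply; apply/andP; split; move: bc; lra.
have cpu : continuous (partial i u) by apply: smooth_continuous; exact: smooth_partial.
have iu : mu.-integrable setT (EFin \o partial i u).
  by apply: (@integrable_compact_support _ _ _ b) => //; exact: measurableT.
have cslice1 y : continuous (fun t => (t, y) : R * R).
  by move=> t; apply: (@continuous_pair2 R id (cst y)); [exact: cvg_id|exact: cvg_cst].
have cslice2 t : continuous (fun y => (t, y) : R * R).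
  by move=> y; apply: (@continuous_pair2 R (cst t) id); [exact: cvg_cst|exact: cvg_id].
have [i0|i1] : i = 0 \/ i = 1.
  by case: i {u0 pu0 cpu iu} => [[|[|//]]] ?; [left|right]; exact: val_inj.
- subst i; rewrite /Rintegral.
  rewrite (_ : (\int[mu]_x (partial 0 u x)%:E = 0)%E)//.
  have := @integral21_prod_meas1 _ _ (measurableTypeR R) (measurableTypeR R) R
    lebesgue_measure lebesgue_measure _ iu => /= <-.
  rewrite /fubini_G; apply: integral0_eq => y _ /=.
  apply: (@integral_derive_compact (fun t => u (t, y)) _ c) => //.
  + by move=> t; apply: is_derive_slice1; exact: smooth_diff.
  + by move=> t; apply: continuous_comp; [exact: cslice1|exact: cpu].
  + by move=> t tc; apply: u0; apply: ofbox; left.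
  + by move=> t tc; apply: pu0; apply: ofbox; left.
- subst i; rewrite /Rintegral.
  rewrite (_ : (\int[mu]_x (partial 1 u x)%:E = 0)%E)//.
  have := @integral12_prod_meas1 _ _ (measurableTypeR R) (measurableTypeR R) R
    lebesgue_measure lebesgue_measure _ iu => /= <-.
  rewrite /fubini_F; apply: integral0_eq => y _ /=.
  apply: (@integral_derive_compact (fun t => u (y, t)) _ c) => //.
  + by move=> t; apply: is_derive_slice2; exact: smooth_diff.
  + by move=> t; apply: continuous_comp; [exact: cslice2|exact: cpu].
  + by move=> t tc; apply: u0; apply: ofbox; right.
  + by move=> t tc; apply: pu0; apply: ofbox; right.
Qed.

Lemma compact_in_box (A : set (R * R)) : compact A -> exists b, A `<=` box 0 b.
Proof.
move=> /compact_bounded[M [_ MA]]; exists (M + 1) => x Ax.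
have := MA (M + 1); rewrite ltrDl => /(_ ltr01 _ Ax) /=.
rewrite prod_normE/= ge_max => /andP[h1 h2].
by apply/box0P; rewrite -!ler_norml.
Qed.

Lemma partial_off_support i u x : ~ closure [set y | u y != 0] x -> partial i u x = 0.
Proof.
move=> xS.
have : nbhs x (~` closure [set y | u y != 0]).
  apply: open_nbhs_nbhs; split => //; apply: closed_openC; exact: closed_closure.
move=> ux.
have nu : \near x, u x = (cst 0 : R * R -> R) x.
  apply: filterS ux => y /= yS; apply/eqP/negPn/negP => uy; apply: yS.
  exact: subset_closure.
by rewrite /partial (near_eq_derive _ nu) derive_cst.
Qed.

Lemma off_support u x : ~ closure [set y | u y != 0] x -> u x = 0.
Proof.
by move=> xS; apply/eqP/negPn/negP => uy; apply: xS; exact: subset_closure.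
Qed.

Lemma test_in_box Om u : test_function Om u ->
  exists b, forall x, ~ box 0 b x -> ~ closure [set y | u y != 0] x.
Proof.
by move=> [_ /compact_in_box[b Sb] _]; exists b => x; apply: contra_not; exact: Sb.
Qed.

Lemma test_integrable Om D u f : test_function Om u -> measurable D -> continuous f ->
  (forall x, ~ closure [set y | u y != 0] x -> f x = 0) -> mu.-integrable D (EFin \o f).
Proof.
move=> /test_in_box[b ub] mD cf f0; apply: (@integrable_compact_support _ _ _ b) => //.
by move=> x /ub; exact: f0.
Qed.

(** The integral of the derivative of the product vanishes, since the product
    has compact support. *)
Lemma by_parts Om i u g : measurable (Om : set plane) -> test_function Om u -> smooth g ->
  \int[mu]_(x in Om) (g x * partial i u x) = - \int[mu]_(x in Om) (partial i g x * u x).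
Proof.
move=> mOm tu sg; have [su cS SOm] := tu.
have pE x : partial i (fun y => g y * u y) x = g x * partial i u x + partial i g x * u x.
  by rewrite partialM; [ring|exact: smooth_diff..].
have cpu : continuous (partial i u) by apply: smooth_continuous; exact: smooth_partial.
have cpg : continuous (partial i g) by apply: smooth_continuous; exact: smooth_partial.
have cu := smooth_continuous su; have cg := smooth_continuous sg.
have z1 x : ~ closure [set y | u y != 0] x -> g x * partial i u x = 0.
  by move=> /(partial_off_support i) ->; rewrite mulr0.
have z2 x : ~ closure [set y | u y != 0] x -> partial i g x * u x = 0.
  by move=> /off_support ->; rewrite mulr0.
have i1 : mu.-integrable Om (EFin \o (fun x => g x * partial i u x)).
  by apply: (test_integrable tu) => // x; apply: cvgM; [exact: cg|exact: cpu].
have i2 : mu.-integrable Om (EFin \o (fun x => partial i g x * u x)).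
  by apply: (test_integrable tu) => // x; apply: cvgM; [exact: cpg|exact: cu].
apply/eqP; rewrite -addr_eq0 -RintegralD//; apply/eqP.
have [b bS] := test_in_box tu.
rewrite -(@integral_partial_compact i (fun y => g y * u y) b).
- rewrite Rintegral_mkcond; apply: eq_Rintegral => x _; rewrite patchE pE.
  case: ifPn => // /negP; rewrite inE => xOm.
  have xS : ~ closure [set y | u y != 0] x by apply: contra_not xOm; exact: SOm.
  by rewrite z1// z2// addr0.
- exact: smoothM.
- by move=> x /bS /off_support ->; rewrite mulr0.
- by move=> x /bS xS; rewrite pE z1// z2// addr0.
Qed.

End ByParts.

(** * A flat smooth function on the line *)

Section FlatExponential.
Variable R : realType.
Implicit Types (z : R) (n : nat).

(** The powers of [1 / z] make the family closed under differentiation, so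
    that all its members are smooth. *)
Definition flatexp n z : R := if 0 < z then z^-1 ^+ n * expR (- z^-1) else 0.

Lemma flatexp_le0 n z : z <= 0 -> flatexp n z = 0.
Proof. by rewrite /flatexp ltNge => ->. Qed.

Lemma flatexp_ge0 n z : 0 <= flatexp n z.
Proof.
rewrite /flatexp; case: ifP => // z0.
by rewrite mulr_ge0 ?expR_ge0// exprn_ge0// invr_ge0 ltW.
Qed.

(** One term of the exponential series of [1 / z] already dominates the
    power; the bound settles differentiability at 0. *)
Lemma flatexp_bound n z : flatexp n z <= n.+2`!%:R * z ^+ 2.
Proof.
rewrite /flatexp; case: ifP => z0; last by rewrite mulr_ge0// sqr_ge0.
set y := z^-1; have y0 : 0 < y by rewrite invr_gt0.
have -> : z = y^-1 by rewrite /y invrK.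
rewrite expRN ler_pdivrMr ?expR_gt0//.
have h : y ^+ n.+2 / n.+2`!%:R <= expR y.
  by apply: le_trans (expR_ge1Dxn n.+1 (ltW y0)); rewrite lerDr.
have f0 : 0 < (n.+2`!%:R : R) by rewrite ltr0n fact_gt0.
have -> : y ^+ n = n.+2`!%:R * y^-1 ^+ 2 * (y ^+ n.+2 / n.+2`!%:R).
  rewrite exprVn -[n.+2]addn2 exprD; field.
  by rewrite (gt_eqF y0) gt_eqF// ltr0n fact_gt0.
by rewrite ler_pM2l// mulr_gt0// exprn_gt0// invr_gt0.
Qed.

Lemma is_derive_flatexp n z :
  is_derive z 1 (flatexp n) (flatexp n.+2 z - n%:R * flatexp n.+1 z).
Proof.
have [z0|z0|->] := ltgtP z 0.
- rewrite !flatexp_le0 ?ltW// mulr0 subr0.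
  have E0 : is_derive z 1 (cst 0 : R -> R) 0 by exact: is_derive_cst.
  apply: (near_eq_is_derive _ E0).
  by apply: filterS (lt_nbhsl z0) => y /ltW /flatexp_le0 ->.
- have zn0 : z != 0 by rewrite gt_eqF.
  have E : is_derive z 1 (fun y => y^-1 ^+ n * expR (- y^-1))
     (flatexp n.+2 z - n%:R * flatexp n.+1 z).
    have dV : is_derive z 1 (fun y : R => y^-1) (- z ^- 2).
      by have := @is_deriveV R id z 1 1 zn0; rewrite /GRing.scale/= mulr1; apply.
    have dN : is_derive z 1 (fun y : R => - y^-1) (z ^- 2).
      by have := is_deriveN dV; rewrite opprK.
    have dE : is_derive z 1 (fun y : R => expR (- y^-1)) (z ^- 2 * expR (- z^-1)).
      apply: (is_derive_eq (@is_derive1_comp _ expR (fun y => - y^-1) z _ _ (is_derive_expR _) dN)).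
      by rewrite mulrC.
    have dX := is_deriveX n dV.
    have -> : (fun y : R => y^-1 ^+ n * expR (- y^-1)) =
        ((fun y : R => y^-1) ^+ n) * (fun y => expR (- y^-1)).
      by apply/funext => y; rewrite mulrfctE exprfctE.
    apply: (is_derive_eq (is_deriveM dX dE)).
    rewrite /flatexp z0 /GRing.scale/=.
    rewrite -!exprVn exprfctE; case: (n) => [|m] /=.
      by rewrite !mul0r mulr0 addr0 subr0 expr0 mul1r.
    by rewrite !exprS; ring.
  apply: (near_eq_is_derive _ E).
  by apply: filterS (lt_nbhsr z0) => y y0; rewrite /flatexp y0.
- rewrite !flatexp_le0// mulr0 subr0.
  suff h : h^-1 *: ((flatexp n \o shift 0) (h *: (1 : R)) - flatexp n 0) @[h --> (0:R)^'] --> (0 : R).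
    by split; [apply: cvgP h|exact: cvg_lim h].
  pose C : R := n.+2`!%:R.
  apply/cvgr0Pnorm_lt => e e0; near=> h.
  have h0 : h != 0 by near: h; exact: nbhs_dnbhs_neq.
  rewrite /= addr0 (flatexp_le0 n (lexx 0)) subr0 /GRing.scale/= mulr1.
  rewrite normrM normfV ger0_norm ?flatexp_ge0// mulrC ltr_pdivrMr ?normr_gt0//.
  apply: (le_lt_trans (flatexp_bound _ _)).
  rewrite -(real_normK (num_real h)) expr2 mulrA ltr_pM2r ?normr_gt0//.
  have C0 : 0 < C by rewrite ltr0n fact_gt0.
  rewrite mulrC -ltr_pdivlMr//.
  near: h; apply: dnbhs0_lt; exact: divr_gt0.
Unshelve. all: by end_near. Qed.
End FlatExponential.

(** * The truncated logarithm *)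

Section Profile.
Variable R : realType.
Local Notation leb := (@lebesgue_measure R).

Lemma continuous_flatexp n : continuous (@flatexp R n).
Proof.
move=> z; apply: differentiable_continuous; apply/derivable1_diffP.
by have [] := is_derive_flatexp n z.
Qed.

Lemma smooth_flatexp n (u : R * R -> R) : smooth u -> smooth (fun x => flatexp n (u x)).
Proof.
move=> su; have du := smooth_diff su; apply/smooth_uptoP => k.
elim: k n => [|k ih] n.
  by apply/smooth_upto0 => x; have [] := partial_comp 0 (du x) (is_derive_flatexp n (u x)).
apply/smooth_uptoS; split=> [x|i].
  by have [] := partial_comp 0 (du x) (is_derive_flatexp n (u x)).
rewrite (_ : partial i _ =
  fun x => (flatexp n.+2 (u x) + (- n%:R) * flatexp n.+1 (u x)) * partial i u x).
  apply: smooth_uptoM; last by move/smooth_uptoP : (smooth_partial i su); apply.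
  by apply: smooth_uptoD => //; apply: smooth_uptoM => //; exact: smooth_upto_cst.
apply/funext => x.
by have [_ ->] := partial_comp i (du x) (is_derive_flatexp n (u x)); rewrite mulNr.
Qed.

(** A smooth decreasing cut-off of the half-line, equal to 1 at 0 and
    vanishing from 1 on. *)
Definition prof (u : R) : R := expR 1 * flatexp 0 (1 - u).
(** The opposite of the derivative of [prof]. *)
Definition dprof (u : R) : R := expR 1 * flatexp 2 (1 - u).

Lemma prof_ge0 u : 0 <= prof u.
Proof. by rewrite mulr_ge0 ?expR_ge0 ?flatexp_ge0. Qed.

Lemma dprof_ge0 u : 0 <= dprof u.
Proof. by rewrite mulr_ge0 ?expR_ge0 ?flatexp_ge0. Qed.

Lemma prof_le1 u : 0 <= u -> prof u <= 1.
Proof.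
move=> u0; rewrite /prof /flatexp; case: ifP => [u1|_]; last by rewrite mulr0.
rewrite expr0 mul1r -expRD expR_le1 subr_le0 invf_ge1//; lra.
Qed.

Lemma prof_eq0 u : 1 <= u -> prof u = 0.
Proof. by move=> u1; rewrite /prof flatexp_le0 ?mulr0// subr_le0. Qed.

Lemma dprof_eq0 u : 1 <= u -> dprof u = 0.
Proof. by move=> u1; rewrite /dprof flatexp_le0 ?mulr0// subr_le0. Qed.

Lemma dprof_bound u : dprof u <= 2 * expR 1.
Proof.
rewrite /dprof mulrC ler_pM2r ?expR_gt0// /flatexp; case: ifP => // u1.
set y := (1 - u)^-1; have y0 : 0 <= y by rewrite invr_ge0 ltW.
rewrite expRN ler_pdivrMr ?expR_gt0//.
have := expR_ge1Dxn 1 y0; rewrite (_ : (2`!)%N = 2%N)//; lra.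
Qed.

Lemma dprof_lower u : 0 <= u <= 13 / 16 -> expR (- 5) <= dprof u.
Proof.
move=> /andP[u0 u1]; rewrite /dprof /flatexp ifT; last lra.
rewrite mulrCA -expRD; set y := (1 - u)^-1.
have u10 : 0 < 1 - u by lra.
have y1 : 1 <= y by rewrite /y invf_ge1//; lra.
have y2 : y <= 6 by rewrite /y -[6]invrK lef_pV2 ?posrE//; lra.
rewrite -[leLHS]mul1r; apply: ler_pM => //; rewrite ?expR_ge0//.
  by rewrite exprn_ege1.
by rewrite ler_expR; lra.
Qed.

Let is_derive_onem (u : R) : is_derive u 1 (fun u : R => 1 - u) (- 1).
Proof.
have h1 : is_derive u 1 (cst 1 : R -> R) 0 by exact: is_derive_cst.
have h2 : is_derive u 1 (id : R -> R) 1 by exact: is_derive_id.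
by have h3 := is_deriveB h1 h2; apply: (is_derive_eq h3); rewrite sub0r.
Qed.

Lemma is_derive_prof (u : R) : is_derive u 1 prof (- dprof u).
Proof.
have d1 := is_derive_onem u.
have d2 := @is_derive1_comp _ _ (fun u : R => 1 - u) u _ _ (is_derive_flatexp 0 (1 - u)) d1.
apply: (is_derive_eq (is_deriveZ (expR 1) d2)).
by rewrite /dprof /GRing.scale/= mul0r subr0; ring.
Qed.

(** The integral of [prof w / w] over [w] from [u] to 1, a truncation of
    [ln (1 / u)], written in the variable [y = 1 - w]. The integrand vanishes
    for negative [y], so that the lower bound [- 1] lets the fundamental
    theorem of calculus be applied at interior points. *)
Definition logprof (u : R) : R :=
  \int[leb]_(y in `[-1, 1 - u]) (expR 1 * flatexp 0 y / (1 - y)).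

Lemma logprof_eq0 u : 1 <= u -> logprof u = 0.
Proof.
move=> u1; rewrite /logprof (_ : \int[leb]_(y in _) _ = \int[leb]_(y in `[-1, 1 - u]) 0).
  by rewrite Rintegral_cst ?mul0r.
apply: eq_Rintegral => y; rewrite inE/= in_itv/= => /andP[_ y1].
by rewrite flatexp_le0 ?mulr0 ?mul0r//; lra.
Qed.

Lemma is_derive_logprof (u : R) : 0 < u -> is_derive u 1 logprof (- (prof u / u)).
Proof.
move=> u0; have [u2|u2] := ltP u 2; last first.
  rewrite prof_eq0; last lra.
  rewrite mul0r oppr0.
  have E0 : is_derive u 1 (cst 0 : R -> R) 0 by exact: is_derive_cst.
  apply: (near_eq_is_derive _ E0).
  have u1 : 1 < u by lra.
  by apply: filterS (lt_nbhsr u1) => y /ltW /logprof_eq0 ->.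
pose q := fun y : R => expR 1 * flatexp 0 y / (1 - y).
have cq y : y < 1 -> {for y, continuous q}.
  move=> y1; apply: cvgM.
    by apply: cvgM; [exact: cvg_cst|exact: continuous_flatexp].
  apply: cvgV; first by rewrite subr_eq0 gt_eqF.
  by apply: cvgB; [exact: cvg_cst|exact: cvg_id].
have [d1 d2] : derivable (fun x : R => \int[leb]_(t in `[-1, x]) q t) (1 - u) 1 /\
    derive1 (fun x : R => \int[leb]_(t in `[-1, x]) q t) (1 - u) = q (1 - u).
  apply: (@continuous_FTC1_closed _ q (-1) (1 - u) (1 - u / 2)); [lra| |lra|].
  - apply: continuous_compact_integrable; first exact: segment_compact.
    apply/subspace_continuousP => y; rewrite /= in_itv/= => /andP[_ y1].
    by apply: cvg_within_filter; apply: cq; lra.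
  - by apply: cq; lra.
have d3 : is_derive (1 - u) 1 (fun x : R => \int[leb]_(t in `[-1, x]) q t) (q (1 - u)).
  by split; [exact: d1|rewrite -derive1E; exact: d2].
have d4 := is_derive_onem u.
apply: (is_derive_eq (@is_derive1_comp _ _ (fun u : R => 1 - u) u _ _ d3 d4)).
by rewrite /q /prof (_ : 1 - (1 - u) = u) ?mulrN1//; ring.
Qed.

Lemma logprof_anti (u v : R) : 0 < u -> u <= v -> logprof v <= logprof u.
Proof.
move=> u0; rewrite le_eqVlt => /predU1P[->//|uv].
have [||c] := @MVT R logprof (fun u => - (prof u / u)) u v uv.
- by move=> x; rewrite in_itv/= => /andP[ux _]; apply: is_derive_logprof; lra.
- apply/subspace_continuousP => y; rewrite /= in_itv/= => /andP[uy _].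
  apply: cvg_within_filter; apply: differentiable_continuous; apply/derivable1_diffP.
  by have [] := is_derive_logprof (lt_le_trans u0 uy).
rewrite in_itv/= => /andP[uc _] E; rewrite -subr_le0 E mulNr oppr_le0.
have c0 : 0 <= c by lra.
by rewrite mulr_ge0//; [rewrite mulr_ge0 ?prof_ge0 ?invr_ge0|lra].
Qed.

Lemma logprof_ge0 u : 0 < u -> 0 <= logprof u.
Proof.
move=> u0; have [u1|u1] := leP u 1.
  by rewrite -(logprof_eq0 (lexx 1)); exact: logprof_anti.
by rewrite logprof_eq0// ltW.
Qed.

Lemma logprof_gt0 u : 0 < u < 1 -> 0 < logprof u.
Proof.
move=> /andP[u0 u1].
have [||c] := @MVT R logprof (fun u => - (prof u / u)) u 1 u1.
- by move=> x; rewrite in_itv/= => /andP[ux _]; apply: is_derive_logprof; lra.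
- apply/subspace_continuousP => y; rewrite /= in_itv/= => /andP[uy _].
  apply: cvg_within_filter; apply: differentiable_continuous; apply/derivable1_diffP.
  by have [] := is_derive_logprof (lt_le_trans u0 uy).
rewrite in_itv/= => /andP[uc c1]; rewrite (logprof_eq0 (lexx 1)) sub0r mulNr => /oppr_inj ->.
have c0 : 0 < c by lra.
apply: mulr_gt0; last lra.
rewrite divr_gt0// /prof mulr_gt0 ?expR_gt0// /flatexp ifT; last lra.
by rewrite expr0 mul1r expR_gt0.
Qed.

End Profile.

(** * A test function whose Laplacian is a difference of two kernels *)

Section Kernel.
Variable R : realType.
Local Notation plane := (measurableTypeR R * measurableTypeR R)%type.
Local Notation mu := (@leb2 R).
Implicit Types (s t : R) (x y : R * R) (u : R * R -> R).

Definition lap u x : R := partial 0 (partial 0 u) x + partial 1 (partial 1 u) x.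

(** The squared Euclidean distance, which is smooth everywhere. *)
Definition dist2 y x : R := (x.1 - y.1) ^+ 2 + (x.2 - y.2) ^+ 2.

(** Balls are indexed by the square of their radius. *)
Definition eball y s : set (R * R) := [set x | dist2 y x < s].

(** A smooth version, compactly supported in [eball y s], of the logarithmic
    fundamental solution with pole [y]; the shift [t] removes the
    singularity. *)
Definition kphi s t y x : R := logprof (dist2 y x / s + t).
(** The part of the Laplacian of [kphi] that comes from the cut-off; it is
    bounded uniformly in [t]. *)
Definition kout s t y x : R :=
  4 / s * (dprof (dist2 y x / s + t) * (dist2 y x / s) / (dist2 y x / s + t)).
(** The part of the Laplacian of [kphi] that comes from the regularization of
    the pole; up to a constant factor it tends to the point mass at [y] when
    [t] tends to 0. *)
Definition kin s t y x : R :=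
  4 / s * (t * prof (dist2 y x / s + t) / (dist2 y x / s + t) ^+ 2).

Let co (i : 'I_2) x : R := if i == 0 then x.1 else x.2.

Let smooth_co i : smooth (co i).
Proof.
rewrite (_ : co i = if i == 0 then fst else snd); last first.
  by apply/funext => x; rewrite /co; case: ifP.
by case: ifP => _; [exact: smooth_fst|exact: smooth_snd].
Qed.

Let partial_co i x : partial i (co i) x = 1.
Proof.
rewrite (_ : co i = if i == 0 then fst else snd); last first.
  by apply/funext => z; rewrite /co; case: ifP.
by case: ifPn => i0; rewrite ?partial_fst ?partial_snd i0.
Qed.

Lemma smooth_dist2 y : smooth (dist2 y).
Proof.
apply: (@smoothD _ (fun x => (x.1 - y.1) ^+ 2) (fun x => (x.2 - y.2) ^+ 2)).
  by apply: (@smooth_sqr _ (fun x => x.1 - y.1)); apply: smoothB;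
    [exact: smooth_fst|exact: smooth_cst].
by apply: (@smooth_sqr _ (fun x => x.2 - y.2)); apply: smoothB;
  [exact: smooth_snd|exact: smooth_cst].
Qed.

Lemma dist2_ge0 y x : 0 <= dist2 y x.
Proof. by apply: addr_ge0; exact: sqr_ge0. Qed.

Lemma dist2_continuous y : continuous (dist2 y).
Proof. exact: smooth_continuous (smooth_dist2 y). Qed.

Lemma open_eball y s : open (eball y s).
Proof.
rewrite (_ : eball y s = dist2 y @^-1` [set` `]-oo, s[]); last first.
  by apply/seteqP; split => x; rewrite /eball /= in_itv.
by move/continuousP : (@dist2_continuous y); apply; exact: interval_open.
Qed.

Lemma measurable_eball y s : measurable (eball y s : set plane).
Proof. by apply: open_plane_measurable; exact: open_eball. Qed.

Lemma eball_box y s (r : R) : 0 <= r -> s <= r ^+ 2 -> eball y s `<=` box y r.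
Proof.
move=> r0 sr x /= xs.
have h1 : (x.1 - y.1) ^+ 2 <= r ^+ 2.
  by have := sqr_ge0 (x.2 - y.2); move: xs; rewrite /eball /dist2/=; lra.
have h2 : (x.2 - y.2) ^+ 2 <= r ^+ 2.
  by have := sqr_ge0 (x.1 - y.1); move: xs; rewrite /eball /dist2/=; lra.
have aux (a : R) : a ^+ 2 <= r ^+ 2 -> - r <= a <= r.
  by move=> h; rewrite -ler_norml -(ler_pXn2r (n := 2))// ?nnegrE// real_normK ?num_real.
by split; [have /andP[] := aux _ h1|have /andP[] := aux _ h2] => *; apply/andP; split; lra.
Qed.

Lemma eball_box0 y s : exists b, eball y s `<=` box 0 b.
Proof.
exists (`|y.1| + `|y.2| + `|s| + 1) => x /(@eball_box y s (`|s| + 1)).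
have r0 : 0 <= `|s| + 1 by rewrite addr_ge0.
move=> /(_ r0); have sr : s <= (`|s| + 1) ^+ 2.
  by have := ler_norm s; have := sqr_ge0 `|s|; rewrite sqrrD; have := normr_ge0 s; lra.
move=> /(_ sr)[/andP[h1 h2] /andP[h3 h4]]; apply/box0P.
have := ler_norm y.1; have := ler_norm y.2; have := ler_norm (- y.1); have := ler_norm (- y.2).
rewrite !normrN; have := normr_ge0 y.1; have := normr_ge0 y.2.
by move=> *; split; apply/andP; split; lra.
Qed.

Lemma eball_center y s : 0 < s -> eball y s y.
Proof. by move=> s0; rewrite /eball /dist2/= !subrr expr0n addr0. Qed.

Lemma leb2_eball_le y s : 0 <= s -> (mu (eball y s) <= (4 * s)%:E)%E.
Proof.
move=> s0; apply: (@le_trans _ _ (mu (box y (Num.sqrt s)))).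
  apply: le_measure; rewrite ?inE; [exact: measurable_eball|exact: measurable_box|].
  by apply: eball_box; rewrite ?sqrtr_ge0// sqr_sqrtr.
by rewrite leb2_box ?sqrtr_ge0// lee_fin exprMn sqr_sqrtr//; lra.
Qed.

Section Fixed.
Variables (s t : R) (y : R * R).
Hypotheses (s0 : 0 < s) (t0 : 0 < t).

Let w x : R := dist2 y x / s + t.

Let w_gt0 x : 0 < w x.
Proof. by rewrite /w ltr_wpDl// divr_ge0 ?dist2_ge0// ltW. Qed.

Let w_neq0 x : w x != 0. Proof. by rewrite gt_eqF. Qed.

Let smooth_w : smooth w.
Proof.
apply: smoothD; last exact: smooth_cst.
by apply: smoothM; [exact: smooth_dist2|exact: smooth_cst].
Qed.

Let w_diff x : differentiable w x. Proof. exact: smooth_diff. Qed.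

Let partial_dist2 i x : partial i (dist2 y) x = 2 * (co i x - co i y).
Proof.
have p1 (j : 'I_2) : partial i (fun x => (co j x - co j y) ^+ 2) x =
    2 * (co j x - co j y) * partial i (co j) x.
  rewrite (_ : (fun x => _ ^+ 2) = fun x => (co j x + - co j y) * (co j x + - co j y)).
    have dj : differentiable (fun x => co j x + - co j y) x.
      by apply: smooth_diff; apply: smoothD; [exact: smooth_co|exact: smooth_cst].
    rewrite partialM// partialD ?partial_cst ?addr0; [ring| |].
      by apply: smooth_diff; exact: smooth_co.
    exact: differentiable_cst.
  by apply/funext => z; rewrite expr2.
rewrite (_ : dist2 y = fun x => (co 0 x - co 0 y) ^+ 2 + (co 1 x - co 1 y) ^+ 2)//.
have sm (j : 'I_2) : differentiable (fun x => (co j x - co j y) ^+ 2) x.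
  by apply: smooth_diff; apply: smooth_sqr; apply: smoothB; [exact: smooth_co|exact: smooth_cst].
rewrite partialD// !p1.
have [->|->] : i = 0 \/ i = 1.
  by case: i {p1} => [[|[|//]]] ?; [left|right]; exact: val_inj.
- by rewrite partial_co [partial 0 (co 1) x]partial_snd/=; ring.
- by rewrite partial_co [partial 1 (co 0) x]partial_fst/=; ring.
Qed.

Let partial_w i x : partial i w x = 2 / s * (co i x - co i y).
Proof.
have dd : differentiable (dist2 y) x by apply: smooth_diff; exact: smooth_dist2.
rewrite /w partialD ?partial_cst//; last exact: differentiableM.
by rewrite partialM// partial_cst partial_dist2; ring.
Qed.

Lemma partial_kphi i : partial i (kphi s t y) =
  fun x => (- (2 / s)) * (prof (w x) * (w x)^-1 * (co i x - co i y)).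
Proof.
apply/funext => x.
have [_ ->] := partial_comp i (w_diff x) (is_derive_logprof (w_gt0 x)).
by rewrite partial_w; ring.
Qed.

Let smooth_prof_w : smooth (fun x => prof (w x)).
Proof.
apply: smoothZ; apply: smooth_flatexp; apply: smoothB => //; exact: smooth_cst.
Qed.

Let smooth_dprof_w : smooth (fun x => dprof (w x)).
Proof.
apply: smoothZ; apply: smooth_flatexp; apply: smoothB => //; exact: smooth_cst.
Qed.

Lemma smooth_kphi : smooth (kphi s t y).
Proof.
apply: smooth_step => [x|i].
  by have [] := partial_comp 0 (w_diff x) (is_derive_logprof (w_gt0 x)).
rewrite partial_kphi; apply: smoothZ; apply: smoothM.
  by apply: smoothM => //; exact: smoothV.
by apply: smoothB; [exact: smooth_co|exact: smooth_cst].
Qed.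

Lemma smooth_kout : smooth (kout s t y).
Proof.
apply: smoothZ; apply: smoothM; last exact: smoothV.
by apply: smoothM => //; apply: smoothM; [exact: smooth_dist2|exact: smooth_cst].
Qed.

Lemma smooth_kin : smooth (kin s t y).
Proof.
apply: smoothZ; apply: smoothM; first exact: smoothZ.
apply: smoothV; last exact: smooth_sqr.
by move=> x; rewrite expf_neq0//; exact: w_neq0.
Qed.

(** In the plane the logarithm of the squared distance is harmonic away from
    its pole, so that only the cut-off and the shift contribute. *)
Lemma lap_kphi x : lap (kphi s t y) x = kout s t y x - kin s t y x.
Proof.
have p2 i : partial i (partial i (kphi s t y)) x =
   (- (2 / s)) * (prof (w x) * (w x)^-1 +
    (co i x - co i y) ^+ 2 * (2 / s) * (- dprof (w x) * (w x)^-1 - prof (w x) * (w x)^-1 * (w x)^-1)).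
  have dA : differentiable (fun x => prof (w x)) x by exact: smooth_diff.
  have dB : differentiable (fun x => (w x)^-1) x by apply: smooth_diff; exact: smoothV.
  have dAB : differentiable (fun x => prof (w x) * (w x)^-1) x by exact: differentiableM.
  have dC : differentiable (fun x => co i x - co i y) x.
    by apply: smooth_diff; apply: smoothB; [exact: smooth_co|exact: smooth_cst].
  rewrite partial_kphi.
  rewrite (@partialM _ _ (fun=> - (2 / s))); [|exact: differentiable_cst|exact: differentiableM].
  rewrite partial_cst mulr0 addr0; congr (_ * _).
  rewrite partialM// partialM// partialV//.
  have [_ ->] := partial_comp i (w_diff x) (is_derive_prof (w x)).
  rewrite partialD ?partial_cst ?partial_co; [|exact: smooth_diff|exact: differentiable_cst].
  by rewrite partial_w; ring.
rewrite /lap !p2 /kout /kin -/(w x) /dist2.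
have E : dist2 y x / s = w x - t by rewrite /w addrK.
have E' : (x.1 - y.1) ^+ 2 + (x.2 - y.2) ^+ 2 = s * (w x - t).
  by rewrite -E /dist2; field; rewrite gt_eqF.
rewrite E' /co/=.
transitivity (- (2 / s) * (2 * (prof (w x) * (w x)^-1) + ((x.1 - y.1) ^+ 2 + (x.2 - y.2) ^+ 2)
 * (2 / s) * (- dprof (w x) * (w x)^-1 - prof (w x) * (w x)^-1 * (w x)^-1))); first by ring.
rewrite E'; field.
by rewrite w_neq0 gt_eqF.
Qed.

Let w_ge1 x : ~ eball y s x -> 1 <= w x.
Proof.
move=> /negP; rewrite -leNgt => h.
have : 1 <= dist2 y x / s by rewrite ler_pdivlMr// mul1r.
by rewrite /w; move: t0; lra.
Qed.

Lemma kphi_off x : ~ eball y s x -> kphi s t y x = 0.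
Proof. by move=> /w_ge1; exact: logprof_eq0. Qed.

Lemma kout_off x : ~ eball y s x -> kout s t y x = 0.
Proof. by move=> /w_ge1 h; rewrite /kout dprof_eq0// !mul0r mulr0. Qed.

Lemma kin_off x : ~ eball y s x -> kin s t y x = 0.
Proof. by move=> /w_ge1 h; rewrite /kin prof_eq0// mulr0 mul0r mulr0. Qed.

Lemma kphi_ge0 x : 0 <= kphi s t y x.
Proof. exact: (logprof_ge0 (w_gt0 x)). Qed.

Lemma kout_ge0 x : 0 <= kout s t y x.
Proof.
apply: mulr_ge0; first by rewrite divr_ge0// ltW.
apply: divr_ge0; last exact: ltW (w_gt0 x).
by apply: mulr_ge0; [exact: dprof_ge0|rewrite divr_ge0 ?dist2_ge0// ltW].
Qed.

Lemma kin_ge0 x : 0 <= kin s t y x.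
Proof.
apply: mulr_ge0; first by rewrite divr_ge0// ltW.
apply: divr_ge0; last exact: sqr_ge0.
by apply: mulr_ge0; [exact: ltW|exact: prof_ge0].
Qed.

Lemma kout_le x : kout s t y x <= 8 * expR 1 / s.
Proof.
rewrite /kout -/(w x).
have h1 : dist2 y x / s / w x <= 1.
  by rewrite ler_pdivrMr// mul1r /w lerDl ltW.
have h2 : 0 <= dist2 y x / s / w x by rewrite !divr_ge0 ?dist2_ge0// ltW.
have h3 : dprof (w x) * (dist2 y x / s) / w x <= 2 * expR 1.
  rewrite -mulrA -[leRHS]mulr1; apply: ler_pM => //; [exact: dprof_ge0|exact: dprof_bound].
rewrite (_ : 8 * expR 1 / s = 4 / s * (2 * expR 1)); last by ring.
by rewrite ler_pM2l// divr_gt0.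
Qed.

Lemma kin_le x (d : R) : 0 < d -> d <= dist2 y x -> kin s t y x <= 4 * s * t / d ^+ 2.
Proof.
move=> d0 dx; rewrite /kin -/(w x).
have wd : d / s <= w x.
  by rewrite /w; apply: ler_wpDr; [exact: ltW|rewrite ler_pM2r ?invr_gt0].
have h1 : prof (w x) <= 1 by apply: prof_le1; exact: ltW.
have h2 : t * prof (w x) / w x ^+ 2 <= t * 1 / (d / s) ^+ 2.
  apply: ler_pM.
  - by apply: mulr_ge0; [exact: ltW|exact: prof_ge0].
  - by rewrite invr_ge0 sqr_ge0.
  - by rewrite ler_pM2l.
  - rewrite lef_pV2 ?posrE ?exprn_gt0 ?divr_gt0//.
    by rewrite ler_pXn2r ?nnegrE// ltW// divr_gt0.
apply: (@le_trans _ _ (4 / s * (t * 1 / (d / s) ^+ 2))).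
  by rewrite ler_pM2l// divr_gt0.
rewrite le_eqVlt; apply/orP; left; apply/eqP; field.
by rewrite !gt_eqF.
Qed.

(** On an annulus strictly inside the ball the cut-off has a definite slope. *)
Lemma kout_ge x : t <= 1 / 4 -> s / 16 <= dist2 y x <= 9 / 16 * s ->
  expR (- 5) / (20 * s) <= kout s t y x.
Proof.
move=> t4 /andP[d1 d2]; rewrite /kout -/(w x).
have r1 : 1 / 16 <= dist2 y x / s by rewrite ler_pdivlMr//; lra.
have r2 : dist2 y x / s <= 9 / 16 by rewrite ler_pdivrMr.
have wx : 1 / 16 <= w x <= 13 / 16.
  by apply/andP; split; rewrite /w; move: t0; lra.
have g : expR (- 5) <= dprof (w x) by apply: dprof_lower; move: wx => /andP[? ?]; apply/andP; split; lra.
have q : 1 / 16 <= dist2 y x / s / w x.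
  rewrite ler_pdivlMr//; apply: le_trans r1; rewrite ler_piMr//.
  by move/andP : wx => [_ ?]; lra.
have e0 := expR_gt0 (- 5 : R).
have -> : expR (- 5) / (20 * s) = 4 / s * (expR (- 5) * (1 / 80)).
  by field; rewrite gt_eqF.
rewrite ler_pM2l ?divr_gt0// -mulrA; apply: ler_pM; [exact: ltW|lra|exact: g|].
by apply: le_trans q; lra.
Qed.

Lemma test_kphi (Om : set (R * R)) : eball y s `<=` Om -> test_function Om (kphi s t y).
Proof.
move=> sOm; pose K := [set x | dist2 y x <= s * (1 - t)].
have cK : closed K.
  rewrite (_ : K = dist2 y @^-1` [set` `]-oo, s * (1 - t)]]); last first.
    by apply/seteqP; split => x; rewrite /K /= in_itv.
  by move/continuous_closedP : (@dist2_continuous y); apply; exact: interval_closed.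
have KS : K `<=` eball y s.
  move=> x /=; rewrite /K/= => h; apply: (le_lt_trans h).
  by rewrite gtr_pMr//; move: t0; lra.
have SK : closure [set x | kphi s t y x != 0] `<=` K.
  rewrite closureE => x; apply; split => // z /=; apply: contra_neqP => /negP.
  rewrite -ltNge => h; apply: logprof_eq0; rewrite -lerBlDr ler_pdivlMr//.
  by rewrite mulrC ltW.
split; first exact: smooth_kphi.
- have [b sb] := eball_box0 y s.
  apply: (@subclosed_compact _ _ (box 0 b)).
  + exact: closed_closure.
  + exact: compact_box.
  + by move=> x /SK /KS /sb.
- by move=> x /SK /KS /sOm.
Qed.

End Fixed.
End Kernel.

(** * Quadratic polynomials as comparison functions *)

Section Quadratic.
Variable R : realType.

Definition quad (a0 a1 a2 b1 b2 b3 : R) (x : R * R) : R :=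
  a0 + a1 * x.1 + a2 * x.2 + b1 * x.1 ^+ 2 + b2 * (x.1 * x.2) + b3 * x.2 ^+ 2.

Let lin (a0 a1 a2 : R) (x : R * R) : R := a0 + a1 * x.1 + a2 * x.2.

Let smooth_lin a0 a1 a2 : smooth (lin a0 a1 a2).
Proof.
by apply: smoothD; [apply: smoothD; [exact: smooth_cst|]|]; apply: smoothZ;
  [exact: smooth_fst|exact: smooth_snd].
Qed.

Let partial_lin i a0 a1 a2 x : partial i (lin a0 a1 a2) x = if i == 0 then a1 else a2.
Proof.
have d1 : differentiable (fun x : R * R => a1 * x.1) x.
  by apply: smooth_diff; apply: smoothZ; exact: smooth_fst.
have d2 : differentiable (fun x : R * R => a2 * x.2) x.
  by apply: smooth_diff; apply: smoothZ; exact: smooth_snd.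
have d0 : differentiable (fun x : R * R => a0) x by exact: differentiable_cst.
rewrite /lin partialD//; last exact: differentiableD.
rewrite partialD// partial_cst.
rewrite partialM ?partial_cst ?partial_fst//; last exact: differentiable_fst.
rewrite partialM ?partial_cst ?partial_snd//; last exact: differentiable_snd.
by case: (i == 0) => /=; ring.
Qed.

Let quadE a0 a1 a2 b1 b2 b3 : quad a0 a1 a2 b1 b2 b3 =
  fun x => lin a0 a1 a2 x + (x.1 * lin 0 b1 b2 x + x.2 * lin 0 0 b3 x).
Proof. by apply/funext => x; rewrite /quad /lin; ring. Qed.

Lemma smooth_quad a0 a1 a2 b1 b2 b3 : smooth (quad a0 a1 a2 b1 b2 b3).
Proof.
rewrite quadE; apply: smoothD => //; apply: smoothD; apply: smoothM => //.
  exact: smooth_fst.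
exact: smooth_snd.
Qed.

Let partial_quad i a0 a1 a2 b1 b2 b3 : partial i (quad a0 a1 a2 b1 b2 b3) =
  if i == 0 then lin a1 (2 * b1) b2 else lin a2 b2 (2 * b3).
Proof.
apply/funext => x; rewrite quadE.
have dl c0 c1 c2 : differentiable (lin c0 c1 c2) x by exact: smooth_diff.
have df : differentiable (fst : R * R -> R) x by exact: differentiable_fst.
have ds : differentiable (snd : R * R -> R) x by exact: differentiable_snd.
have d1 : differentiable (fun x : R * R => x.1 * lin 0 b1 b2 x) x by exact: differentiableM.
have d2 : differentiable (fun x : R * R => x.2 * lin 0 0 b3 x) x by exact: differentiableM.
rewrite (@partialD _ i (lin a0 a1 a2))//; last exact: differentiableD.
rewrite (@partialD _ i (fun x => x.1 * lin 0 b1 b2 x) (fun x => x.2 * lin 0 0 b3 x))//.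
rewrite (@partialM _ i fst (lin 0 b1 b2))// (@partialM _ i snd (lin 0 0 b3))//.
rewrite !partial_lin partial_fst partial_snd /lin.
by case: (i == 0) => /=; ring.
Qed.

Lemma lap_quad a0 a1 a2 b1 b2 b3 x : lap (quad a0 a1 a2 b1 b2 b3) x = 2 * b1 + 2 * b3.
Proof. by rewrite /lap !partial_quad/= !partial_lin. Qed.

End Quadratic.

(** * Masses of the kernels *)

Section MeanValue.
Variable R : realType.
Local Notation plane := (measurableTypeR R * measurableTypeR R)%type.
Local Notation mu := (@leb2 R).
Implicit Types (s t : R) (x y : R * R) (u w : R * R -> R).

Lemma integrable_scale (D : set plane) c u : measurable D -> mu.-integrable D (EFin \o u) ->
  mu.-integrable D (EFin \o (fun x => c * u x)).
Proof.
move=> mD iu; have := integrableZl mD c iu.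
by apply: eq_integrable => // x _; rewrite /= EFinM.
Qed.

Lemma integrable_add (D : set plane) u w : measurable D -> mu.-integrable D (EFin \o u) ->
  mu.-integrable D (EFin \o w) -> mu.-integrable D (EFin \o (fun x => u x + w x)).
Proof.
move=> mD iu iw; have := integrableD mD iu iw.
by apply: eq_integrable => // x _; rewrite /= EFinD.
Qed.

Lemma test_partial (Om : set (R * R)) i u : test_function Om u -> test_function Om (partial i u).
Proof.
move=> [su cS sOm].
have sub : closure [set x | partial i u x != 0] `<=` closure [set x | u x != 0].
  rewrite [X in X `<=` _]closureE => x; apply; split; first exact: closed_closure.
  by move=> z /=; apply: contra_neqP => /partial_off_support.
split; first exact: smooth_partial.
- by apply: subclosed_compact cS sub; exact: closed_closure.
- exact: subset_trans sOm.
Qed.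

Lemma by_parts_lap (Om : set (R * R)) u g : measurable (Om : set plane) ->
  test_function Om u -> smooth g ->
  \int[mu]_(x in Om) (g x * lap u x) = \int[mu]_(x in Om) (lap g x * u x).
Proof.
move=> mOm tu sg.
have tpu i := test_partial i tu; have spg i := smooth_partial i sg.
have [su _ _] := tu; have tppu i := test_partial i (tpu i).
have sppu i := smooth_partial i (smooth_partial i su).
have sppg i := smooth_partial i (spg i).
have p i : \int[mu]_(x in Om) (g x * partial i (partial i u) x) =
   \int[mu]_(x in Om) (partial i (partial i g) x * u x).
  by rewrite by_parts// by_parts// opprK.
have i1 i : mu.-integrable Om (EFin \o (fun x => g x * partial i (partial i u) x)).
  apply: (test_integrable (tppu i)) => // [x|x /off_support ->]; last by rewrite mulr0.
  by apply: cvgM; exact: smooth_continuous.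
have i2 i : mu.-integrable Om (EFin \o (fun x => partial i (partial i g) x * u x)).
  apply: (test_integrable tu) => // [x|x /off_support ->]; last by rewrite mulr0.
  by apply: cvgM; exact: smooth_continuous.
have e1 := RintegralD mOm (i1 0) (i1 1); have e2 := RintegralD mOm (i2 0) (i2 1).
apply: (@etrans _ _ (\int[mu]_(x in Om)
    (g x * partial 0 (partial 0 u) x + g x * partial 1 (partial 1 u) x))).
  by apply: eq_Rintegral => x _; rewrite /lap mulrDr.
apply: (etrans e1); apply: (etrans (congr2 +%R (p 0) (p 1))); apply: (etrans (esym e2)).
by apply: eq_Rintegral => x _; rewrite /lap mulrDl.
Qed.

Lemma continuous_eball_integrable y s u : continuous u ->
  mu.-integrable (eball y s) (EFin \o u).
Proof.
move=> cu; have [b sb] := eball_box0 y s.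
have [C uC] : exists C, forall x, box 0 b x -> `|u x| <= C.
  have /compact_bounded[M [_ Mf]] : compact (u @` box 0 b).
    apply: continuous_compact; last exact: compact_box.
    exact: continuous_subspaceT.
  by exists (M + 1) => x bx; apply: (Mf (M + 1)); [rewrite ltrDl|exists x].
apply: (bounded_integrable (b := b) (C := C)) => //; first exact: measurable_eball.
- apply: (@measurable_funS _ _ _ _ setT) => //; exact: continuous_plane_measurable.
- by move=> x /sb; exact: uC.
Qed.

Lemma Rintegral_lower (A B : set plane) u c : measurable A -> measurable B -> A `<=` B ->
  mu.-integrable B (EFin \o u) -> (forall x, B x -> 0 <= u x) ->
  (forall x, A x -> c <= u x) -> (mu A < +oo)%E ->
  c * fine (mu A) <= \int[mu]_(x in B) u x.
Proof.
move=> mA mB AB iu u0 uc muA.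
have iuA : mu.-integrable A (EFin \o u) by exact: integrableS iu.
apply: (@le_trans _ _ (\int[mu]_(x in A) u x)).
  rewrite -Rintegral_cst//; apply: le_Rintegral => //.
  apply: (@measurable_bounded_integrable _ _ _ mu (cst c)) => //.
  by exists `|c|; split=> [|M cM z _]; [exact: num_real|exact: ltW].
rewrite /Rintegral fine_le//; [exact: integrable_fin_num|exact: integrable_fin_num|].
apply: ge0_subset_integral => //; first exact: measurable_int iu.
Qed.

Lemma fine_leb2_eball y s : 0 <= s -> 0 <= fine (mu (eball y s)) <= 4 * s.
Proof.
move=> s0; rewrite fine_ge0//=.
have h := leb2_eball_le y s0.
have fin : mu (eball y s) \is a fin_num.
  by rewrite ge0_fin_numE//; apply: le_lt_trans h _; rewrite ltry.
by rewrite -lee_fin fineK.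
Qed.

Definition kmass s t y : R := \int[mu]_(x in eball y s) kphi s t y x.

(** The kernel is the Laplacian of a test function; integrate by parts twice. *)
Lemma kernel_laplacian s t y g : 0 < s -> 0 < t -> smooth g ->
  \int[mu]_(x in eball y s) (g x * (kout s t y x - kin s t y x)) =
  \int[mu]_(x in eball y s) (lap g x * kphi s t y x).
Proof.
move=> s0 t0 sg; rewrite -by_parts_lap//; [|exact: measurable_eball|exact: test_kphi].
by apply: eq_Rintegral => x _; rewrite lap_kphi.
Qed.

Lemma lap_cst (c : R) x : lap (fun=> c) x = 0.
Proof.
have -> : (fun=> c) = quad c 0 0 0 0 0.
  by apply/funext => z; rewrite /quad !mul0r !addr0.
by rewrite lap_quad mulr0 addr0.
Qed.

Lemma kout_integrable s t y : 0 < s -> 0 < t -> mu.-integrable (eball y s) (EFin \o kout s t y).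
Proof.
by move=> s0 t0; apply: continuous_eball_integrable; apply: smooth_continuous; exact: smooth_kout.
Qed.

Lemma kin_integrable s t y : 0 < s -> 0 < t -> mu.-integrable (eball y s) (EFin \o kin s t y).
Proof.
by move=> s0 t0; apply: continuous_eball_integrable; apply: smooth_continuous; exact: smooth_kin.
Qed.

Lemma kphi_integrable s t y : 0 < s -> 0 < t -> mu.-integrable (eball y s) (EFin \o kphi s t y).
Proof.
by move=> s0 t0; apply: continuous_eball_integrable; apply: smooth_continuous; exact: smooth_kphi.
Qed.

(** The two kernels carry the same mass, because they differ by the Laplacian
    of a compactly supported function. *)
Lemma kernel_mass s t y : 0 < s -> 0 < t ->
  \int[mu]_(x in eball y s) kin s t y x = \int[mu]_(x in eball y s) kout s t y x.
Proof.
move=> s0 t0; have := kernel_laplacian y s0 t0 (smooth_cst 1).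
under eq_Rintegral do rewrite mul1r.
under [in RHS]eq_Rintegral do rewrite lap_cst mul0r.
rewrite Rintegral_cst ?mul0r; last exact: measurable_eball.
rewrite RintegralB//; [|exact: measurable_eball|exact: kout_integrable|exact: kin_integrable].
by move=> /eqP; rewrite subr_eq0 => /eqP.
Qed.

Lemma kout_mass_le s t y : 0 < s -> 0 < t ->
  \int[mu]_(x in eball y s) kout s t y x <= 32 * expR 1.
Proof.
move=> s0 t0; have /andP[m0 m1] := fine_leb2_eball y (ltW s0).
have c0 : 0 <= 8 * expR 1 / s by rewrite divr_ge0 ?mulr_ge0 ?expR_ge0// ltW.
apply: (@le_trans _ _ (\int[mu]_(x in eball y s) (8 * expR 1 / s))).
  apply: le_Rintegral; [exact: measurable_eball|exact: kout_integrable| |].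
    by apply: continuous_eball_integrable; exact: cst_continuous.
  by move=> x _; exact: kout_le.
rewrite Rintegral_cst; last exact: measurable_eball.
apply: (le_trans (ler_wpM2l c0 m1)).
by rewrite le_eqVlt; apply/orP; left; apply/eqP; field; rewrite gt_eqF.
Qed.

Lemma kout_mass_ge s t y : 0 < s -> 0 < t <= 1 / 4 ->
  expR (- 5) / 320 <= \int[mu]_(x in eball y s) kout s t y x.
Proof.
move=> s0 /andP[t0 t4]; pose q := Num.sqrt s / 8.
have qs : q ^+ 2 = s / 64 by rewrite /q exprMn sqr_sqrtr ?ltW// exprVn; congr (_ / _); ring.
have q0 : 0 < q by rewrite divr_gt0// sqrtr_gt0.
have E2 : (2 * q) ^+ 2 = s / 16 by transitivity (4 * q ^+ 2); [ring|rewrite qs; field].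
have E4 : (4 * q) ^+ 2 = s / 4 by transitivity (16 * q ^+ 2); [ring|rewrite qs; field].
pose z : R * R := (y.1 + 3 * q, y.2 + 3 * q).
have zb x : box z q x -> s / 16 <= dist2 y x <= 9 / 16 * s.
  move=> [/= /andP[h1 h2] /andP[h3 h4]]; rewrite /dist2.
  have a1 : (2 * q) ^+ 2 <= (x.1 - y.1) ^+ 2 <= (4 * q) ^+ 2.
    by rewrite !ler_pXn2r ?nnegrE//; move: q0; try apply/andP; try split; lra.
  have a2 : (2 * q) ^+ 2 <= (x.2 - y.2) ^+ 2 <= (4 * q) ^+ 2.
    by rewrite !ler_pXn2r ?nnegrE//; move: q0; try apply/andP; try split; lra.
  move: a1 a2; rewrite E2 E4 => /andP[? ?] /andP[? ?]; apply/andP; split; lra.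
have := @Rintegral_lower (box z q) (eball y s) (kout s t y) (expR (- 5) / (20 * s)).
move=> /(_ (measurable_box _ _) (measurable_eball _ _)).
rewrite (leb2_box _ (ltW q0)) => /= h.
have -> : expR (- 5) / 320 = expR (- 5) / (20 * s) * (2 * q) ^+ 2.
  by rewrite E2; field; rewrite gt_eqF.
apply: h.
- by move=> x /zb /andP[_ h]; rewrite /eball /=; lra.
- exact: kout_integrable.
- by move=> x _; exact: kout_ge0.
- by move=> x /zb; exact: kout_ge.
- by rewrite ltry.
Qed.

Lemma eball_nbhs y s : 0 < s -> nbhs y (eball y s).
Proof.
by move=> s0; apply: open_nbhs_nbhs; split; [exact: open_eball|exact: eball_center].
Qed.

Lemma nbhs_eball y (A : set (R * R)) : nbhs y A -> exists2 d, 0 < d & eball y d `<=` A.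
Proof.
move=> /nbhs_ballP[e /= e0 yA]; exists (e ^+ 2); first exact: exprn_gt0.
move=> x xe; apply: yA; rewrite /eball/= /dist2 in xe.
have aux (a : R) : a ^+ 2 < e ^+ 2 -> `|a| < e.
  by move=> h; rewrite -(ltr_pXn2r (n := 2)) ?nnegrE ?(ltW e0)// real_normK ?num_real.
split => /=; rewrite /ball/= distrC; apply: aux.
  by have := sqr_ge0 (x.2 - y.2); lra.
by have := sqr_ge0 (x.1 - y.1); lra.
Qed.

(** The inner kernels have bounded mass, and away from their centre they are
    small with [t]. *)
Lemma kin_concentrates w y s e : 0 < s -> mu.-integrable (eball y s) (EFin \o w) ->
  {for y, continuous w} -> w y = 0 -> 0 < e ->
  exists2 t1, 0 < t1 & forall t, 0 < t < t1 ->
    `|\int[mu]_(x in eball y s) (w x * kin s t y x)| <= e.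
Proof.
move=> s0 iw cw w0 e0.
have mB := measurable_eball y s.
pose M : R := 32 * expR 1; have M0 : 0 < M by rewrite mulr_gt0// expR_gt0.
pose e1 := e / (2 * M); have e10 : 0 < e1 by rewrite divr_gt0// mulr_gt0.
have [d d0 dw] : exists2 d, 0 < d & eball y d `<=` [set x | `|w x| <= e1].
  apply: nbhs_eball; have /cvgrPdist_le /(_ _ e10) := cw.
  by rewrite w0; apply: filterS => x /=; rewrite sub0r normrN.
pose I := \int[mu]_(x in eball y s) `|w x|.
have I0 : 0 <= I by apply: Rintegral_ge0.
pose t1 := e * d ^+ 2 / (8 * s * (I + 1)).
have I1 : 0 < I + 1 by rewrite ltr_wpDl.
have t10 : 0 < t1 by rewrite divr_gt0// ?mulr_gt0// exprn_gt0.
exists t1 => // t /andP[t0 tt1].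
have ik := kin_integrable y s0 t0.
have mk : measurable_fun (eball y s : set plane) (kin s t y).
  by apply/measurable_EFinP; exact: measurable_int ik.
have [C kC] : exists C, forall x, eball y s x -> `|kin s t y x| <= C.
  exists (4 / s * (t * 1 / t ^+ 2)) => x _; rewrite ger0_norm ?kin_ge0//.
  have wt : t <= dist2 y x / s + t by rewrite lerDr divr_ge0 ?dist2_ge0// ltW.
  have wt0 : 0 < dist2 y x / s + t by exact: lt_le_trans wt.
  rewrite /kin ler_pM2l ?divr_gt0//; apply: ler_pM.
  - by apply: mulr_ge0; [exact: ltW|exact: prof_ge0].
  - by rewrite invr_ge0 sqr_ge0.
  - by rewrite ler_pM2l//; apply: prof_le1; exact: ltW.
  - by rewrite lef_pV2 ?posrE ?exprn_gt0// ler_pXn2r// nnegrE ltW.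
have iwk : mu.-integrable (eball y s) (EFin \o (fun x => w x * kin s t y x)).
  exact: integrable_mulr_bounded iw mk kC.
have inw : mu.-integrable (eball y s) (EFin \o (fun x => `|w x|)) by exact: integrable_norm iw.
apply: (le_trans (le_normr_Rintegral mB iwk)).
apply: (@le_trans _ _ (\int[mu]_(x in eball y s) (e1 * kin s t y x + (4 * s * t / d ^+ 2) * `|w x|))).
  apply: le_Rintegral => //.
  - exact: (integrable_norm iwk).
  - by apply: integrable_add => //; exact: integrable_scale.
  move=> x xB; rewrite normrM (ger0_norm (kin_ge0 _ _ _ _))//.
  have c0 : 0 <= 4 * s * t / d ^+ 2.
    by rewrite divr_ge0 ?sqr_ge0// !mulr_ge0// ltW.
  have [xd|xd] := ltP (dist2 y x) d.
    apply: ler_wpDr; first exact: mulr_ge0.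
    by apply: ler_wpM2r; [exact: kin_ge0|exact: dw].
  apply: ler_wpDl; first by apply: mulr_ge0; [exact: ltW|exact: kin_ge0].
  by rewrite mulrC; apply: ler_wpM2r => //; exact: kin_le.
rewrite RintegralD//; [|exact: integrable_scale|exact: integrable_scale].
rewrite (RintegralZl _ mB inw) (RintegralZl e1 mB ik).
rewrite (kernel_mass y s0 t0).
have h1 := kout_mass_le y s0 t0.
have h2 : e1 * \int[mu]_(x in eball y s) kout s t y x <= e / 2.
  apply: (le_trans (ler_wpM2l (ltW e10) h1)).
  by rewrite le_eqVlt; apply/orP; left; apply/eqP; rewrite /e1 -/M; field; rewrite gt_eqF.
have h3 : 4 * s * t / d ^+ 2 * I <= e / 2.
  have -> : e / 2 = 4 * s * t1 / d ^+ 2 * (I + 1).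
    by rewrite /t1; field; rewrite !gt_eqF.
  apply: ler_pM => //.
  - by rewrite divr_ge0 ?sqr_ge0// !mulr_ge0// ltW.
  - by rewrite ler_pM2r ?invr_gt0 ?exprn_gt0// ler_pM2l ?mulr_gt0// ltW.
  - by rewrite lerDl.
by rewrite -/I; lra.
Qed.

End MeanValue.

(** * One-sided bounds of the Laplacian, comparison and mean values *)

Section Touching.
Variable R : realType.
Local Notation plane := (measurableTypeR R * measurableTypeR R)%type.
Local Notation mu := (@leb2 R).
Implicit Types (c r s t : R) (x y : R * R) (u w : R * R -> R).

(** A weak form of: the Laplacian of [w] is at least [c] on [eball y r]. Only
    test functions centred at [y] are used, which suffices to compare [w]
    with smooth functions at [y]. *)
Definition lap_ge c w y r := forall s t, 0 < s <= r -> 0 < t ->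
  c * kmass s t y <= \int[mu]_(x in eball y s) (w x * (kout s t y x - kin s t y x)).

Definition lap_le c w y r := forall s t, 0 < s <= r -> 0 < t ->
  \int[mu]_(x in eball y s) (w x * (kout s t y x - kin s t y x)) <= c * kmass s t y.

Lemma continuous_eball_bounded y s u : continuous u ->
  exists C, forall x, eball y s x -> `|u x| <= C.
Proof.
move=> cu; have [b sb] := eball_box0 y s.
have /compact_bounded[M [_ Mf]] : compact (u @` box 0 b).
  apply: continuous_compact; last exact: compact_box.
  exact: continuous_subspaceT.
by exists (M + 1) => x /sb bx; apply: (Mf (M + 1)); [rewrite ltrDl|exists x].
Qed.

Lemma integrable_mul_smooth y s w u : mu.-integrable (eball y s) (EFin \o w) -> smooth u ->
  mu.-integrable (eball y s) (EFin \o (fun x => w x * u x)).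
Proof.
move=> iw su; have [C uC] := continuous_eball_bounded y s (smooth_continuous su).
apply: (integrable_mulr_bounded (measurable_eball _ _) iw (C := C)) => //.
exact: smooth_measurable.
Qed.

Lemma kernel_splitE y s t w : 0 < s -> 0 < t -> mu.-integrable (eball y s) (EFin \o w) ->
  \int[mu]_(x in eball y s) (w x * (kout s t y x - kin s t y x)) =
  \int[mu]_(x in eball y s) (w x * kout s t y x) -
  \int[mu]_(x in eball y s) (w x * kin s t y x).
Proof.
move=> s0 t0 iw.
have i1 := integrable_mul_smooth iw (smooth_kout y s0 t0).
have i2 := integrable_mul_smooth iw (smooth_kin y s0 t0).
have := RintegralB (measurable_eball y s) i1 i2; apply: etrans.
by apply: eq_Rintegral => x _; rewrite mulrBr.
Qed.

(** As a test, the function [dist2 y / 4], of Laplacian 1, computes the total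
    mass of the bumps. *)
Lemma kmass_le s t y : 0 < s -> 0 < t -> kmass s t y <= 32 * expR 1 * s.
Proof.
move=> s0 t0; have sg := smoothZ (4^-1) (smooth_dist2 y).
have gE : (fun x => 4^-1 * dist2 y x) =
    quad ((y.1 ^+ 2 + y.2 ^+ 2) / 4) (- y.1 / 2) (- y.2 / 2) (4^-1) 0 (4^-1).
  by apply/funext => x; rewrite /quad /dist2; field.
have ig := continuous_eball_integrable y s (smooth_continuous sg).
have -> : kmass s t y = \int[mu]_(x in eball y s) (lap (fun x => 4^-1 * dist2 y x) x * kphi s t y x).
  by apply: eq_Rintegral => x _; rewrite gE lap_quad (_ : 2 * _ + _ = 1) ?mul1r//; field.
rewrite -kernel_laplacian// kernel_splitE//.
have h0 : 0 <= \int[mu]_(x in eball y s) ((fun x => 4^-1 * dist2 y x) x * kin s t y x).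
  apply: Rintegral_ge0 => x _; apply: mulr_ge0; last exact: kin_ge0.
  by apply: mulr_ge0; [rewrite invr_ge0|exact: dist2_ge0].
apply: (@le_trans _ _ (\int[mu]_(x in eball y s) (s * kout s t y x))); last first.
  rewrite (RintegralZl _ (measurable_eball y s) (kout_integrable _ s0 t0)) mulrC.
  by rewrite ler_pM2r//; exact: kout_mass_le.
rewrite -[leRHS]subr0; apply: lerB => //.
apply: le_Rintegral.
- exact: measurable_eball.
- by apply: integrable_mul_smooth => //; exact: smooth_kout.
- by apply: integrable_scale; [exact: measurable_eball|exact: kout_integrable].
move=> x; rewrite /eball/= => xs; apply: ler_wpM2r; first exact: kout_ge0.
by have := dist2_ge0 y x; lra.
Qed.

(** The shifts [t] up to 1/2 leave a fixed bump below [kphi]. *)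
Lemma kmass_gt s y : 0 < s -> exists2 m, 0 < m & forall t, 0 < t <= 1 / 2 -> m <= kmass s t y.
Proof.
move=> s0; pose q := Num.sqrt s / 4.
have qs : q ^+ 2 = s / 16 by rewrite /q exprMn sqr_sqrtr ?ltW// exprVn; congr (_ / _); ring.
have q0 : 0 < q by rewrite divr_gt0// sqrtr_gt0.
pose c : R := logprof (5 / 8).
have c0 : 0 < c by apply: logprof_gt0; lra.
have zb x : box y q x -> dist2 y x <= s / 8.
  move=> [/= /andP[h1 h2] /andP[h3 h4]]; rewrite /dist2.
  have aux (a : R) : - q <= a <= q -> a ^+ 2 <= s / 16.
    by rewrite -ler_norml -qs => h; rewrite -real_normK ?num_real// ler_pXn2r ?nnegrE// ltW.
  have a1 := aux (x.1 - y.1); have a2 := aux (x.2 - y.2).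
  have := a1 ltac:(by apply/andP; split; lra); have := a2 ltac:(by apply/andP; split; lra); lra.
exists (c * (2 * q) ^+ 2); first by rewrite mulr_gt0// exprn_gt0// mulr_gt0.
move=> t /andP[t0 t2].
have := @Rintegral_lower R (box y q) (eball y s) (kphi s t y) c.
move=> /(_ (measurable_box _ _) (measurable_eball _ _)).
rewrite (leb2_box _ (ltW q0)) => /= h; apply: h.
- by move=> x /zb h; rewrite /eball /=; lra.
- exact: kphi_integrable.
- by move=> x _; exact: kphi_ge0.
- move=> x /zb h; apply: logprof_anti.
    by rewrite ltr_wpDl// divr_ge0 ?dist2_ge0// ltW.
  have : dist2 y x / s <= 1 / 8 by rewrite ler_pdivrMr//; lra.
  lra.
- by rewrite ltry.
Qed.

Lemma continuous_eball_near w y : {for y, continuous w} ->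
  exists2 d, 0 < d & eball y d `<=` [set x | `|w x| <= `|w y| + 1].
Proof.
move=> cw; apply: nbhs_eball; have /cvgrPdist_le /(_ _ ltr01) := cw.
apply: filterS => x /= h; rewrite -[w x](subrK (w y)) addrC.
by apply: (le_trans (ler_normD _ _)); rewrite lerD2l distrC.
Qed.

Lemma eball_sub y s r : s <= r -> eball y s `<=` eball y r.
Proof. by move=> sr x; rewrite /eball/= => h; exact: lt_le_trans sr. Qed.

(** Comparison principle. Where a smooth function of constant Laplacian [L]
    touches [w] from above, test the difference: it is nonpositive and
    vanishes at the centre, so the outer kernel gives a nonpositive integral
    and the inner kernels see only the point of contact. *)
Lemma touch_above w (g : R * R -> R) y r c (L : R) : 0 < r ->
  measurable_fun (eball y r : set plane) w -> {for y, continuous w} ->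
  smooth g -> (forall x, lap g x = L) ->
  (forall x, eball y r x -> w x <= g x) -> w y = g y ->
  lap_ge c w y r -> c <= L.
Proof.
move=> r0 mw cw sg lg wg wgy wc.
have [d d0 dw] := continuous_eball_near cw.
pose s := Num.min r d.
have s0 : 0 < s by rewrite lt_min r0 d0.
have sr : s <= r by rewrite ge_min lexx.
have sd : s <= d by rewrite ge_min lexx orbT.
have mB := measurable_eball y s.
have iw : mu.-integrable (eball y s) (EFin \o w).
  have [b sb] := eball_box0 y s.
  apply: (bounded_integrable (b := b) (C := `|w y| + 1)) => //.
  - apply: measurable_funS mw; [exact: measurable_eball|exact: eball_sub].
  - by move=> x /(eball_sub sd) /dw.
have ig := continuous_eball_integrable y s (smooth_continuous sg).
pose o x := w x + -1 * g x.
have io : mu.-integrable (eball y s) (EFin \o o).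
  by apply: integrable_add => //; exact: integrable_scale.
have co : {for y, continuous o}.
  apply: cvgD => //; apply: cvgM; first exact: cvg_cst.
  exact: smooth_continuous.
have oy : o y = 0 by rewrite /o mulN1r wgy subrr.
rewrite leNgt; apply/negP => Lc.
have [m m0 mJ] := kmass_gt y s0.
pose e := (c - L) * m / 2.
have e0 : 0 < e by rewrite divr_gt0// mulr_gt0// subr_gt0.
have [t1 t10 ht] := kin_concentrates s0 io co oy e0.
pose t := Num.min (t1 / 2) (1 / 2).
have t0 : 0 < t by rewrite lt_min; apply/andP; split; lra.
have tt1 : t < t1 by rewrite gt_min; apply/orP; left; lra.
have t2 : t <= 1 / 2 by rewrite ge_min lexx orbT.
have := ht t; rewrite t0 tt1 => /(_ isT) hin.
have hJ := mJ t; move: hJ; rewrite t0 t2 => /(_ isT) hJ.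
have := wc s t; rewrite s0 sr => /(_ isT t0) hc.
have hg : \int[mu]_(x in eball y s) (g x * (kout s t y x - kin s t y x)) = L * kmass s t y.
  rewrite kernel_laplacian// -(RintegralZl _ mB (kphi_integrable y s0 t0)).
  by apply: eq_Rintegral => x _; rewrite lg.
have ho : \int[mu]_(x in eball y s) (o x * (kout s t y x - kin s t y x)) =
    \int[mu]_(x in eball y s) (w x * (kout s t y x - kin s t y x)) - L * kmass s t y.
  rewrite -hg.
  have sK : smooth (fun x => kout s t y x - kin s t y x).
    by apply: smoothB; [exact: smooth_kout|exact: smooth_kin].
  have i1 := integrable_mul_smooth iw sK.
  have i2 := integrable_mul_smooth ig sK.
  have := RintegralB mB i1 i2; apply: etrans.
  by apply: eq_Rintegral => x _; rewrite /o; ring.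
have hout : \int[mu]_(x in eball y s) (o x * kout s t y x) <= 0.
  rewrite -oppr_ge0; have := RintegralZl (-1) mB (integrable_mul_smooth io (smooth_kout y s0 t0)).
  rewrite mulN1r => <-; apply: Rintegral_ge0 => x xs; rewrite mulN1r oppr_ge0.
  rewrite mulr_le0_ge0 ?kout_ge0//.
  by rewrite /o mulN1r subr_le0; apply: wg; exact: eball_sub xs.
have hs := kernel_splitE s0 t0 io.
have hin' := ler_norm (- \int[mu]_(x in eball y s) (o x * kin s t y x)).
rewrite normrN in hin'.
have key : (c - L) * m <= (c - L) * kmass s t y by rewrite ler_pM2l// subr_gt0.
have : (c - L) * m <= e.
  move: hs ho hc hout hin hin' key; rewrite mulrBl.
  set A := \int[mu]_(x in _) _; set B := \int[mu]_(x in _) _.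
  set C := \int[mu]_(x in _) _; set D := \int[mu]_(x in _) _.
  by rewrite !mulrBl; lra.
have : 0 < (c - L) * m by rewrite mulr_gt0// subr_gt0.
by rewrite /e; lra.
Qed.

Lemma partialZ i c u : smooth u ->
  partial i (fun x => c * u x) = fun x => c * partial i u x.
Proof.
move=> su; apply/funext => x; rewrite (@partialM _ _ (fun=> c)).
- by rewrite partial_cst mulr0 addr0.
- exact: differentiable_cst.
- exact: smooth_diff.
Qed.

Lemma lapZ c u x : smooth u -> lap (fun x => c * u x) x = c * lap u x.
Proof.
move=> su; rewrite /lap !partialZ ?mulrDr//; exact: smooth_partial.
Qed.

Lemma lap_leN c w y r : lap_le c w y r -> 0 < r -> mu.-integrable (eball y r) (EFin \o w) ->
  lap_ge (- c) (fun x => - w x) y r.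
Proof.
move=> h r0 iw s t sr t0; have := h s t sr t0; rewrite -lerN2 mulNr => h'.
apply: (le_trans h'); move/andP : sr => [s0 sr].
have mB := measurable_eball y s.
have iws : mu.-integrable (eball y s) (EFin \o w).
  by apply: integrableS iw; [exact: measurable_eball| |exact: eball_sub].
have sK : smooth (fun x => kout s t y x - kin s t y x).
  by apply: smoothB; [exact: smooth_kout|exact: smooth_kin].
have := RintegralZl (-1) mB (integrable_mul_smooth iws sK); rewrite mulN1r => <-.
rewrite le_eqVlt; apply/orP; left; apply/eqP; apply: eq_Rintegral => x _; ring.
Qed.

Lemma touch_below w (g : R * R -> R) y r c (L : R) : 0 < r ->
  mu.-integrable (eball y r) (EFin \o w) -> {for y, continuous w} ->
  smooth g -> (forall x, lap g x = L) ->
  (forall x, eball y r x -> g x <= w x) -> w y = g y ->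
  lap_le c w y r -> L <= c.
Proof.
move=> r0 iw cw sg lg wg wgy wc; rewrite -lerN2.
have mw : measurable_fun (eball y r : set plane) w.
  by apply/measurable_EFinP; exact: measurable_int iw.
apply: (@touch_above (fun x => - w x) (fun x => (-1) * g x) y r) => //.
- exact: measurableT_comp.
- exact: cvgN.
- exact: smoothZ.
- by move=> x; rewrite lapZ// lg mulN1r.
- by move=> x xr; rewrite mulN1r lerN2; exact: wg.
- by rewrite mulN1r wgy.
- exact: lap_leN.
Qed.

(** For a subsolution the inner integral is at most the outer one; the former
    tends to the value at the centre times the common mass of the kernels,
    the latter is bounded by the integral of [w]. *)
Lemma sub_mean_value w y r : 0 < r -> mu.-integrable (eball y r) (EFin \o w) ->
  {for y, continuous w} -> (forall x, eball y r x -> 0 <= w x) -> lap_ge 0 w y r ->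
  w y <= (2560 * expR 6 / r) * \int[mu]_(x in eball y r) w x.
Proof.
move=> r0 iw cw w0 wc; have mB := measurable_eball y r.
set I := \int[mu]_(x in eball y r) w x.
suff : w y * (expR (- 5) / 320) <= 8 * expR 1 / r * I.
  have c0 : 0 < expR (- 5) / 320 :> R by apply: divr_gt0; [exact: expR_gt0|rewrite ltr0n].
  rewrite -(ler_pdivlMr _ _ c0) => h; apply: (le_trans h).
  rewrite le_eqVlt; apply/orP; left; apply/eqP.
  have -> : expR 6 = expR 1 / expR (- 5) :> R by rewrite -expRB; congr expR; ring.
  by field; rewrite !gt_eqF ?expR_gt0.
apply/ler_addgt0Pr => e e0.
have iwy : mu.-integrable (eball y r) (EFin \o (fun=> w y)).
  by apply: continuous_eball_integrable; exact: cst_continuous.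
pose o x := w x + -1 * w y.
have io : mu.-integrable (eball y r) (EFin \o o).
  apply: integrable_add => //.
  by apply: continuous_eball_integrable; exact: cst_continuous.
have co : {for y, continuous o} by apply: cvgD => //; exact: cvg_cst.
have oy : o y = 0 by rewrite /o mulN1r subrr.
have [t1 t10 ht] := kin_concentrates r0 io co oy e0.
pose t := Num.min (t1 / 2) (1 / 4).
have t0 : 0 < t by rewrite lt_min; apply/andP; split; lra.
have tt1 : t < t1 by rewrite gt_min; apply/orP; left; lra.
have t2 : t <= 1 / 4 by rewrite ge_min lexx orbT.
have := ht t; rewrite t0 tt1 => /(_ isT) hin.
have := wc r t; rewrite r0 lexx mul0r => /(_ isT t0) hc.
have hs := kernel_splitE r0 t0 iw.
have hm : expR (- 5) / 320 <= \int[mu]_(x in eball y r) kout r t y x.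
  by apply: kout_mass_ge => //; rewrite t0.
have hw : \int[mu]_(x in eball y r) (w x * kin r t y x) =
    \int[mu]_(x in eball y r) (o x * kin r t y x) +
    w y * \int[mu]_(x in eball y r) kout r t y x.
  rewrite -(kernel_mass y r0 t0) -(RintegralZl _ mB (kin_integrable y r0 t0)).
  have i1 := integrable_mul_smooth io (smooth_kin y r0 t0).
  have i2 := integrable_scale (w y) mB (kin_integrable y r0 t0).
  have := RintegralD mB i1 i2 => <-.
  by apply: eq_Rintegral => x _; rewrite /o; ring.
have hout : \int[mu]_(x in eball y r) (w x * kout r t y x) <= 8 * expR 1 / r * I.
  rewrite /I -(RintegralZl _ mB iw); apply: le_Rintegral => //.
  - by apply: integrable_mul_smooth => //; exact: smooth_kout.
  - exact: integrable_scale.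
  - move=> x xr; rewrite mulrC; apply: ler_wpM2r; first exact: w0.
    exact: kout_le.
have hin' := ler_norm (- \int[mu]_(x in eball y r) (o x * kin r t y x)).
rewrite normrN in hin'.
have wy0 : 0 <= w y by apply: w0; exact: eball_center.
have key : w y * (expR (- 5) / 320) <= w y * \int[mu]_(x in eball y r) kout r t y x.
  exact: ler_wpM2l.
move: hc; rewrite hs hw; lra.
Qed.

Definition annulus y s : set (R * R) := [set x | s / 16 <= dist2 y x <= 9 / 16 * s].

Lemma measurable_annulus y s : measurable (annulus y s : set plane).
Proof.
rewrite (_ : annulus y s = (dist2 y) @^-1` [set` `[s / 16, 9 / 16 * s]]); last first.
  by apply/seteqP; split => x; rewrite /annulus /= in_itv.
rewrite -[X in measurable X]setTI.
by apply: continuous_plane_measurable => //; exact: dist2_continuous.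
Qed.

(** A super-mean value property around a zero: the inner integral tends to 0,
    and the outer kernel is bounded below on the annulus. *)
Lemma growth_annulus w y r c : 0 < r -> 0 <= c -> mu.-integrable (eball y r) (EFin \o w) ->
  {for y, continuous w} -> (forall x, eball y r x -> 0 <= w x) -> w y = 0 ->
  lap_le c w y r ->
  \int[mu]_(x in annulus y r) w x <= 640 * expR 6 * c * r ^+ 2.
Proof.
move=> r0 c0 iw cw w0 wy wc; have mB := measurable_eball y r.
have sub : annulus y r `<=` eball y r.
  by move=> x /andP[_ h]; rewrite /eball/=; lra.
have ia : mu.-integrable (annulus y r) (EFin \o w).
  by apply: integrableS iw => //; exact: measurable_annulus.
set I := \int[mu]_(x in annulus y r) w x.
suff : expR (- 5) / (20 * r) * I <= 32 * expR 1 * r * c.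
  rewrite mulrC -ler_pdivlMr ?divr_gt0 ?expR_gt0 ?mulr_gt0// => h; apply: (le_trans h).
  rewrite le_eqVlt; apply/orP; left; apply/eqP.
  have -> : expR 6 = expR 1 / expR (- 5) :> R by rewrite -expRB; congr expR; ring.
  by field; rewrite !gt_eqF ?expR_gt0.
apply/ler_addgt0Pr => e e0.
have [t1 t10 ht] := kin_concentrates r0 iw cw wy e0.
pose t := Num.min (t1 / 2) (1 / 4).
have t0 : 0 < t by rewrite lt_min; apply/andP; split; lra.
have tt1 : t < t1 by rewrite gt_min; apply/orP; left; lra.
have t2 : t <= 1 / 4 by rewrite ge_min lexx orbT.
have := ht t; rewrite t0 tt1 => /(_ isT) hin.
have := wc r t; rewrite r0 lexx => /(_ isT t0) hc.
have hs := kernel_splitE r0 t0 iw.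
have hJ := ler_wpM2l c0 (kmass_le y r0 t0).
have hout : expR (- 5) / (20 * r) * I <= \int[mu]_(x in eball y r) (w x * kout r t y x).
  rewrite /I -(RintegralZl _ (measurable_annulus y r) ia).
  have ik := integrable_mul_smooth iw (smooth_kout y r0 t0).
  apply: (@le_trans _ _ (\int[mu]_(x in annulus y r) (w x * kout r t y x))).
    apply: le_Rintegral.
    - exact: measurable_annulus.
    - by apply: integrable_scale => //; exact: measurable_annulus.
    - by apply: integrableS ik => //; exact: measurable_annulus.
    - move=> x xr; rewrite mulrC; apply: ler_wpM2l; first exact/w0/sub.
      exact: kout_ge.
  rewrite /Rintegral fine_le//.
  - apply: integrable_fin_num; first exact: measurable_annulus.
    by apply: integrableS ik => //; exact: measurable_annulus.
  - exact: integrable_fin_num.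
  apply: ge0_subset_integral => //; first exact: measurable_annulus.
    exact: measurable_int ik.
  by move=> x xr; rewrite lee_fin mulr_ge0 ?kout_ge0 ?w0.
have hin' := ler_norm (\int[mu]_(x in eball y r) (w x * kin r t y x)).
move: hc hJ; rewrite hs; lra.
Qed.

End Touching.

(** * The weak equation tested without a flux across the interface *)

Section Transmission.
Variable R : realType.
Local Notation plane := (measurableTypeR R * measurableTypeR R)%type.
Local Notation mu := (@leb2 R).
Local Notation D := (@unit_disk R).
Implicit Types (x y : R * R) (f u v w h : R * R -> R).

Lemma unit_diskE : D = eball 0 1.
Proof.
have e x : dist2 0 x = x.1 ^+ 2 + x.2 ^+ 2 by rewrite /dist2 !subr0.
by apply/seteqP; split => x; rewrite /unit_disk /eball /= e.
Qed.

Lemma measurable_disk : measurable (D : set plane).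
Proof. by rewrite unit_diskE; exact: measurable_eball. Qed.

Lemma L2_integrable u : L2 D u -> mu.-integrable D (EFin \o u).
Proof.
move=> [mu_ iu2]; have mD := measurable_disk.
apply: (@le_integrable _ _ _ _ _ mD _ (EFin \o (fun x => 1 + u x ^+ 2))).
- exact/measurable_EFinP.
- move=> x _ /=; rewrite lee_fin (le_trans _ (ler_norm _))//.
  rewrite -(real_normK (num_real (u x))); have := sqr_ge0 (`|u x| - 1); rewrite sqrrB.
  have := normr_ge0 (u x); nra.
- apply: (@integrable_add _ _ (fun=> 1) (fun x => u x ^+ 2)) => //.
  rewrite unit_diskE; apply: continuous_eball_integrable; exact: cst_continuous.
Qed.

Lemma test_bounded (Om : set (R * R)) u f : test_function Om u -> continuous f ->
  (forall x, ~ closure [set y | u y != 0] x -> f x = 0) ->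
  exists2 C, 0 <= C & forall x, `|f x| <= C.
Proof.
move=> [_ cS _] cf f0.
have /compact_bounded[M [_ Mf]] : compact (f @` closure [set y | u y != 0]).
  by apply: continuous_compact => //; exact: continuous_subspaceT.
exists (`|M| + 1) => [|x]; first by rewrite addr_ge0.
have [xS|xS] := pselect (closure [set y | u y != 0] x); last first.
  by rewrite f0// normr0 addr_ge0.
apply: (Mf (`|M| + 1)); last by exists x.
by rewrite ltr_pwDr// ler_norm.
Qed.

Lemma test_W120 u : test_function D u -> W12_0 D u (fun i => partial i u).
Proof.
move=> tu; have [su _ _] := tu; have mD := measurable_disk.
have L2s f : smooth f -> (forall x, ~ closure [set y | u y != 0] x -> f x = 0) -> L2 D f.
  move=> sf f0; split; first exact: smooth_measurable.
  apply: (test_integrable tu) => //.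
    by apply: smooth_continuous; exact: smooth_sqr.
  by move=> x /f0 ->; rewrite expr0n.
split.
  split.
  - by apply: L2s => // x; exact: off_support.
  - by move=> i; apply: L2s; [exact: smooth_partial|move=> x; exact: partial_off_support].
  - by move=> i phi tphi; exact: by_parts.
exists (fun=> u) => //.
apply: cvg_near_cst; apply: nearW => k.
have z (f : R * R -> R) : \int[mu]_(x in D) ((f x - f x) ^+ 2) = 0.
  have -> : \int[mu]_(x in D) ((f x - f x) ^+ 2) = \int[mu]_(x in D) 0.
    by apply: eq_Rintegral => x _; rewrite subrr expr0n.
  by rewrite Rintegral_cst ?mul0r.
by rewrite z add0r big1// => i _; exact: z.
Qed.

Definition side (a b : R) x : R := if 0 < x.2 then a else b.

(** Test functions belong to the closure of the test functions, with their
    classical gradient as weak gradient. *)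
Lemma weak_test a b h u p :
  (forall phi q, W12_0 D phi q ->
      - (\int[mu]_(x in D) (\sum_(i < 2) \sum_(j < 2) coef a b i j x * p i x * q j x)) =
      (\int[mu]_(x in D) (h x * phi x))) ->
  test_function D u ->
  - (\int[mu]_(x in D) (side a b x * (p 0 x * partial 0 u x + p 1 x * partial 1 u x))) =
  \int[mu]_(x in D) (h x * u x).
Proof.
move=> H tu; rewrite -(H _ _ (test_W120 tu)); congr (- _).
apply: eq_Rintegral => x _; rewrite !big_ord_recl !big_ord0 /coef /side/=.
have -> : lift ord0 ord0 = 1 :> 'I_2 by exact: val_inj.
have -> : ord0 = 0 :> 'I_2 by exact: val_inj.
move: (p 0 x) (p 1 x) (partial 0 u x) (partial 1 u x) => p0 p1 q0 q1.
by case: ifP => _ /=; ring.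
Qed.

(** Smooth approximations of the discontinuous coefficient. *)
Definition ramp (a b : R) (n : nat) x : R :=
  (a + b) / 2 + (a - b) / pi * atan (n.+1%:R * x.2).
Definition dramp (a b : R) (n : nat) x : R :=
  (a - b) / pi * ((1 + (n.+1%:R * x.2) ^+ 2)^-1 * n.+1%:R).

Let den_neq0 n x : 1 + (n.+1%:R * x.2) ^+ 2 != 0.
Proof. by rewrite gt_eqF// ltr_wpDr// sqr_ge0. Qed.

Let smooth_arg n : smooth (fun x : R * R => n.+1%:R * x.2).
Proof. by apply: smoothZ; exact: smooth_snd. Qed.

Lemma partial_ramp i a b n : partial i (ramp a b n) =
  fun x => if i == 0 then 0 else dramp a b n x.
Proof.
apply/funext => x.
have da : is_derive (n.+1%:R * x.2) 1 (@atan R) (1 + (n.+1%:R * x.2) ^+ 2)^-1.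
  by exact: is_derive1_atan.
have dx : differentiable (fun x : R * R => n.+1%:R * x.2) x by exact: smooth_diff.
have [d1 d2] := partial_comp i dx da.
have dc (c : R) : differentiable (fun _ : R * R => c) x by exact: differentiable_cst.
rewrite /ramp (@partialD _ i (fun=> _)); [|exact: dc|exact: differentiableM].
rewrite partial_cst add0r (@partialM _ i (fun=> _)); [|exact: dc|exact: d1].
rewrite partial_cst mulr0 addr0 d2 (@partialM _ i (fun=> _)); [|exact: dc|exact: differentiable_snd].
rewrite partial_cst mulr0 addr0 partial_snd /dramp.
by case: (i == 0) => /=; rewrite ?mulr0 ?mulr1.
Qed.

Lemma smooth_dramp a b n : smooth (dramp a b n).
Proof.
apply: smoothZ; apply: smoothM; last exact: smooth_cst.
apply: smoothV => //; apply: smoothD; first exact: smooth_cst.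
exact: smooth_sqr.
Qed.

Lemma smooth_ramp a b n : smooth (ramp a b n).
Proof.
apply: smooth_step => [x|i].
  have da : is_derive (n.+1%:R * x.2) 1 (@atan R) (1 + (n.+1%:R * x.2) ^+ 2)^-1.
    by exact: is_derive1_atan.
  have dx : differentiable (fun x : R * R => n.+1%:R * x.2) x by exact: smooth_diff.
  have [d1 _] := partial_comp 0 dx da.
  apply: differentiableD; first exact: differentiable_cst.
  by apply: differentiableM; first exact: differentiable_cst.
rewrite partial_ramp; case: (i == 0); [exact: smooth_cst|exact: smooth_dramp].
Qed.

Lemma ramp_bound a b n x : `|ramp a b n x| <= `|a| + `|b|.
Proof.
have pi0 := pi_gt0 R; pose z := atan (n.+1%:R * x.2) / pi.
have [z1 z2] : - (1 / 2) <= z /\ z <= 1 / 2.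
  split; rewrite /z.
    by rewrite ler_pdivlMr//; have := atan_gtNpi2 (n.+1%:R * x.2); lra.
  by rewrite ler_pdivrMr//; have := atan_ltpi2 (n.+1%:R * x.2); lra.
have -> : ramp a b n x = (1 / 2 + z) * a + (1 / 2 - z) * b.
  have aux (P A : R) : 0 < P ->
    (a + b) / 2 + (a - b) / P * A = (1 / 2 + A / P) * a + (1 / 2 - A / P) * b.
    by move=> P0; field; rewrite gt_eqF.
  exact: aux.
apply: (le_trans (ler_normD _ _)); rewrite !normrM.
by apply: lerD; apply: ler_piMl => //; rewrite ler_norml; apply/andP; split; lra.
Qed.

Lemma ramp_cvg a b x : x.2 != 0 -> ramp a b n x @[n --> \oo] --> side a b x.
Proof.
have pos (z : R) : 0 < z -> atan (n.+1%:R * z) @[n --> \oo] --> (pi / 2 : R).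
  move=> z0; apply: (@cvg_comp _ _ _ (fun n => n.+1%:R * z) (@atan R) _ +oo); last exact: cvgy_atan.
  apply/cvgryPge => A; near=> n; rewrite -ler_pdivrMr//.
  apply: (@le_trans _ _ n%:R); last by rewrite ler_nat.
  by near: n; exact: nbhs_infty_ger.
have pi0 := pi_gt0 R.
move=> x0; rewrite /ramp /side; case: ltP => x2.
  rewrite -[X in _ --> X](_ : (a + b) / 2 + (a - b) / pi * (pi / 2) = a); last first.
    have aux (P : R) : 0 < P -> (a + b) / 2 + (a - b) / P * (P / 2) = a.
      by move=> P0; field; rewrite gt_eqF.
    exact: aux.
  by apply: cvgD; [exact: cvg_cst|apply: cvgM; [exact: cvg_cst|exact: pos]].
have {}x2 : 0 < - x.2 by rewrite oppr_gt0 lt_neqAle x0.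
rewrite -[X in _ --> X](_ : (a + b) / 2 + (a - b) / pi * (- (pi / 2)) = b); last first.
  have aux (P : R) : 0 < P -> (a + b) / 2 + (a - b) / P * (- (P / 2)) = b.
    by move=> P0; field; rewrite gt_eqF.
  exact: aux.
apply: cvgD; [exact: cvg_cst|apply: cvgM; [exact: cvg_cst|]].
rewrite (_ : (fun n => _) = fun n => - atan (n.+1%:R * - x.2)); first exact: cvgN (pos _ x2).
by apply/funext => n; rewrite -atanN mulrN opprK.
Unshelve. all: by end_near. Qed.

Lemma neumann_lipschitz u : test_function D u -> (forall z : R, partial 1 u (z, 0) = 0) ->
  exists2 C, 0 <= C & forall x, `|partial 1 u x| <= C * `|x.2|.
Proof.
move=> tu u0; have [su _ _] := tu.
have tpu := test_partial 1 tu; have spu := smooth_partial 1 su.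
have [C C0 uC] := @test_bounded D (partial 1 u) (partial 1 (partial 1 u)) tpu
   (smooth_continuous (smooth_partial 1 spu)) (fun x hx => partial_off_support 1 hx).
exists C => // -[x1 x2] /=.
pose f t := partial 1 u (x1, t).
have df (t : R) : is_derive t 1 f (partial 1 (partial 1 u) (x1, t)).
  by apply: is_derive_slice2; exact: smooth_diff.
have cf (a b : R) : {within `[a, b], continuous f}.
  apply: continuous_subspaceT => t; apply: differentiable_continuous.
  by apply/derivable1_diffP; have [] := df t.
rewrite -[partial 1 u _](_ : f x2 - f 0 = _); last by rewrite /f u0 subr0.
have [x20|x20|->] := ltgtP x2 0; last by rewrite subrr !normr0 mulr0.
- have [c _] := MVT x20 (fun t _ => df t) (cf _ _).
  by rewrite distrC sub0r => ->; rewrite normrM normrN ler_wpM2r.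
- have [c _] := MVT x20 (fun t _ => df t) (cf _ _).
  by rewrite subr0 => ->; rewrite normrM ler_wpM2r.
Qed.

(** The derivative of the approximations blows up only like the inverse of
    the distance to the axis. *)
Lemma dramp_bound a b n x : `|dramp a b n x| * `|x.2| <= `|(a - b) / pi|.
Proof.
set z := n.+1%:R * x.2; rewrite -normrM.
have -> : dramp a b n x * x.2 = (a - b) / pi * (z / (1 + z ^+ 2)).
  by rewrite /dramp -/z -mulrA; congr (_ * _); rewrite -mulrA mulrC.
have d0 : 0 < 1 + z ^+ 2 by rewrite ltr_wpDr ?sqr_ge0.
rewrite normrM ler_piMr// normrM normfV (ger0_norm (ltW d0)) ler_pdivrMr// mul1r.
rewrite -(real_normK (num_real z)); have := sqr_ge0 (`|z| - 1).
rewrite sqrrB; have := normr_ge0 z; nra.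
Qed.

Lemma dramp_cvg0 a b x : x.2 != 0 -> dramp a b n x @[n --> \oo] --> (0 : R).
Proof.
move=> x0; rewrite -(mulr0 ((a - b) / pi)).
apply: cvgM; first exact: cvg_cst.
have x20 : 0 < x.2 ^+ 2 by rewrite exprn_even_gt0.
apply: (@squeeze_cvgr _ _ _ _ (cst (0 : R)) (fun n => (x.2 ^+ 2)^-1 * n.+1%:R^-1)).
- near=> n; have n0 : (0 : R) < n.+1%:R by rewrite ltr0n.
  have d0 : 0 < 1 + (n.+1%:R * x.2) ^+ 2 by rewrite ltr_wpDr ?sqr_ge0.
  apply/andP; split; first by rewrite mulr_ge0// invr_ge0 ltW.
  have d1 : 0 < x.2 ^+ 2 * n.+1%:R by exact: mulr_gt0.
  rewrite mulrC ler_pdivrMr// -invfM ler_pdivlMl//.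
  by rewrite exprMn (_ : _ * _ * _ = n.+1%:R ^+ 2 * x.2 ^+ 2) ?lerDr//; ring.
- exact: cvg_cst.
- rewrite -(mulr0 (x.2 ^+ 2)^-1); apply: cvgM; [exact: cvg_cst|exact: cvg_harmonic].
Unshelve. all: by end_near. Qed.

Lemma measurable_side a b (A : set plane) : measurable_fun A (side a b).
Proof.
apply: measurable_funTS.
apply: (@measurable_fun_ifT _ _ plane R (fun=> a) (fun=> b) (fun x => 0 < x.2)) => //.
by apply: (@measurable_fun_ltr _ plane R setT (fun=> 0) snd).
Qed.

(** Integrating by parts twice moves all derivatives to [u], provided that
    the jump of the coefficient does not contribute. It is replaced by a
    smooth ramp; the error term is the product of the derivative of the ramp,
    of order [1 / |x.2|], and of the normal derivative of [u], of order
    [|x.2|], hence bounded, and it tends to 0 off the axis. *)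
Lemma neumann_identity a b v h u : weak_solution D (coef a b) v h ->
  test_function D u -> (forall z : R, partial 1 u (z, 0) = 0) ->
  \int[mu]_(x in D) (side a b x * v x * lap u x) = \int[mu]_(x in D) (h x * u x).
Proof.
move=> [L2h [p [L2v L2p vp] weak]] tu u0; have mD := measurable_disk.
rewrite -(weak_test weak tu).
have [su _ _] := tu; have sp i := smooth_partial i su.
have tp i := test_partial i tu; have spp i j := smooth_partial i (sp j).
have iv := L2_integrable L2v; have ip i := L2_integrable (L2p i).
have mv : measurable_fun D v by case: L2v.
have mp i : measurable_fun D (p i) by case: (L2p i).
have slap : smooth (lap u) by apply: smoothD.
have [C C0 uC] := neumann_lipschitz tu u0.
have bd f : smooth f -> (forall x, ~ closure [set y | u y != 0] x -> f x = 0) ->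
    exists2 C, 0 <= C & forall x, `|f x| <= C.
  by move=> sf f0; apply: test_bounded tu _ f0; exact: smooth_continuous.
have [L L0 uL] : exists2 C, 0 <= C & forall x, `|lap u x| <= C.
  apply: bd => // x xS; rewrite /lap.
  by rewrite !partial_off_support ?addr0//; move: xS; apply: contra_not;
    rewrite [X in X _ -> _]closureE; apply; split; [exact: closed_closure| |exact: closed_closure|];
    move=> z /=; apply: contra_neqP => /partial_off_support.
have [P P0 uP] : exists2 C, 0 <= C & forall i x, `|partial i u x| <= C.
  have [C1 C10 h1] := bd _ (sp 0) (fun x hx => partial_off_support 0 hx).
  have [C2 C20 h2] := bd _ (sp 1) (fun x hx => partial_off_support 1 hx).
  exists (C1 + C2); first exact: addr_ge0.
  move=> i x; have [->|->] : i = 0 \/ i = 1.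
    by case: i => [[|[|//]]] ?; [left|right]; exact: val_inj.
  - by apply: ler_wpDr => //; exact: h1.
  - by apply: ler_wpDl => //; exact: h2.
pose K := `|a| + `|b|; have K0 : 0 <= K by rewrite addr_ge0.
pose K' := `|(a - b) / pi|.
(* the divergence of [ramp * grad u], and the energy that it balances *)
pose Ln n := \int[mu]_(x in D) (v x * (ramp a b n x * lap u x + dramp a b n x * partial 1 u x)).
pose Rn n := \int[mu]_(x in D) (ramp a b n x * (p 0 x * partial 0 u x + p 1 x * partial 1 u x)).
(* one integration by parts, legitimate since the ramp is smooth *)
have LR n : Ln n = - Rn n.
  have tst i : test_function D (fun x => ramp a b n x * partial i u x).
    have [_ cS SD] := tp i; have sub : closure [set x | ramp a b n x * partial i u x != 0] `<=`
       closure [set x | partial i u x != 0].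
      rewrite [X in X `<=` _]closureE => x; apply; split; first exact: closed_closure.
      move=> z /= hz; apply: subset_closure => /=; apply: contra_neq hz => ->.
      by rewrite mulr0.
    split; first by apply: smoothM => //; exact: smooth_ramp.
    - by apply: subclosed_compact cS sub; exact: closed_closure.
    - exact: subset_trans SD.
  have E i := vp i _ (tst i).
  have pE i x : partial i (fun x => ramp a b n x * partial i u x) x =
     ramp a b n x * partial i (partial i u) x +
     partial i u x * (if i == 0 then 0 else dramp a b n x).
    have [spi _ _] := tp i.
    have sr : differentiable (ramp a b n) x by apply: smooth_diff; exact: smooth_ramp.
    rewrite -[if _ then _ else _]/((fun z => if i == 0 then 0 else dramp a b n z) x) -partial_ramp.
    by apply: (partialM i sr); exact: (smooth_diff spi).
  have mr : measurable_fun D (ramp a b n) by apply: smooth_measurable; exact: smooth_ramp.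
  have iw i : mu.-integrable D (EFin \o (fun x => p i x * (ramp a b n x * partial i u x))).
    apply: (integrable_mulr_bounded mD (ip i) (C := K * P)) => [|x _].
      by apply: measurable_funM => //; exact: smooth_measurable.
    by rewrite normrM; apply: ler_pM => //; exact: ramp_bound.
  have iv' i : mu.-integrable D (EFin \o (fun x => v x * partial i (fun x => ramp a b n x * partial i u x) x)).
    have [C1 C10 h1] := @test_bounded D _ _ (tst i)
      (smooth_continuous (smooth_partial i (smoothM (smooth_ramp a b n) (sp i))))
      (fun x hx => partial_off_support i hx).
    apply: (@integrable_mulr_bounded R D v (partial i (fun x => ramp a b n x * partial i u x)) C1 mD iv) => //.
    by apply: smooth_measurable; apply: smooth_partial; apply: smoothM => //; exact: smooth_ramp.
  have e1 := RintegralD mD (iv' 0) (iv' 1).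
  have e2 := RintegralD mD (iw 0) (iw 1).
  have -> : Ln n = \int[mu]_(x in D)
     (v x * partial 0 (fun x => ramp a b n x * partial 0 u x) x +
      v x * partial 1 (fun x => ramp a b n x * partial 1 u x) x).
    apply: eq_Rintegral => x _; rewrite (pE 0) (pE 1).
    have aux (r A B z d c c' : R) :
      z * (r * (A + B) + d * c) = z * (r * A + c' * 0) + z * (r * B + c * d) by ring.
    exact: aux.
  have -> : Rn n = \int[mu]_(x in D)
     (p 0 x * (ramp a b n x * partial 0 u x) + p 1 x * (ramp a b n x * partial 1 u x)).
    apply: eq_Rintegral => x _.
    have aux (r A B c c' : R) : r * (A * c + B * c') = A * (r * c) + B * (r * c') by ring.
    exact: aux.
  apply: (etrans e1); apply: (etrans (congr2 +%R (E 0) (E 1))).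
  by rewrite -opprD; congr (- _); exact: esym e2.
have offD : {ae mu, forall x : plane, D x -> x.2 != 0}.
  by apply: filterS (ae_off_line R) => x.
have mside := measurable_side a b.
have cL : Ln n @[n --> \oo] --> \int[mu]_(x in D) (side a b x * v x * lap u x).
  have [] := @Rdominated_convergence R D
    (fun n x => v x * (ramp a b n x * lap u x + dramp a b n x * partial 1 u x))
    (fun x => side a b x * v x * lap u x) (fun x => (K * L + K' * C) * `|v x|) mD => //.
  - move=> n; apply: measurable_funM => //; apply: smooth_measurable; apply: smoothD.
      by apply: smoothM => //; exact: smooth_ramp.
    by apply: smoothM => //; exact: smooth_dramp.
  - apply: measurable_funM; first exact: measurable_funM.
    exact: smooth_measurable.
  - apply: filterS offD => x xD /xD x2.
    rewrite -[X in _ --> X](_ : v x * (side a b x * lap u x + 0 * partial 1 u x) = _); last by ring.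
    apply: cvgM; first exact: cvg_cst.
    apply: cvgD; apply: cvgM; [exact: ramp_cvg|exact: cvg_cst|exact: dramp_cvg0|exact: cvg_cst].
  - apply: integrable_scale => //; exact: integrable_norm iv.
  - move=> n x _; rewrite normrM mulrC; apply: ler_wpM2r => //.
    apply: (le_trans (ler_normD _ _)); rewrite (normrM (ramp a b n x)) (normrM (dramp a b n x)); apply: lerD.
      by apply: ler_pM => //; exact: ramp_bound.
    apply: (@le_trans _ _ (`|dramp a b n x| * (C * `|x.2|))).
      by apply: ler_wpM2l => //; exact: uC.
    rewrite mulrCA mulrC; apply: ler_wpM2r => //; exact: dramp_bound.
have mpu : measurable_fun D (fun x => p 0 x * partial 0 u x + p 1 x * partial 1 u x).
  by apply: measurable_funD; apply: measurable_funM;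
    [exact: mp|apply: smooth_measurable; exact: sp|exact: mp|apply: smooth_measurable; exact: sp].
have cR : Rn n @[n --> \oo] --> \int[mu]_(x in D)
    (side a b x * (p 0 x * partial 0 u x + p 1 x * partial 1 u x)).
  have [] := @Rdominated_convergence R D
    (fun n x => ramp a b n x * (p 0 x * partial 0 u x + p 1 x * partial 1 u x))
    (fun x => side a b x * (p 0 x * partial 0 u x + p 1 x * partial 1 u x))
    (fun x => K * P * (`|p 0 x| + `|p 1 x|)) mD => //.
  - move=> n; apply: measurable_funM; first by apply: smooth_measurable; exact: smooth_ramp.
    exact: mpu.
  - exact: (measurable_funM (mside D) mpu).
  - apply: filterS offD => x xD /xD x2.
    by apply: cvgM; [exact: ramp_cvg|exact: cvg_cst].
  - apply: integrable_scale => //; apply: integrable_add => //.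
      exact: integrable_norm (ip 0).
    exact: integrable_norm (ip 1).
  - move=> n x _; rewrite normrM -mulrA; apply: ler_pM => //; first exact: ramp_bound.
    apply: (le_trans (ler_normD _ _)).
    rewrite (normrM (p 0 x)) (normrM (p 1 x)) mulrDr.
    by apply: lerD; rewrite mulrC; apply: ler_wpM2r.
have cL' : Ln n @[n --> \oo] --> - \int[mu]_(x in D)
    (side a b x * (p 0 x * partial 0 u x + p 1 x * partial 1 u x)).
  by rewrite (_ : Ln = fun n => - Rn n); [exact: cvgN|apply/funext].
exact: (cvg_unique _ cL cL').
Qed.

End Transmission.

(** * Reflection in the interface *)

Section Flip.
Variable R : realType.
Local Notation plane := (measurableTypeR R * measurableTypeR R)%type.
Local Notation mu := (@leb2 R).
Local Notation D := (@unit_disk R).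
Implicit Types (s t r : R) (x y z : R * R) (f g u w : R * R -> R).

Definition flip x : R * R := (x.1, - x.2).

Lemma flipE x : flip x = stretch (1, -1) x.
Proof. by rewrite /flip /stretch/= mul1r mulN1r. Qed.

Lemma flipK : involutive flip.
Proof. by move=> [x1 x2]; rewrite /flip/= opprK. Qed.

Lemma dist2_flip y x : dist2 (flip y) (flip x) = dist2 y x.
Proof. by rewrite /dist2 /flip/=; ring. Qed.

Lemma dist2_flipl y x : dist2 (flip y) x = dist2 y (flip x).
Proof. by rewrite -{1}(flipK x) dist2_flip. Qed.

Lemma kphi_flip s t y x : kphi s t (flip y) x = kphi s t y (flip x).
Proof. by rewrite /kphi dist2_flipl. Qed.
Lemma kout_flip s t y x : kout s t (flip y) x = kout s t y (flip x).
Proof. by rewrite /kout dist2_flipl. Qed.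
Lemma kin_flip s t y x : kin s t (flip y) x = kin s t y (flip x).
Proof. by rewrite /kin dist2_flipl. Qed.

Let flip_neq0 : ((1, -1) : R * R).2 != 0.
Proof. by rewrite /= oppr_eq0 oner_neq0. Qed.

Let flip_preimage (A : set (R * R)) : stretch (1, -1) @^-1` A = flip @^-1` A.
Proof. by apply/seteqP; split => x; rewrite /= flipE. Qed.

Lemma integrable_flip (A : set plane) f : measurable A -> mu.-integrable A (EFin \o f) ->
  mu.-integrable (flip @^-1` A) (EFin \o (fun x => f (flip x))).
Proof.
move=> mA fi; rewrite -flip_preimage.
have := @integrable_stretch R (1, -1) A f (oner_neq0 R) flip_neq0 mA fi.
apply: eq_integrable.
  exact: measurable_stretch_preimage.
by move=> x _; rewrite /= flipE.
Qed.

Lemma Rintegral_flip (A : set plane) f : measurable A -> mu.-integrable A (EFin \o f) ->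
  \int[mu]_(x in flip @^-1` A) f (flip x) = \int[mu]_(x in A) f x.
Proof.
move=> mA fi.
have := @Rintegral_stretch R (1, -1) A f (oner_neq0 R) flip_neq0 mA fi => ->.
rewrite /= mul1r normrN1 mul1r flip_preimage.
by apply: eq_Rintegral => x _; rewrite flipE.
Qed.

Lemma ae_flip (P : plane -> Prop) : {ae mu, forall x, P x} -> {ae mu, forall x, P (flip x)}.
Proof.
move=> h; have h' := @ae_stretch R (1, -1) P (oner_neq0 R) flip_neq0 h.
by apply: (@filterS _ _ (ae_filter_ringOfSetsType mu) _ _ _ h') => x; rewrite flipE.
Qed.

Lemma measurable_fun_flip (A : set plane) f : measurable A -> measurable_fun A f ->
  measurable_fun (flip @^-1` A : set plane) (fun x => f (flip x)).
Proof.
move=> mA mf; rewrite -flip_preimage (_ : (fun x => f (flip x)) = fun x => f (stretch (1, -1) x)).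
  exact: measurable_fun_stretch.
by apply/funext => x; rewrite flipE.
Qed.

Lemma disk_flip : flip @^-1` D = D.
Proof. by apply/seteqP; split => x; rewrite /unit_disk/= sqrrN. Qed.

Lemma eball_flip y s : flip @^-1` (eball y s) = eball (flip y) s.
Proof. by apply/seteqP; split => x; rewrite /eball/= dist2_flipl. Qed.

Lemma continuous_flip : continuous flip.
Proof.
move=> x; apply: continuous_pair2; first exact: cvg_fst.
by apply: cvgN; exact: cvg_snd.
Qed.

(** Poisson equation, in the same weak sense as [lap_ge] and [lap_le]. *)
Definition lap_eq w f y r := forall s t, 0 < s <= r -> 0 < t ->
  \int[mu]_(x in eball y s) (w x * (kout s t y x - kin s t y x)) =
  \int[mu]_(x in eball y s) (f x * kphi s t y x).

Lemma lap_eq_le w f y r c : lap_eq w f y r -> mu.-integrable (eball y r) (EFin \o f) ->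
  (forall x, eball y r x -> f x <= c) -> lap_le c w y r.
Proof.
move=> h fi fc s t sr t0; rewrite h//; move/andP : sr => [s0 sr].
have mB := measurable_eball y s.
rewrite /kmass -(RintegralZl _ mB (kphi_integrable y s0 t0)).
apply: le_Rintegral => //.
- apply: integrable_mul_smooth; last exact: smooth_kphi.
  by apply: integrableS fi => //; [exact: measurable_eball|exact: eball_sub].
- by apply: integrable_scale => //; exact: kphi_integrable.
- move=> x xs; apply: ler_wpM2r; first exact: kphi_ge0.
  by apply: fc; exact: eball_sub xs.
Qed.

Lemma lap_eq_ge w f y r c : lap_eq w f y r -> mu.-integrable (eball y r) (EFin \o f) ->
  (forall x, eball y r x -> c <= f x) -> lap_ge c w y r.
Proof.
move=> h fi fc s t sr t0; rewrite h//; move/andP : sr => [s0 sr].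
have mB := measurable_eball y s.
rewrite /kmass -(RintegralZl _ mB (kphi_integrable y s0 t0)).
apply: le_Rintegral => //.
- by apply: integrable_scale => //; exact: kphi_integrable.
- apply: integrable_mul_smooth; last exact: smooth_kphi.
  by apply: integrableS fi => //; [exact: measurable_eball|exact: eball_sub].
- move=> x xs; apply: ler_wpM2r; first exact: kphi_ge0.
  by apply: fc; exact: eball_sub xs.
Qed.

End Flip.

(** * The folded solution and its quadratic growth *)

Section ObstacleSolution.
Variable R : realType.
Local Notation plane := (measurableTypeR R * measurableTypeR R)%type.
Local Notation mu := (@leb2 R).
Local Notation D := (@unit_disk R).
Implicit Types (s t r : R) (x y z : R * R).
Variables (a b : R) (v : R * R -> R).
Hypotheses (a0 : 0 < a) (b0 : 0 < b) (sol : obstacle_solution a b v).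

Definition rhs x : R := 2^-1 * \1_(positivity_set D v) x.

Lemma rhsE x : D x -> rhs x = if 0 < v x then 2^-1 else 0.
Proof.
move=> Dx; rewrite /rhs indicE; case: ifPn => vx.
  by rewrite mem_set ?mulr1.
by rewrite memNset ?mulr0// => -[_]; exact/negP.
Qed.

Lemma rhs_bound x : 0 <= rhs x <= 2^-1.
Proof. by rewrite /rhs indicE; case: (_ \in _) => /=; apply/andP; split; lra. Qed.

Lemma sol_ge0 x : D x -> 0 <= v x.
Proof. by case: sol => _ _ h _; exact: h. Qed.

Lemma sol_cont x : D x -> {for x, continuous v}.
Proof. by case: sol => h _ _ _; exact: h. Qed.

Lemma sol_measurable : measurable_fun (D : set plane) v.
Proof. by case: sol => _ [_ [p [[]]]]. Qed.

Lemma sol_integrable : mu.-integrable D (EFin \o v).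
Proof. by case: sol => _ [_ [p [L2v _ _] _]] _ _; exact: L2_integrable. Qed.

Lemma rhs_integrable : mu.-integrable D (EFin \o rhs).
Proof. by case: sol => _ [L2h _] _ _; exact: L2_integrable. Qed.

Lemma disk0 : D 0.
Proof. by rewrite /unit_disk/= expr0n addr0. Qed.

Lemma sol0 : v 0 = 0.
Proof.
have [_ _ _ [_ [cl _]]] := sol.
apply/eqP/negPn/negP => v0.
have /cvgrPdist_lt /(_ `|v 0|) := sol_cont disk0.
rewrite normr_gt0 => /(_ v0) /cl [x [[_ vx]] /=].
by rewrite vx subr0 ltxx.
Qed.

Lemma sol_positive_near r : 0 < r -> exists2 x, eball 0 r x & D x /\ 0 < v x.
Proof.
move=> r0; have [_ _ _ [[cl _] _]] := sol.
by have [x [Px xr]] := cl _ (eball_nbhs 0 r0); exists x.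
Qed.

(** The sum of the flux potential, which is [a * v] above the axis and
    [b * v] below, and of its reflection. *)
Definition fold x : R := a * v (x.1, `|x.2|) + b * v (x.1, - `|x.2|).

Definition fold_rhs x : R := rhs x + rhs (flip x).

Lemma foldE x : fold x = if 0 <= x.2 then a * v x + b * v (flip x) else a * v (flip x) + b * v x.
Proof.
rewrite /fold; case: (leP 0 x.2) => x2.
  by rewrite ger0_norm// -surjective_pairing.
by rewrite ltr0_norm// opprK -surjective_pairing.
Qed.

Lemma diskF x : D x -> D (flip x).
Proof. by move=> Dx; rewrite -[D]disk_flip /= flipK. Qed.

Lemma fold_ge0 x : D x -> 0 <= fold x.
Proof.
move=> Dx; have := sol_ge0 Dx; have := sol_ge0 (diskF Dx) => h1 h2.
by rewrite foldE; case: ifP => _; rewrite addr_ge0// mulr_ge0// ltW.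
Qed.

Lemma le_fold m x : D x -> 0 <= m -> m <= a -> m <= b -> m * v x <= fold x.
Proof.
move=> Dx m0 ma mb; have := sol_ge0 Dx; have := sol_ge0 (diskF Dx) => h1 h2.
rewrite foldE; case: ifP => _.
  by rewrite ler_wpDr ?mulr_ge0 ?(ltW b0)// ler_wpM2r.
by rewrite ler_wpDl ?mulr_ge0 ?(ltW a0)// ler_wpM2r.
Qed.

Lemma fold_cont x : D x -> {for x, continuous fold}.
Proof.
move=> Dx.
have D1 : D (x.1, `|x.2|) by rewrite /unit_disk/= real_normK ?num_real.
have D2 : D (x.1, - `|x.2|) by rewrite /unit_disk/= sqrrN real_normK ?num_real.
have c1 : {for x, continuous (fun z => (z.1, `|z.2|) : R * R)}.
  apply: continuous_pair2; first exact: cvg_fst.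
  by apply: cvg_norm; exact: cvg_snd.
have c2 : {for x, continuous (fun z => (z.1, - `|z.2|) : R * R)}.
  apply: continuous_pair2; first exact: cvg_fst.
  by apply: cvgN; apply: cvg_norm; exact: cvg_snd.
apply: cvgD; (apply: cvgM; first exact: cvg_cst).
  exact: (@continuous_comp _ _ _ _ v x c1 (sol_cont D1)).
exact: (@continuous_comp _ _ _ _ v x c2 (sol_cont D2)).
Qed.

Lemma fold0 : fold 0 = 0.
Proof.
rewrite /fold.
have -> : ((0 : R * R).1, `|(0 : R * R).2|) = 0 :> R * R by rewrite normr0.
have -> : ((0 : R * R).1, - `|(0 : R * R).2|) = 0 :> R * R by rewrite normr0 oppr0.
by rewrite sol0 !mulr0 addr0.
Qed.

Lemma fold_rhs_bound x : 0 <= fold_rhs x <= 1.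
Proof.
have /andP[h1 h2] := rhs_bound x; have /andP[h3 h4] := rhs_bound (flip x).
by rewrite /fold_rhs; apply/andP; split; lra.
Qed.

Lemma fold_rhs_ge x : D x -> 0 < fold x -> 2^-1 <= fold_rhs x.
Proof.
move=> Dx fx; rewrite /fold_rhs (rhsE Dx) (rhsE (diskF Dx)).
have := sol_ge0 Dx; have := sol_ge0 (diskF Dx) => h1 h2.
have [vx|vx] := ltP 0 (v x); first by case: ifP => _; lra.
have v0 : v x = 0 by apply/eqP; rewrite eq_le vx.
have [vf|vf] := ltP 0 (v (flip x)); first by lra.
have vf0 : v (flip x) = 0 by apply/eqP; rewrite eq_le vf.
by move: fx; rewrite foldE v0 vf0 !mulr0 addr0 if_same ltxx.
Qed.

Lemma fold_gt0 x : D x -> 0 < v x -> 0 < fold x.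
Proof.
move=> Dx vx; apply: (@lt_le_trans _ _ (Num.min a b * v x)).
  by rewrite mulr_gt0// lt_min a0 b0.
by apply: le_fold => //; rewrite ?le_min ?ge_min ?lexx ?orbT// !ltW.
Qed.

Lemma flip_integrable_disk (f : R * R -> R) : mu.-integrable D (EFin \o f) ->
  mu.-integrable D (EFin \o (fun x => f (flip x))).
Proof. by move=> fi; have := integrable_flip (@measurable_disk R) fi; rewrite disk_flip. Qed.

Let side_int : mu.-integrable D (EFin \o (fun x => side a b x * v x)).
Proof.
have := integrable_mulr_bounded (@measurable_disk R) sol_integrable (@measurable_side R a b D) (C := a + b).
have bd x : D x -> `|side a b x| <= a + b.
  by move=> _; rewrite /side; case: ifP => _; rewrite gtr0_norm// ?lerDl ?lerDr ltW.
by move=> /(_ bd); apply: eq_integrable => [|x _]; [exact: measurable_disk|rewrite /= mulrC].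
Qed.

Let fold_sum x : x.2 != 0 -> side a b x * v x + side a b (flip x) * v (flip x) = fold x.
Proof.
move=> x2; rewrite foldE /side /flip /= oppr_gt0.
by have [x0|x0|x0] := ltgtP 0 x.2; [|rewrite addrC|move: x2; rewrite -x0 eqxx].
Qed.

Let fold_sum_int :
  mu.-integrable D (EFin \o (fun x => side a b x * v x + side a b (flip x) * v (flip x))).
Proof.
apply: integrable_add; [exact: measurable_disk|exact: side_int|].
exact: (flip_integrable_disk side_int).
Qed.

Lemma fold_measurable : measurable_fun (D : set plane) fold.
Proof.
have mD := @measurable_disk R.
have msnd : measurable_fun (setT : set plane) (snd : plane -> R) by exact: measurable_snd.
have mf : measurable_fun (D : set plane) (fun x => v (flip x)).
  by have := measurable_fun_flip mD sol_measurable; rewrite disk_flip.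
have mv := sol_measurable.
have m1 : measurable_fun (D : set plane) (fun x => a * v x + b * v (flip x)).
  by apply: measurable_funD; apply: measurable_funM.
have m2 : measurable_fun (D : set plane) (fun x => a * v (flip x) + b * v x).
  by apply: measurable_funD; apply: measurable_funM.
rewrite (_ : fold = fun x => if 0 <= x.2 then a * v x + b * v (flip x) else a * v (flip x) + b * v x).
  have mc : measurable_fun (D : set plane) (fun x : plane => 0 <= x.2 :> R).
    by apply: (@measurable_fun_ler _ plane R D (fun=> 0) snd) => //; exact: measurable_funTS.
  apply: (@measurable_fun_if _ _ plane R (fun x => a * v x + b * v (flip x))
    (fun x => a * v (flip x) + b * v x) D mD _ mc).
  - apply: measurable_funS m1 => //; exact: subIsetl.
  - apply: measurable_funS m2 => //; exact: subIsetl.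
by apply/funext => x; exact: foldE.
Qed.

Lemma fold_integrable : mu.-integrable D (EFin \o fold).
Proof.
have mD := @measurable_disk R.
have iv := sol_integrable; have ivf := flip_integrable_disk iv.
apply: (@le_integrable _ _ _ _ _ mD _ (EFin \o (fun x => (a + b) * `|v x| + (a + b) * `|v (flip x)|))).
- by apply/measurable_EFinP; exact: fold_measurable.
- move=> x Dx /=; rewrite lee_fin (ger0_norm (fold_ge0 Dx)) (le_trans _ (ler_norm _))//.
  have := sol_ge0 Dx; have := sol_ge0 (diskF Dx) => h1 h2.
  rewrite !ger0_norm// foldE; case: ifP => _; move: a0 b0 => ? ?; nra.
- by apply: integrable_add => //; apply: integrable_scale => //; exact: integrable_norm.
Qed.

Lemma fold_rhs_integrable : mu.-integrable D (EFin \o fold_rhs).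
Proof.
apply: integrable_add; [exact: measurable_disk|exact: rhs_integrable|].
exact: (flip_integrable_disk rhs_integrable).
Qed.

Lemma eball_disk_restrict y s (f g : R * R -> R) : eball y s `<=` D ->
  (forall x, ~ eball y s x -> g x = 0) ->
  \int[mu]_(x in D) (f x * g x) = \int[mu]_(x in eball y s) (f x * g x).
Proof.
move=> sD g0; rewrite [LHS]Rintegral_mkcond [RHS]Rintegral_mkcond.
apply: eq_Rintegral => x _; rewrite !patchE.
have [xs|xs] := pselect (eball y s x).
  by rewrite !mem_set//; exact: sD.
by rewrite (memNset xs); case: ifP => // _; rewrite g0// mulr0.
Qed.

Lemma test_add (Om : set (R * R)) (f g : R * R -> R) : test_function Om f -> test_function Om g ->
  test_function Om (fun x => f x + g x).
Proof.
move=> [sf cf fO] [sg cg gO].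
have sub : closure [set x | f x + g x != 0] `<=`
   closure [set x | f x != 0] `|` closure [set x | g x != 0].
  rewrite [X in X `<=` _]closureE => x; apply; split.
    by apply: closedU; exact: closed_closure.
  move=> z /= h; have [fz|fz] := eqVneq (f z) 0; last by left; exact: subset_closure.
  by right; apply: subset_closure; move: h; rewrite /= fz add0r.
split; first exact: smoothD.
- apply: subclosed_compact (compactU cf cg) sub; exact: closed_closure.
- by apply: (subset_trans sub) => x [/fO|/gO].
Qed.

Lemma lapD (f g : R * R -> R) x : smooth f -> smooth g ->
  lap (fun x => f x + g x) x = lap f x + lap g x.
Proof.
move=> sf sg; rewrite /lap.
have pD i : partial i (fun x => f x + g x) = fun x => partial i f x + partial i g x.
  by apply/funext => z; rewrite partialD//; exact: smooth_diff.
have dd i (u : R * R -> R) : smooth u -> differentiable (partial i u) x.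
  by move=> su; apply: smooth_diff; exact: smooth_partial.
rewrite (pD 0) (pD 1) (partialD 0 (dd 0 _ sf) (dd 0 _ sg)).
apply: etrans; last exact: addrACA.
by congr (_ + _); exact: (partialD 1 (dd 1 _ sf) (dd 1 _ sg)).
Qed.

Let kernel_off s t y : 0 < s -> 0 < t -> forall x, ~ eball y s x ->
  kout s t y x - kin s t y x = 0.
Proof. by move=> s0 t0 x xs; rewrite kout_off// kin_off// subrr. Qed.

(** The test function [kphi s t y + kphi s t (flip y)] is even in the second
    variable, so that its normal derivative vanishes on the axis and
    [neumann_identity] applies. By symmetry, testing with it amounts to
    testing [fold] with [kphi s t y] alone. *)
Lemma lap_eq_fold y r : eball y r `<=` D -> lap_eq fold fold_rhs y r.
Proof.
move=> yD s t /andP[s0 sr] t0.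
have ysD : eball y s `<=` D by apply: subset_trans yD; exact: eball_sub.
have yfD : eball (flip y) s `<=` D by rewrite -eball_flip -disk_flip => x; exact: ysD.
have mD := @measurable_disk R.
(* the Laplacian of [kphi s t y] *)
pose K x := kout s t y x - kin s t y x.
have sK : smooth K by apply: smoothB; [exact: smooth_kout|exact: smooth_kin].
have sp := smooth_kphi y s0 t0.
have tu := test_add (test_kphi s0 t0 ysD) (test_kphi s0 t0 yfD).
have nu (z : R) : partial 1 (fun x => kphi s t y x + kphi s t (flip y) x) (z, 0) = 0.
  rewrite partialD; [|by apply: smooth_diff; exact: smooth_kphi..].
  rewrite !partial_kphi//= dist2_flipl /flip/= oppr0.
  rewrite !sub0r opprK; ring.
have := neumann_identity (let: And4 _ w _ _ := sol in w) tu nu.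
have sKf : smooth (fun x => K (flip x)).
  rewrite (_ : (fun x => K (flip x)) = fun x => kout s t (flip y) x - kin s t (flip y) x).
    by apply: smoothB; [exact: smooth_kout|exact: smooth_kin].
  by apply/funext => x; rewrite kout_flip kin_flip.
have spf : smooth (fun x => kphi s t y (flip x)).
  rewrite (_ : (fun x => kphi s t y (flip x)) = kphi s t (flip y)); first exact: smooth_kphi.
  by apply/funext => x; rewrite kphi_flip.
have DE : D = eball 0 1 := @unit_diskE R.
have mulint (f g : R * R -> R) : mu.-integrable D (EFin \o f) -> smooth g ->
    mu.-integrable D (EFin \o (fun x => f x * g x)).
  by rewrite DE => fi sg; exact: integrable_mul_smooth.
have symm (f g : R * R -> R) : mu.-integrable D (EFin \o f) -> smooth g -> smooth (fun x => g (flip x)) ->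
    \int[mu]_(x in D) (f x * (g x + g (flip x))) = \int[mu]_(x in D) ((f x + f (flip x)) * g x).
  move=> fi sg sgf.
  have i1 := mulint _ _ fi sg; have i2 := mulint _ _ fi sgf.
  have i3 := mulint _ _ (flip_integrable_disk fi) sg.
  have e3 : \int[mu]_(x in D) (f x * g (flip x)) = \int[mu]_(x in D) (f (flip x) * g x).
    rewrite -(Rintegral_flip mD i2) disk_flip.
    by apply: eq_Rintegral => x _; rewrite flipK.
  apply: (@etrans _ _ (\int[mu]_(x in D) (f x * g x + f x * g (flip x)))).
    by apply: eq_Rintegral => x _; rewrite mulrDr.
  apply: (etrans (RintegralD mD i1 i2)); rewrite e3.
  apply: (etrans (esym (RintegralD mD i1 i3))).
  by apply: eq_Rintegral => x _; rewrite mulrDl.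
move=> id0.
have id1 : \int[mu]_(x in D) ((side a b x * v x) * (K x + K (flip x))) =
    \int[mu]_(x in D) (rhs x * (kphi s t y x + kphi s t y (flip x))).
  apply: (etrans _ (etrans id0 _)).
    apply: eq_Rintegral => x _; rewrite lapD ?lap_kphi//; last exact: smooth_kphi.
    by rewrite kout_flip kin_flip.
  by apply: eq_Rintegral => x _; rewrite kphi_flip.
have id2 : \int[mu]_(x in D) (fold x * K x) = \int[mu]_(x in D) (fold_rhs x * kphi s t y x).
  apply: (etrans _ (etrans (esym (symm _ _ side_int sK sKf))
    (etrans id1 (symm _ _ rhs_integrable sp spf)))).
  apply: eq_Rintegral_ae => //.
  - by apply: measurable_funM; [exact: fold_measurable|exact: smooth_measurable].
  - apply: measurable_funM; last exact: smooth_measurable.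
    by apply/measurable_EFinP; exact: measurable_int fold_sum_int.
  - by apply: filterS (ae_off_line R) => x x2 _; rewrite fold_sum.
rewrite -(@eball_disk_restrict y s fold K ysD (kernel_off s0 t0)).
by rewrite -(@eball_disk_restrict y s fold_rhs _ ysD (kphi_off s0 t0)).
Qed.

(** Off the interface the kernel itself has no normal derivative on the axis,
    since it is supported in a half-plane. *)
Lemma lap_eq_upper y r : eball y r `<=` D -> (forall x, eball y r x -> 0 < x.2) ->
  lap_eq v (fun x => a^-1 * rhs x) y r.
Proof.
move=> yD yup s t /andP[s0 sr] t0.
have ysD : eball y s `<=` D by apply: subset_trans yD; exact: eball_sub.
have mB := measurable_eball y s.
pose K x := kout s t y x - kin s t y x.
have sK : smooth K by apply: smoothB; [exact: smooth_kout|exact: smooth_kin].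
have nu (z : R) : partial 1 (kphi s t y) (z, 0) = 0.
  rewrite partial_kphi// prof_eq0 ?mul0r ?mulr0//.
  have : ~ eball y s (z, 0) by move=> /(eball_sub sr) /yup /=; rewrite ltxx.
  move=> /negP; rewrite -leNgt => h.
  have : 1 <= dist2 y (z, 0) / s by rewrite ler_pdivlMr// mul1r.
  by move: t0; lra.
have id0 := neumann_identity (let: And4 _ w _ _ := sol in w) (test_kphi s0 t0 ysD) nu.
have iv : mu.-integrable (eball y s) (EFin \o v).
  by apply: integrableS sol_integrable; [exact: measurable_disk| |].
have ir : mu.-integrable (eball y s) (EFin \o rhs).
  by apply: integrableS rhs_integrable; [exact: measurable_disk| |].
have id1 : a * \int[mu]_(x in eball y s) (v x * K x) = \int[mu]_(x in eball y s) (rhs x * kphi s t y x).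
  rewrite -(RintegralZl _ mB (integrable_mul_smooth iv sK)).
  rewrite -(@eball_disk_restrict y s rhs _ ysD (kphi_off s0 t0)).
  apply: (etrans _ id0); rewrite (@eball_disk_restrict y s _ (lap (kphi s t y)) ysD); last first.
    by move=> x xs; rewrite lap_kphi// kernel_off.
  apply: eq_Rintegral => x; rewrite inE => xs; rewrite lap_kphi// /side yup ?mulrA//.
  exact: eball_sub xs.
apply: (etrans (_ : _ = a^-1 * \int[mu]_(x in eball y s) (rhs x * kphi s t y x))).
  by rewrite -id1 mulKf// gt_eqF.
rewrite -(RintegralZl _ mB (integrable_mul_smooth ir (smooth_kphi y s0 t0))).
by apply: eq_Rintegral => x _; rewrite mulrA.
Qed.

Lemma lap_eq_lower y r : eball y r `<=` D -> (forall x, eball y r x -> 0 < x.2) ->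
  lap_eq (fun x => v (flip x)) (fun x => b^-1 * rhs (flip x)) y r.
Proof.
move=> yD yup s t /andP[s0 sr] t0.
have yfD : eball (flip y) s `<=` D.
  rewrite -eball_flip -disk_flip => x /= xs; apply: yD; exact: eball_sub xs.
have mB := measurable_eball (flip y) s.
pose K x := kout s t (flip y) x - kin s t (flip y) x.
have sK : smooth K by apply: smoothB; [exact: smooth_kout|exact: smooth_kin].
have up x : eball (flip y) s x -> x.2 < 0.
  by rewrite -eball_flip /= => /(eball_sub sr) /yup; rewrite /flip/= oppr_gt0.
have nu (z : R) : partial 1 (kphi s t (flip y)) (z, 0) = 0.
  rewrite partial_kphi// prof_eq0 ?mul0r ?mulr0//.
  have : ~ eball (flip y) s (z, 0) by move=> /up /=; rewrite ltxx.
  move=> /negP; rewrite -leNgt => h.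
  have : 1 <= dist2 (flip y) (z, 0) / s by rewrite ler_pdivlMr// mul1r.
  by move: t0; lra.
have id0 := neumann_identity (let: And4 _ w _ _ := sol in w) (test_kphi s0 t0 yfD) nu.
have iv : mu.-integrable (eball (flip y) s) (EFin \o v).
  by apply: integrableS sol_integrable; [exact: measurable_disk| |].
have ir : mu.-integrable (eball (flip y) s) (EFin \o rhs).
  by apply: integrableS rhs_integrable; [exact: measurable_disk| |].
have ivK := integrable_mul_smooth iv sK.
have irp := integrable_mul_smooth ir (smooth_kphi (flip y) s0 t0).
have id1 : b * \int[mu]_(x in eball (flip y) s) (v x * K x) =
    \int[mu]_(x in eball (flip y) s) (rhs x * kphi s t (flip y) x).
  rewrite -(RintegralZl _ mB ivK).
  rewrite -(@eball_disk_restrict (flip y) s rhs _ yfD (kphi_off s0 t0)).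
  apply: (etrans _ id0); rewrite (@eball_disk_restrict (flip y) s _ (lap (kphi s t (flip y))) yfD); last first.
    by move=> x xs; rewrite lap_kphi// kernel_off.
  apply: eq_Rintegral => x; rewrite inE => xs; rewrite lap_kphi// /side ltNge (ltW (up _ xs)).
  by rewrite mulrA.
have e1 := Rintegral_flip mB ivK; have e2 := Rintegral_flip mB irp.
rewrite -id1 in e2; rewrite eball_flip flipK in e1 e2.
apply: (etrans (_ : _ = \int[mu]_(x in eball y s) (v (flip x) * K (flip x)))).
  by apply: eq_Rintegral => x _; rewrite /K !kout_flip !kin_flip flipK.
have bn : b != 0 by rewrite gt_eqF.
rewrite e1 -[LHS](mulKf bn) -e2.
have irp' := integrable_flip mB irp; rewrite eball_flip flipK in irp'.
rewrite -(RintegralZl _ (measurable_eball y s) irp').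
by apply: eq_Rintegral => x _; rewrite kphi_flip flipK mulrA.
Qed.

(** Quadratic growth at the free boundary point: the super-mean value
    property around the zero at the origin bounds the integral over an
    annulus, and the sub-mean value property transfers the bound to the
    points [x] of the annulus. *)
Lemma fold_growth : exists2 C, 0 <= C & forall x, dist2 0 x < 1 / 4 ->
  fold x <= C * dist2 0 x.
Proof.
pose k1 : R := 2560 * expR 6; pose k2 : R := 640 * expR 6.
have k10 : 0 <= k1 by apply: mulr_ge0; [exact: ler0n|exact: expR_ge0].
have k20 : 0 <= k2 by apply: mulr_ge0; [exact: ler0n|exact: expR_ge0].
exists (k1 * 4 * (k2 * 16)) => [|x x4].
  by apply: mulr_ge0; apply: mulr_ge0.
set d := dist2 0 x; have d0 : 0 <= d by exact: dist2_ge0.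
have DE := @unit_diskE R.
have [dz|dn] := eqVneq d 0.
  rewrite dz mulr0 (_ : x = 0) ?fold0//.
  move: dz; rewrite /d /dist2 !subr0 => /eqP; rewrite paddr_eq0 ?sqr_ge0// !sqrf_eq0.
  by case: x {x4 d d0} => x1 x2 /= /andP[/eqP -> /eqP ->].
have {dn}d1 : 0 < d by rewrite lt_neqAle eq_sym dn.
have s1 : eball 0 (4 * d) `<=` D by rewrite DE; apply: eball_sub; rewrite -/d in x4; lra.
have i1 : mu.-integrable (eball 0 (4 * d)) (EFin \o fold).
  by apply: integrableS fold_integrable; [exact: measurable_disk|exact: measurable_eball|].
have r1 : mu.-integrable (eball 0 (4 * d)) (EFin \o fold_rhs).
  by apply: integrableS fold_rhs_integrable; [exact: measurable_disk|exact: measurable_eball|].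
have d40 : 0 < 4 * d by lra.
have h1 : \int[mu]_(z in annulus 0 (4 * d)) fold z <= k2 * 1 * (4 * d) ^+ 2.
  apply: growth_annulus => //.
  - exact: (fold_cont disk0).
  - by move=> z /s1; exact: fold_ge0.
  - exact: fold0.
  - apply: lap_eq_le (lap_eq_fold s1) r1 _ => z _.
    by have /andP[] := fold_rhs_bound z.
(* the annulus of index [4 * d] contains a ball about each point at squared
   distance [d] *)
have an z : eball x (d / 4) z -> annulus 0 (4 * d) z.
  rewrite /eball /annulus /d /dist2 /= !subr0 => h.
  have q1 := sqr_ge0 (x.1 - 2 * (z.1 - x.1)); have q2 := sqr_ge0 (x.2 - 2 * (z.2 - x.2)).
  have q3 := sqr_ge0 (x.1 + 2 * (z.1 - x.1)); have q4 := sqr_ge0 (x.2 + 2 * (z.2 - x.2)).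
  by apply/andP; split; nra.
have s2 : annulus 0 (4 * d) `<=` eball 0 (4 * d).
  by move=> z /andP[_ hz]; rewrite /eball/=; lra.
have s3 : eball x (d / 4) `<=` D by move=> z /an /s2 /s1.
have i2 : mu.-integrable (eball x (d / 4)) (EFin \o fold).
  by apply: integrableS fold_integrable; [exact: measurable_disk|exact: measurable_eball|].
have r2 : mu.-integrable (eball x (d / 4)) (EFin \o fold_rhs).
  by apply: integrableS fold_rhs_integrable; [exact: measurable_disk|exact: measurable_eball|].
have i3 : mu.-integrable (annulus 0 (4 * d)) (EFin \o fold).
  by apply: integrableS i1 => //; [exact: measurable_eball|exact: measurable_annulus].
have d4 : 0 < d / 4 by lra.
have h2 : fold x <= k1 / (d / 4) * \int[mu]_(z in eball x (d / 4)) fold z.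
  apply: sub_mean_value => //.
  - by apply: fold_cont; apply: s3; exact: eball_center.
  - by move=> z /s3; exact: fold_ge0.
  - apply: lap_eq_ge (lap_eq_fold s3) r2 _ => z _.
    by have /andP[] := fold_rhs_bound z.
apply: (le_trans h2).
have c0 : 0 <= k1 / (d / 4) by apply: divr_ge0 => //; exact: ltW.
have h3 : \int[mu]_(z in eball x (d / 4)) fold z <= \int[mu]_(z in annulus 0 (4 * d)) fold z.
  rewrite /Rintegral fine_le//.
  - by apply: integrable_fin_num => //; exact: measurable_eball.
  - by apply: integrable_fin_num => //; exact: measurable_annulus.
  apply: ge0_subset_integral => //; [exact: measurable_eball|exact: measurable_annulus| |].
    exact: measurable_int i3.
  by move=> z /s2 /s1 Dz; rewrite lee_fin fold_ge0.
apply: (le_trans (ler_wpM2l c0 (le_trans h3 h1))).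
rewrite le_eqVlt; apply/orP; left; apply/eqP.
rewrite -/d; move: (k1) (k2) => l1 l2; field.
by rewrite gt_eqF.
Qed.

End ObstacleSolution.

(** * Rescaling and passage to the limit *)

Section Limits.
Variable R : realType.
Local Notation plane := (measurableTypeR R * measurableTypeR R)%type.
Local Notation mu := (@leb2 R).
Local Notation D := (@unit_disk R).
Implicit Types (s t r c : R) (x y z : R * R) (f g u w : R * R -> R).

Let scaleE (p : R) x : p *: x = stretch (p, p) x.
Proof. by []. Qed.

Lemma dist2_scale (p : R) y x : dist2 (p *: y) (p *: x) = p ^+ 2 * dist2 y x.
Proof. by rewrite /dist2 !scaleE /stretch/=; ring. Qed.

Lemma dist2_scale0 (p : R) x : dist2 0 (p *: x) = p ^+ 2 * dist2 0 x.
Proof. by rewrite -dist2_scale scaler0. Qed.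

Lemma eball_scale (p : R) y s : 0 < p ->
  stretch (p, p) @^-1` (eball (p *: y) (p ^+ 2 * s)) = eball y s.
Proof.
move=> p0; apply/seteqP; split => x; rewrite /eball /= -scaleE dist2_scale.
  by rewrite ltr_pM2l// exprn_gt0.
by rewrite ltr_pM2l// exprn_gt0.
Qed.

Lemma lap_eq_scale w f y r (p : R) : 0 < p ->
  mu.-integrable (eball (p *: y) (p ^+ 2 * r)) (EFin \o w) ->
  mu.-integrable (eball (p *: y) (p ^+ 2 * r)) (EFin \o f) ->
  lap_eq w f (p *: y) (p ^+ 2 * r) ->
  lap_eq (fun x => w (p *: x) / p ^+ 2) (fun x => f (p *: x)) y r.
Proof.
move=> p0 iw fi h s t /andP[s0 sr] t0.
have pn : p != 0 by rewrite gt_eqF.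
have p20 : 0 < p ^+ 2 by rewrite exprn_gt0.
pose s' := p ^+ 2 * s; have s'0 : 0 < s' by rewrite mulr_gt0.
have s'r : s' <= p ^+ 2 * r by rewrite ler_pM2l.
have mB := measurable_eball (p *: y) s'.
have sub : eball (p *: y) s' `<=` eball (p *: y) (p ^+ 2 * r) by exact: eball_sub.
have iw' : mu.-integrable (eball (p *: y) s') (EFin \o w).
  by apply: integrableS iw => //; exact: measurable_eball.
have if' : mu.-integrable (eball (p *: y) s') (EFin \o f).
  by apply: integrableS fi => //; exact: measurable_eball.
have rE x : dist2 (p *: y) (p *: x) / s' = dist2 y x / s.
  by rewrite dist2_scale /s' -mulf_div divff ?mul1r// gt_eqF.
have sK : smooth (fun x => kout s' t (p *: y) x - kin s' t (p *: y) x).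
  by apply: smoothB; [exact: smooth_kout|exact: smooth_kin].
have i1 := integrable_mul_smooth iw' sK.
have i2 := integrable_mul_smooth if' (smooth_kphi (p *: y) s'0 t0).
have e1 := @Rintegral_stretch R (p, p) _ _ pn pn mB i1.
have e2 := @Rintegral_stretch R (p, p) _ _ pn pn mB i2.
have := h s' t; rewrite s'0 s'r => /(_ isT t0) e.
rewrite e1 e2 (eball_scale y s p0) in e.
have pp : `|(p, p).1 * (p, p).2| != 0 by rewrite normr_eq0 mulf_neq0.
have {}e := mulfI pp e.
apply: (etrans _ (etrans e _)).
  apply: eq_Rintegral => x _; rewrite -scaleE.
  have -> : kout s t y x = p ^+ 2 * kout s' t (p *: y) (p *: x).
    rewrite /kout rE.
    move: (dprof _ * _ / _) => Q; rewrite /s'; field.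
    by rewrite (gt_eqF p0) (gt_eqF s0).
  have -> : kin s t y x = p ^+ 2 * kin s' t (p *: y) (p *: x).
    rewrite /kin rE.
    move: (t * _ / _) => Q; rewrite /s'; field.
    by rewrite (gt_eqF p0) (gt_eqF s0).
  by rewrite -mulrBr mulrA divfK// gt_eqF.
by apply: eq_Rintegral => x _; rewrite -scaleE /kphi rE.
Qed.

Lemma kernel_integral_limit (wn : nat -> R * R -> R) w u y s C :
  (forall n, measurable_fun (eball y s : set plane) (wn n)) ->
  measurable_fun (eball y s : set plane) w ->
  {ae mu, forall x, eball y s x -> wn n x @[n --> \oo] --> w x} ->
  (forall n x, eball y s x -> `|wn n x| <= C) -> smooth u ->
  \int[mu]_(x in eball y s) (wn n x * u x) @[n --> \oo] -->
  \int[mu]_(x in eball y s) (w x * u x).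
Proof.
move=> mwn mw cw wC su; have mB := measurable_eball y s.
have mu' : measurable_fun (eball y s : set plane) u by exact: smooth_measurable.
have iu := continuous_eball_integrable y s (smooth_continuous su).
have [] // := @Rdominated_convergence R (eball y s) (fun n x => wn n x * u x)
   (fun x => w x * u x) (fun x => C * `|u x|) mB.
- by move=> n; exact: measurable_funM.
- exact: measurable_funM.
- apply: (@filterS _ _ (ae_filter_ringOfSetsType mu) _ _ _ cw) => x h xs.
  by apply: cvgM; [exact: h|exact: cvg_cst].
- by apply: integrable_scale => //; exact: integrable_norm iu.
- by move=> n x xs; rewrite normrM ler_wpM2r// wC.
Qed.

Lemma lap_le_limit (wn : nat -> R * R -> R) w y r c C :
  (forall n, measurable_fun (eball y r : set plane) (wn n)) ->
  measurable_fun (eball y r : set plane) w ->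
  {ae mu, forall x, eball y r x -> wn n x @[n --> \oo] --> w x} ->
  (forall n x, eball y r x -> `|wn n x| <= C) ->
  (forall n, lap_le c (wn n) y r) -> lap_le c w y r.
Proof.
move=> mwn mw cw wC h s t /andP[s0 sr] t0.
have sub := @eball_sub R y _ _ sr; have mB := measurable_eball y r.
have sK : smooth (fun x => kout s t y x - kin s t y x).
  by apply: smoothB; [exact: smooth_kout|exact: smooth_kin].
have cv := @kernel_integral_limit wn w _ y s C
  (fun n => measurable_funS mB sub (mwn n)) (measurable_funS mB sub mw)
  (@filterS _ _ (ae_filter_ringOfSetsType mu) _ _ (fun x hx xs => hx (sub _ xs)) cw)
  (fun n x xs => wC n x (sub _ xs)) sK.
apply: (cvgr_to_le cv); apply: nearW => n; apply: h => //; exact/andP.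
Qed.

Lemma lap_ge_limit (wn fn : nat -> R * R -> R) w y r c C C' :
  (forall n, measurable_fun (eball y r : set plane) (wn n)) ->
  measurable_fun (eball y r : set plane) w ->
  {ae mu, forall x, eball y r x -> wn n x @[n --> \oo] --> w x} ->
  (forall n x, eball y r x -> `|wn n x| <= C) ->
  (forall n, measurable_fun (eball y r : set plane) (fn n)) ->
  {ae mu, forall x, eball y r x -> fn n x @[n --> \oo] --> c} ->
  (forall n x, eball y r x -> `|fn n x| <= C') ->
  (forall n, lap_eq (wn n) (fn n) y r) -> lap_ge c w y r.
Proof.
move=> mwn mw cw wC mfn cf fC h s t /andP[s0 sr] t0.
have sub := @eball_sub R y _ _ sr; have mB := measurable_eball y r.
have sK : smooth (fun x => kout s t y x - kin s t y x).
  by apply: smoothB; [exact: smooth_kout|exact: smooth_kin].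
have cv := @kernel_integral_limit wn w _ y s C
  (fun n => measurable_funS mB sub (mwn n)) (measurable_funS mB sub mw)
  (@filterS _ _ (ae_filter_ringOfSetsType mu) _ _ (fun x hx xs => hx (sub _ xs)) cw)
  (fun n x xs => wC n x (sub _ xs)) sK.
have cv' := @kernel_integral_limit fn (fun=> c) _ y s C'
  (fun n => measurable_funS mB sub (mfn n)) (measurable_cst _)
  (@filterS _ _ (ae_filter_ringOfSetsType mu) _ _ (fun x hx xs => hx (sub _ xs)) cf)
  (fun n x xs => fC n x (sub _ xs)) (smooth_kphi y s0 t0).
have E : (fun n => \int[mu]_(x in eball y s) (wn n x * (kout s t y x - kin s t y x))) =
  (fun n => \int[mu]_(x in eball y s) (fn n x * kphi s t y x)).
  by apply/funext => n; apply: h => //; exact/andP.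
rewrite E in cv; rewrite (cvg_unique _ cv cv') //.
by rewrite (RintegralZl _ (measurable_eball y s) (kphi_integrable y s0 t0)).
Qed.

End Limits.

(** * Equations satisfied by the blow-up *)

Section BlowUp.
Variable R : realType.
Local Notation plane := (measurableTypeR R * measurableTypeR R)%type.
Local Notation mu := (@leb2 R).
Local Notation D := (@unit_disk R).
Implicit Types (s t r c : R) (x y z : R * R) (f g u w : R * R -> R).

Section Generic.
Variables (w f w0 : R * R -> R) (rho : nat -> R) (c C0 : R) (y : R * R) (r : R).
Hypotheses (iw : mu.-integrable D (EFin \o w)) (fi : mu.-integrable D (EFin \o f)).
Hypotheses (fc : forall x, D x -> 0 <= f x <= c).
Hypotheses (C00 : 0 <= C0) (wC : forall x, dist2 0 x < 1 / 4 -> `|w x| <= C0 * dist2 0 x).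
Hypotheses (rho0 : forall n, 0 < rho n) (crho : rho @ \oo --> (0 : R)).
Hypothesis eqn : forall n, eball (rho n *: y) (rho n ^+ 2 * r) `<=` D ->
  lap_eq w f (rho n *: y) (rho n ^+ 2 * r).
Hypothesis cvw : {ae mu, forall x : plane, w (rho n *: (x : R * R)) / rho n ^+ 2 @[n --> \oo] --> w0 x}.
Hypothesis mw0 : measurable_fun (eball y r : set plane) w0.

(** The quadratic growth is exactly what makes the quadratic rescaling
    bounded. *)
Lemma rescaled_bound : exists N C, forall n x, (N <= n)%N -> eball y r x ->
  D (rho n *: x) /\ `|w (rho n *: x) / rho n ^+ 2| <= C.
Proof.
have [b yb] := eball_box0 y r; pose B := 2 * b ^+ 2 + 1.
have B0 : 0 < B by rewrite ltr_wpDl// mulr_ge0// sqr_ge0.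
have yB x : eball y r x -> dist2 0 x < B.
  move=> /yb /box0P[/andP[h1 h2] /andP[h3 h4]]; rewrite /dist2 !subr0 /B.
  have aux (e : R) : - b <= e -> e <= b -> e ^+ 2 <= b ^+ 2 by nra.
  by have := aux _ h1 h2; have := aux _ h3 h4; lra.
have e0 : 0 < 1 / (4 * B + 4) by rewrite divr_gt0//; lra.
have [N _ HN] : \forall n \near \oo, `|rho n| < 1 / (4 * B + 4).
  by have /cvgr0Pnorm_lt := crho; apply.
exists N, (C0 * B) => n x nN /yB xB.
have := HN n nN; rewrite gtr0_norm// => rn.
have rn1 : rho n * (4 * B + 4) < 1 by rewrite -ltr_pdivlMr//; lra.
have p0 := rho0 n.
have r2 : rho n ^+ 2 * B < 1 / 4 by nra.
have d4 : dist2 0 (rho n *: x) < 1 / 4.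
  rewrite dist2_scale0; apply: le_lt_trans r2; apply: ler_wpM2l; first exact: sqr_ge0.
  exact: ltW.
split; first by rewrite unit_diskE /eball/=; lra.
rewrite normrM normfV (ger0_norm (sqr_ge0 (rho n))).
have pp : 0 < rho n ^+ 2 by rewrite exprn_gt0.
rewrite ler_pdivrMr//.
apply: (le_trans (wC d4)); rewrite dist2_scale0 mulrCA mulrC; apply: ler_wpM2r; first exact: ltW.
by apply: ler_wpM2l => //; exact: ltW.
Qed.

(** Dropping finitely many terms makes the bounds uniform over the whole
    sequence. *)
Let setup : exists (sh : nat -> R) C,
  [/\ forall n, 0 < sh n,
   forall n, lap_eq (fun x : R * R => w (sh n *: x) / sh n ^+ 2) (fun x : R * R => f (sh n *: x)) y r,
   forall n x, eball y r x -> D (sh n *: x) /\ `|w (sh n *: x) / sh n ^+ 2| <= C,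
   (forall n, measurable_fun (eball y r : set plane) (fun x : R * R => w (sh n *: x) / sh n ^+ 2)) /\
   (forall n, measurable_fun (eball y r : set plane) (fun x : R * R => f (sh n *: x))) &
   {ae mu, forall x : R * R, eball y r x -> w (sh n *: x) / sh n ^+ 2 @[n --> \oo] --> w0 x} /\
   exists N, sh = fun n => rho (n + N)%N].
Proof.
have [N [C NC]] := rescaled_bound.
exists (fun n => rho (n + N)%N), C; have mD := @measurable_disk R.
have mB := measurable_eball y r.
have sub n : eball y r `<=` stretch (rho (n + N)%N, rho (n + N)%N) @^-1` D.
  by move=> x xr; have [] := NC (n + N)%N x (leq_addl _ _) xr.
have ball n : eball (rho (n + N)%N *: y) (rho (n + N)%N ^+ 2 * r) `<=` D.
  move=> x xr; have p0 := rho0 (n + N).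
  have xE : x = rho (n + N)%N *: ((rho (n + N)%N)^-1 *: x).
    by rewrite scalerA divff ?scale1r// gt_eqF.
  rewrite xE; apply: (sub n); rewrite -(eball_scale y r p0) /=.
  by rewrite -[stretch _ _]xE.
have mwD : measurable_fun (D : set plane) w by apply/measurable_EFinP; exact: measurable_int iw.
have mfD : measurable_fun (D : set plane) f by apply/measurable_EFinP; exact: measurable_int fi.
have mDs n := measurable_stretch_preimage (rho (n + N)%N, rho (n + N)%N) mD.
split => //.
- move=> n; apply: lap_eq_scale => //.
  + by apply: integrableS iw => //; exact: measurable_eball.
  + by apply: integrableS fi => //; exact: measurable_eball.
  + exact: eqn.
- by move=> n x; apply: NC; exact: leq_addl.
- have mst (g : R * R -> R) n : measurable_fun (D : set plane) g ->
    measurable_fun (eball y r : set plane) (fun x : R * R => g (rho (n + N)%N *: x)).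
    move=> mg; apply: (measurable_funS (mDs n) (sub n)).
    exact: (@measurable_fun_stretch R (rho (n + N)%N, rho (n + N)%N) _ _ mg mD).
  split=> n; last exact: mst.
  by apply: (@measurable_funM _ plane R (eball y r) (fun x : R * R => w (rho (n + N)%N *: x)));
    [exact: mst|exact: measurable_cst].
- split; last by exists N.
  apply: (@filterS _ _ (ae_filter_ringOfSetsType mu) _ _ _ cvw) => x h _.
  by have := h; rewrite -(cvg_shiftn N).
Qed.

Lemma blowup_lap_le : lap_le c w0 y r.
Proof.
have [sh [C [sh0 e bd [mw mf] [cv _]]]] := setup.
apply: (lap_le_limit mw mw0 cv (fun n x xr => (bd n x xr).2)) => n.
apply: (lap_eq_le (e n)).
  have [b yb] := eball_box0 y r.
  apply: (bounded_integrable (measurable_eball _ _) yb (mf n) (C := c)) => x xr.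
  have [Dx _] := bd n x xr.
  by have /andP[f0 f1] := fc Dx; rewrite ger0_norm.
by move=> x xr; have [Dx _] := bd n x xr; have /andP[] := fc Dx.
Qed.

Lemma blowup_lap_ge :
  {ae mu, forall x : plane, eball y r x -> \forall n \near \oo, D (rho n *: (x : R * R)) -> f (rho n *: (x : R * R)) = c} ->
  lap_ge c w0 y r.
Proof.
move=> ev; have [sh [C [sh0 e bd [mw mf] [cv [N shE]]]]] := setup.
apply: (@lap_ge_limit R _ (fun n x => f (sh n *: x)) _ _ _ _ C c mw mw0 cv
  (fun n x xr => (bd n x xr).2) mf _ _ e).
  apply: (@filterS _ _ (ae_filter_ringOfSetsType mu) _ _ _ ev) => x h xr.
  have [M _ HM] := h xr.
  apply: cvg_near_cst; exists M => // n /= Mn.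
  have [Dx _] := bd n x xr.
  by move: Dx; rewrite shE; apply: HM; rewrite /= (leq_trans Mn)// leq_addr.
move=> n x xr; have [Dx _] := bd n x xr; have /andP[f0 f1] := fc Dx.
by rewrite ger0_norm.
Qed.

End Generic.

Variables (a b : R) (v v0 : R * R -> R) (rho : nat -> R).
Hypotheses (a0 : 0 < a) (b0 : 0 < b) (sol : obstacle_solution a b v).
Hypotheses (rho0 : forall n, 0 < rho n) (crho : rho @ \oo --> (0 : R)).
Hypothesis cvv : {ae mu, forall x : plane, v (rho n *: (x : R * R)) / rho n ^+ 2 @[n --> \oo] --> v0 x}.
Hypothesis cv0 : continuous v0.

Let mv0 (A : set plane) : measurable_fun A v0.
Proof. by apply: measurable_funTS; exact: continuous_plane_measurable. Qed.

Lemma ae_ball_nonempty y s (P : plane -> Prop) : 0 < s -> {ae mu, forall x, P x} ->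
  exists2 x : R * R, eball y s x & P x.
Proof.
move=> s0 [N [mN N0 PN]]; apply: contrapT => h.
pose q := Num.sqrt s / 2; have q0 : 0 < q by rewrite divr_gt0// sqrtr_gt0.
have qs : q ^+ 2 = s / 4 by rewrite /q exprMn sqr_sqrtr ?ltW// exprVn; congr (_ / _); ring.
have sub : box y q `<=` N.
  move=> x [/= /andP[h1 h2] /andP[h3 h4]]; apply: PN => Px; apply: h; exists x => //.
  rewrite /eball/= /dist2.
  have aux (e : R) : - q <= e -> e <= q -> e ^+ 2 <= s / 4 by rewrite -qs; nra.
  have := aux (x.1 - y.1); have := aux (x.2 - y.2) => k1 k2.
  have := k1 ltac:(lra) ltac:(lra); have := k2 ltac:(lra) ltac:(lra); lra.
have : (mu (box y q) <= mu N)%E.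
  by apply: le_measure => //; rewrite inE//; exact: measurable_box.
rewrite N0 (leb2_box _ (ltW q0)) lee_fin leNgt.
by rewrite exprn_gt0// mulr_gt0.
Qed.

(** The inequality holds almost everywhere, hence everywhere by continuity. *)
Lemma blowup_ge0 x : 0 <= v0 x.
Proof.
rewrite leNgt; apply/negP => vx.
have e0 : 0 < - v0 x by rewrite oppr_gt0.
have [d d0 dv] : exists2 d, 0 < d & eball x d `<=` [set z | `|v0 x - v0 z| < - v0 x].
  by apply: nbhs_eball; have /cvgrPdist_lt /(_ _ e0) := @cv0 x.
have [z /dv /= zx cz] := ae_ball_nonempty x d0 cvv.
have vz : v0 z < 0 by move: zx; rewrite ltr_norml => /andP[h1 _]; lra.
suff : 0 <= v0 z by rewrite leNgt vz.
apply: (cvgr_to_ge cz).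
have e1 : 0 < 1 / (dist2 0 z + 1) by rewrite divr_gt0// ltr_wpDl// dist2_ge0.
have /cvgr0Pnorm_lt /(_ _ e1) := crho; apply: filterS => n.
rewrite gtr0_norm// => rn; rewrite divr_ge0 ?sqr_ge0//.
apply: (sol_ge0 sol); rewrite unit_diskE /eball/= dist2_scale0.
have dz := dist2_ge0 0 z; have p0 := rho0 n.
have : rho n * (dist2 0 z + 1) < 1 by rewrite -ltr_pdivlMr ?ltr_wpDl//; lra.
have p1 : rho n < 1.
  by apply: (lt_le_trans rn); rewrite ler_pdivrMr ?ltr_wpDl//; lra.
move=> h; have : rho n ^+ 2 * dist2 0 z <= rho n * dist2 0 z.
  by rewrite expr2 -mulrA ler_piMl ?mulr_ge0// ltW.
lra.
Qed.

Let m := Num.min a b.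
Let m0 : 0 < m. Proof. by rewrite lt_min a0 b0. Qed.

Let fold_growth' : exists2 C, 0 <= C & forall x, dist2 0 x < 1 / 4 ->
  [/\ `|v x| <= C * dist2 0 x, `|v (flip x)| <= C * dist2 0 x & `|fold a b v x| <= C * dist2 0 x].
Proof.
have [C C0 hC] := fold_growth a0 b0 sol.
exists (C + C / m) => [|x x4]; first by rewrite addr_ge0// divr_ge0// ltW.
have Dx : D x by rewrite unit_diskE /eball/=; lra.
have Df := diskF Dx.
have h1 := le_fold a0 b0 sol Dx (ltW m0); have h2 := le_fold a0 b0 sol Df (ltW m0).
have ma : m <= a by rewrite ge_min lexx.
have mb : m <= b by rewrite ge_min lexx orbT.
have ff : fold a b v (flip x) = fold a b v x by rewrite /fold /flip/= normrN.
have {}h1 := h1 ma mb; have {}h2 := h2 ma mb; rewrite ff in h2.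
have hx := hC x x4; have dx := dist2_ge0 0 x.
have Cm : 0 <= C / m by rewrite divr_ge0// ltW.
have E : (C + C / m) * dist2 0 x = C * dist2 0 x + C * dist2 0 x / m by ring.
have q1 : 0 <= C * dist2 0 x by exact: mulr_ge0.
have q2 : 0 <= C * dist2 0 x / m by rewrite divr_ge0// ltW.
rewrite E !ger0_norm ?(sol_ge0 sol)//; last exact: (fold_ge0 a0 b0 sol).
split.
- by rewrite ler_wpDl// ler_pdivlMr// mulrC; exact: le_trans hx.
- by rewrite ler_wpDl// ler_pdivlMr// mulrC; exact: le_trans hx.
- by rewrite ler_wpDr.
Qed.

(** Where the limit is positive, so are the rescaled functions eventually,
    and the right-hand side is 1/2 there. *)
Let rhs_eventually (x : R * R) (g : R * R -> R * R) : 0 < v0 (g x) ->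
  (forall p, g (p *: x) = p *: g x) ->
  v (rho n *: g x) / rho n ^+ 2 @[n --> \oo] --> v0 (g x) ->
  \forall n \near \oo, D (g (rho n *: x)) -> rhs v (g (rho n *: x)) = 2^-1.
Proof.
move=> vx gp cvx; have /cvgr_gt /(_ _ vx) := cvx; apply: filterS => n h Dx.
rewrite rhsE// gp ifT//; move: h; rewrite pmulr_lgt0// invr_gt0 exprn_gt0//.
Qed.

Let flip_scale (p : R) x : flip (p *: x) = p *: flip x.
Proof. by rewrite /flip /=; congr pair; rewrite -scalerN. Qed.

Let cvvf : {ae mu, forall x : plane, v (rho n *: flip x) / rho n ^+ 2 @[n --> \oo] --> v0 (flip x)}.
Proof. exact: (ae_flip cvv). Qed.

Let scaled_rhs (k : R) x : 0 < k -> 0 <= k^-1 * rhs v x <= k^-1 * 2^-1.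
Proof.
move=> k0; have /andP[h1 h2] := rhs_bound v x.
have k1 : 0 <= k^-1 by rewrite invr_ge0 ltW.
by apply/andP; split; [exact: mulr_ge0|exact: ler_wpM2l].
Qed.

Lemma blowup_upper y r : (forall x, eball y r x -> 0 < x.2) -> lap_le (a^-1 * 2^-1) v0 y r.
Proof.
move=> yup; have [C C0 hC] := fold_growth'.
apply: (@blowup_lap_le v (fun x => a^-1 * rhs v x) v0 rho _ C y r) => //.
- exact: sol_integrable sol.
- by apply: integrable_scale; [exact: measurable_disk|exact: rhs_integrable sol].
- by move=> x _; exact: scaled_rhs.
- by move=> x /hC[].
- move=> n sub; apply: (lap_eq_upper a0 sol sub) => x.
  have p0 := rho0 n.
  have xE : x = rho n *: ((rho n)^-1 *: x) by rewrite scalerA divff ?scale1r// gt_eqF.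
  rewrite {1}xE => h; have : eball y r ((rho n)^-1 *: x).
    by rewrite -(eball_scale y r p0).
  by move=> /yup /=; rewrite pmulr_rgt0// invr_gt0.
Qed.

Lemma blowup_upper_ge y r : (forall x, eball y r x -> 0 < x.2) ->
  (forall x, eball y r x -> 0 < v0 x) -> lap_ge (a^-1 * 2^-1) v0 y r.
Proof.
move=> yup ypos; have [C C0 hC] := fold_growth'.
apply: (@blowup_lap_ge v (fun x => a^-1 * rhs v x) v0 rho _ C y r) => //.
- exact: sol_integrable sol.
- by apply: integrable_scale; [exact: measurable_disk|exact: rhs_integrable sol].
- by move=> x _; exact: scaled_rhs.
- by move=> x /hC[].
- move=> n sub; apply: (lap_eq_upper a0 sol sub) => x.
  have p0 := rho0 n.
  have xE : x = rho n *: ((rho n)^-1 *: x) by rewrite scalerA divff ?scale1r// gt_eqF.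
  rewrite {1}xE => h; have : eball y r ((rho n)^-1 *: x).
    by rewrite -(eball_scale y r p0).
  by move=> /yup /=; rewrite pmulr_rgt0// invr_gt0.
- apply: (@filterS _ _ (ae_filter_ringOfSetsType mu) _ _ _ cvv) => x h /ypos xp.
  by have := @rhs_eventually x id xp (fun=> erefl) h; apply: filterS => n hn /hn ->.
Qed.

Let mv0f (A : set plane) : measurable_fun A (fun x => v0 (flip x)).
Proof.
apply: measurable_funTS; apply: continuous_plane_measurable => x.
by apply: (@continuous_comp _ _ _ (@flip R) v0 x); [exact: continuous_flip|exact: cv0].
Qed.

Lemma blowup_lower y r : (forall x, eball y r x -> 0 < x.2) ->
  lap_le (b^-1 * 2^-1) (fun x => v0 (flip x)) y r.
Proof.
move=> yup; have [C C0 hC] := fold_growth'.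
apply: (@blowup_lap_le (fun x => v (flip x)) (fun x => b^-1 * rhs v (flip x)) _ rho _ C y r) => //.
- exact: (flip_integrable_disk (sol_integrable sol)).
- apply: integrable_scale; first exact: measurable_disk.
  exact: (flip_integrable_disk (rhs_integrable sol)).
- by move=> x _; exact: scaled_rhs.
- by move=> x /hC[].
- move=> n sub; apply: (lap_eq_lower b0 sol sub) => x.
  have p0 := rho0 n.
  have xE : x = rho n *: ((rho n)^-1 *: x) by rewrite scalerA divff ?scale1r// gt_eqF.
  rewrite {1}xE => h; have : eball y r ((rho n)^-1 *: x).
    by rewrite -(eball_scale y r p0).
  by move=> /yup /=; rewrite pmulr_rgt0// invr_gt0.
- apply: (@filterS _ _ (ae_filter_ringOfSetsType mu) _ _ _ cvvf) => x.
  by under eq_cvg do rewrite -flip_scale.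
Qed.

Lemma blowup_lower_ge y r : (forall x, eball y r x -> 0 < x.2) ->
  (forall x, eball y r x -> 0 < v0 (flip x)) ->
  lap_ge (b^-1 * 2^-1) (fun x => v0 (flip x)) y r.
Proof.
move=> yup ypos; have [C C0 hC] := fold_growth'.
apply: (@blowup_lap_ge (fun x => v (flip x)) (fun x => b^-1 * rhs v (flip x)) _ rho _ C y r) => //.
- exact: (flip_integrable_disk (sol_integrable sol)).
- apply: integrable_scale; first exact: measurable_disk.
  exact: (flip_integrable_disk (rhs_integrable sol)).
- by move=> x _; exact: scaled_rhs.
- by move=> x /hC[].
- move=> n sub; apply: (lap_eq_lower b0 sol sub) => x.
  have p0 := rho0 n.
  have xE : x = rho n *: ((rho n)^-1 *: x) by rewrite scalerA divff ?scale1r// gt_eqF.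
  rewrite {1}xE => h; have : eball y r ((rho n)^-1 *: x).
    by rewrite -(eball_scale y r p0).
  by move=> /yup /=; rewrite pmulr_rgt0// invr_gt0.
- apply: (@filterS _ _ (ae_filter_ringOfSetsType mu) _ _ _ cvvf) => x.
  by under eq_cvg do rewrite -flip_scale.
- apply: (@filterS _ _ (ae_filter_ringOfSetsType mu) _ _ _ cvvf) => x h /ypos xp.
  have := @rhs_eventually x (@flip R) xp (fun p => flip_scale p x) h.
  by apply: filterS => n hn /diskF /hn ->.
Qed.

Lemma fold_scale (p : R) (u : R * R -> R) x : 0 < p ->
  fold a b u (p *: x) / p ^+ 2 = fold a b (fun z => u (p *: z) / p ^+ 2) x.
Proof.
move=> p0; have pn : `|p *: x.2| = p *: `|x.2| by rewrite normrM gtr0_norm.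
have E1 : ((p *: x).1, `|(p *: x).2|) = p *: (x.1, `|x.2|) by rewrite /= pn.
have E2 : ((p *: x).1, - `|(p *: x).2|) = p *: (x.1, - `|x.2|).
  by rewrite /= pn -scalerN.
by rewrite /fold E1 E2; ring.
Qed.

Lemma ae_fold : {ae mu, forall x : plane,
  fold a b v (rho n *: (x : R * R)) / rho n ^+ 2 @[n --> \oo] --> fold a b v0 x}.
Proof.
apply: (@filterS2 _ _ (ae_filter_ringOfSetsType mu) _ _ _ _ cvv cvvf) => x h1 h2.
have E : (fun n => fold a b v (rho n *: x) / rho n ^+ 2) =
  fun n => fold a b (fun z => v (rho n *: z) / rho n ^+ 2) x.
  by apply/funext => n; exact: fold_scale.
rewrite E foldE; under eq_cvg do rewrite foldE.
by case: ifP => _; apply: cvgD; apply: cvgM => //; exact: cvg_cst.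
Qed.

Lemma continuous_fold0 : continuous (fold a b v0).
Proof.
move=> x.
have c1 : {for x, continuous (fun z => (z.1, `|z.2|) : R * R)}.
  apply: continuous_pair2; first exact: cvg_fst.
  by apply: cvg_norm; exact: cvg_snd.
have c2 : {for x, continuous (fun z => (z.1, - `|z.2|) : R * R)}.
  apply: continuous_pair2; first exact: cvg_fst.
  by apply: cvgN; apply: cvg_norm; exact: cvg_snd.
apply: cvgD; (apply: cvgM; first exact: cvg_cst).
  exact: (@continuous_comp _ _ _ _ v0 x c1 (@cv0 (x.1, `|x.2|))).
exact: (@continuous_comp _ _ _ _ v0 x c2 (@cv0 (x.1, - `|x.2|))).
Qed.

Lemma blowup_fold y r : lap_le 1 (fold a b v0) y r.
Proof.
have [C C0 hC] := fold_growth'.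
apply: (@blowup_lap_le (fold a b v) (fold_rhs v) _ rho _ C y r) => //.
- exact: fold_integrable.
- exact: (fold_rhs_integrable sol).
- by move=> x _; exact: fold_rhs_bound.
- by move=> x /hC[].
- by move=> n sub; exact: lap_eq_fold.
- exact: ae_fold.
- by apply: measurable_funTS; apply: continuous_plane_measurable; exact: continuous_fold0.
Qed.

Lemma blowup_fold_ge y r : (forall x, eball y r x -> 0 < v0 x /\ 0 < v0 (flip x)) ->
  lap_ge 1 (fold a b v0) y r.
Proof.
move=> ypos; have [C C0 hC] := fold_growth'.
apply: (@blowup_lap_ge (fold a b v) (fold_rhs v) _ rho _ C y r) => //.
- exact: fold_integrable.
- exact: (fold_rhs_integrable sol).
- by move=> x _; exact: fold_rhs_bound.
- by move=> x /hC[].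
- by move=> n sub; exact: lap_eq_fold.
- exact: ae_fold.
- by apply: measurable_funTS; apply: continuous_plane_measurable; exact: continuous_fold0.
- apply: (@filterS2 _ _ (ae_filter_ringOfSetsType mu) _ _ _ _ cvv cvvf) => x h1 h2 /ypos[p1 p2].
  have e1 := @rhs_eventually x id p1 (fun=> erefl) h1.
  have e2 := @rhs_eventually x (@flip R) p2 (fun p => flip_scale p x) h2.
  apply: filterS2 e1 e2 => n q1 q2 Dx.
  have r1 : rhs v (rho n *: (x : R * R)) = 2^-1 := q1 Dx.
  have r2 : rhs v (flip (rho n *: (x : R * R))) = 2^-1 := q2 (diskF Dx).
  by rewrite /fold_rhs r1 r2; field.
Qed.

End BlowUp.

(** * The blow-up does not vanish *)

Lemma ball_in_box (R : realType) (z p : R * R) : dist2 z p < 1 ->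
  exists2 r, 0 < r & eball p r `<=` box z 1.
Proof.
have q1 := sqr_ge0 (p.1 - z.1); have q2 := sqr_ge0 (p.2 - z.2).
rewrite /dist2 => d1.
have aux (e : R) : e ^+ 2 < 1 -> `|e| < 1.
  by move=> h; rewrite -(ltr_pXn2r (n := 2)) ?nnegrE ?ler01// real_normK ?num_real// expr1n.
have n1 : `|p.1 - z.1| < 1 by apply: aux; lra.
have n2 : `|p.2 - z.2| < 1 by apply: aux; lra.
pose k := Num.min (1 - `|p.1 - z.1|) (1 - `|p.2 - z.2|).
have k0 : 0 < k by rewrite lt_min !subr_gt0 n1 n2.
have k1 : k <= 1 - `|p.1 - z.1| by rewrite ge_min lexx.
have k2 : k <= 1 - `|p.2 - z.2| by rewrite ge_min lexx orbT.
exists (k ^+ 2); first exact: exprn_gt0.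
move=> x /(eball_box (ltW k0) (lexx _)) [].
move: n1 n2 k1 k2; rewrite !ltr_norml => _ _ k1 k2 /andP[h1 h2] /andP[h3 h4].
have := ler_norm (p.1 - z.1); have := ler_norm (p.2 - z.2).
have := ler_norm (- (p.1 - z.1)); have := ler_norm (- (p.2 - z.2)); rewrite !normrN => m1 m2 m3 m4.
by clear - h1 h2 h3 h4 m1 m2 m3 m4 k1 k2; split; apply/andP; split; lra.
Qed.

Lemma box_dist2 (R : realType) (z x : R * R) : dist2 0 z < 1 / 16 -> box z 1 x ->
  dist2 0 x <= 4.
Proof.
rewrite /dist2 !subr0 => zr [/andP[h1 h2] /andP[h3 h4]].
have aux (e f : R) : e ^+ 2 < 1 / 16 -> e - 1 <= f -> f <= e + 1 -> f ^+ 2 <= 25 / 16.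
  move=> k1 k2 k3; have : - (1 / 4) <= e <= 1 / 4.
    by rewrite -ler_norml -(ler_pXn2r (n := 2)) ?nnegrE ?divr_ge0// real_normK ?num_real//; lra.
  by move=> /andP[k4 k5]; nra.
have e1 := sqr_ge0 z.1; have e2 := sqr_ge0 z.2.
have z1 : z.1 ^+ 2 < 1 / 16 by lra.
have z2 : z.2 ^+ 2 < 1 / 16 by lra.
have f1 := aux _ _ z1 h1 h2; have f2 := aux _ _ z2 h3 h4; lra.
Qed.

Section Nondegeneracy.
Variable R : realType.
Local Notation plane := (measurableTypeR R * measurableTypeR R)%type.
Local Notation mu := (@leb2 R).
Local Notation D := (@unit_disk R).
Implicit Types (s t r c : R) (x y z p : R * R).
Variables (a b : R) (v v0 : R * R -> R) (rho : nat -> R).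
Hypotheses (a0 : 0 < a) (b0 : 0 < b) (sol : obstacle_solution a b v).
Hypotheses (rho0 : forall n, 0 < rho n) (crho : rho @ \oo --> (0 : R)).
Hypothesis cvv : {ae mu, forall x : plane, v (rho n *: (x : R * R)) / rho n ^+ 2 @[n --> \oo] --> v0 x}.
Hypothesis cv0 : continuous v0.

Lemma eball_scaled_sub (q : R) y r : 0 < q -> (forall x, eball y r x -> D (q *: x)) ->
  eball (q *: y) (q ^+ 2 * r) `<=` D.
Proof.
move=> q0 h x xr; have xE : x = q *: (q^-1 *: x).
  by rewrite scalerA divff ?scale1r// gt_eqF.
rewrite xE; apply: h; rewrite -(eball_scale y r q0) /=.
by rewrite -[stretch _ _]xE.
Qed.

(** The maximum of [w - c * dist2 z] over the box is attained in its
    interior, because the paraboloid exceeds [w] near the boundary, while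
    [w z] is positive. *)
Lemma compact_touching (w : R * R -> R) z c M : 0 < w z ->
  (forall x, box z 1 x -> {for x, continuous w}) ->
  (forall x, box z 1 x -> w x <= M) -> M < c ->
  exists p r, [/\ 0 < r, eball p r `<=` box z 1, 0 < w p &
    forall x, eball p r x -> w x <= w p + c * (dist2 z x - dist2 z p)].
Proof.
move=> wz cw wM Mc.
have zz : box z 1 z by split; apply/andP; split; lra.
have c0 : 0 < c by have := wM z zz; lra.
have cG : {within box z 1, continuous (fun x => w x - c * dist2 z x)}.
  apply: continuous_in_subspaceT => x; rewrite inE => xB.
  apply: cvgB; first exact: cw.
  by apply: cvgM; [exact: cvg_cst|exact: dist2_continuous].
have [|p] := @compact_EVT_max _ _ _ _ _ (@compact_box R z 1) cG.
  by exists z.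
rewrite inE => pB pmax.
have zp : dist2 z z = 0 by rewrite /dist2 !subrr expr0n addr0.
have hz := pmax z; rewrite inE zp mulr0 subr0 in hz; have {}hz := hz zz.
have dp := dist2_ge0 z p.
have cdp : 0 <= c * dist2 z p by rewrite mulr_ge0// ltW.
have wp : 0 < w p by lra.
have wpM := wM p pB.
have d1 : dist2 z p < 1.
  rewrite ltNge; apply/negP => d1.
  have : c * 1 <= c * dist2 z p by rewrite ler_pM2l.
  lra.
have [r r0 sub] := ball_in_box d1.
exists p, r; split => //.
move=> x /sub xB; have := pmax x; rewrite inE => /(_ xB); rewrite mulrBr; lra.
Qed.

(** Nondegeneracy: if the blow-up vanished, the rescaled solutions would be
    small on a fixed disk by the sub-mean value property, while the Laplacian
    of [fold] is at least 1/2 where it is positive; comparison with the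
    paraboloid of Laplacian 1/4 centred at a point of positivity forbids it. *)
Lemma blowup_nonzero : ~ (forall x, v0 x = 0).
Proof.
move=> v00; have [C1 C10 hC] := fold_growth a0 b0 sol.
have hC' x : dist2 0 x < 1 / 4 -> `|fold a b v x| <= C1 * dist2 0 x.
  move=> x4; rewrite ger0_norm; first exact: hC.
  by apply: (fold_ge0 a0 b0 sol); rewrite unit_diskE /eball/=; lra.
have [N [C NC]] := rescaled_bound (0 : R * R) 9 C10 hC' rho0 crho.
pose W n x := fold a b v (rho n *: (x : R * R)) / rho n ^+ 2.
have mD := @measurable_disk R.
have mB : measurable (eball (0 : R * R) 9 : set plane) by exact: measurable_eball.
have sub n : (N <= n)%N -> eball 0 9 `<=` stretch (rho n, rho n) @^-1` D.
  by move=> nN x xr; have [] := NC n x nN xr.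
have mW n : (N <= n)%N -> measurable_fun (eball (0 : R * R) 9 : set plane) (W n).
  move=> nN; apply: (@measurable_funM _ plane R _ (fun x => fold a b v (rho n *: (x : R * R))));
    last exact: measurable_cst.
  apply: (measurable_funS (measurable_stretch_preimage (rho n, rho n) mD) (sub n nN)).
  exact: (@measurable_fun_stretch R (rho n, rho n) _ _ (fold_measurable sol) mD).
have Wb n x : (N <= n)%N -> eball 0 9 x -> `|W n x| <= C by move=> nN xr; have [] := NC n x nN xr.
have f00 : fold a b v0 = fun=> 0.
  by apply/funext => x; rewrite /fold !v00 !mulr0 addr0.
have [b9 sb9] := eball_box0 (0 : R * R) 9.
have iW n : (N <= n)%N -> mu.-integrable (eball (0 : R * R) 9) (EFin \o W n).
  move=> nN; apply: (bounded_integrable mB sb9 (mW n nN) (C := C)) => x.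
  exact: Wb.
have cI : \int[mu]_(x in eball (0 : R * R) 9) W (n + N)%N x @[n --> \oo] --> (0 : R).
  have h1 k : measurable_fun (eball (0 : R * R) 9 : set plane) (W (k + N)%N).
    by apply: mW; exact: leq_addl.
  have h2 : measurable_fun (eball (0 : R * R) 9 : set plane) (fun=> 0 : R).
    exact: measurable_cst.
  have h3 : {ae mu, forall x : plane, eball 0 9 x -> W (k + N)%N x @[k --> \oo] --> (0 : R)}.
    have h := ae_fold a b rho0 cvv; rewrite f00 in h.
    apply: (@filterS _ _ (ae_filter_ringOfSetsType mu) _ _ _ h) => x hx _.
    by have := hx; rewrite -(cvg_shiftn N).
  have h4 : mu.-integrable (eball 0 9) (EFin \o (fun=> C : R)).
    apply: continuous_eball_integrable; exact: cst_continuous.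
  have h5 k x : eball 0 9 x -> `|W (k + N)%N x| <= C.
    by move=> xr; apply: Wb => //; exact: leq_addl.
  have [_] := @Rdominated_convergence R (eball 0 9) (fun k => W (k + N)%N) _ _ mB h1 h2 h3 h4 h5.
  by rewrite Rintegral_cst// mul0r.
pose K : R := 2560 * expR 6.
have K0 : 0 < K by apply: mulr_gt0; [rewrite ltr0n|exact: expR_gt0].
have d0 : 0 < 1 / (32 * K).
  by move: (K) K0 => k k0; rewrite divr_gt0// mulr_gt0.
have [M _ HM] : \forall n \near \oo, `|\int[mu]_(x in eball (0 : R * R) 9) W (n + N)%N x| < 1 / (32 * K).
  by have /cvgr0Pnorm_lt := cI; apply.
pose n := (M + N)%N; have nN : (N <= n)%N by exact: leq_addl.
have {HM} hI : \int[mu]_(x in eball (0 : R * R) 9) W n x < 1 / (32 * K).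
  by apply: le_lt_trans (ler_norm _) _; apply: HM => /=.
have p0 := rho0 n; have pn : rho n != 0 by rewrite gt_eqF.
have p2 : 0 < rho n ^+ 2 by rewrite exprn_gt0.
have inD x : eball 0 9 x -> D (rho n *: x) by move=> xr; exact: (sub n nN).
have W0 x : eball 0 9 x -> 0 <= W n x.
  by move=> /inD Dx; rewrite divr_ge0 ?(ltW p2)//; exact: (fold_ge0 a0 b0 sol).
have cW x : eball 0 9 x -> {for x, continuous (W n)}.
  move=> /inD Dx; apply: cvgM; last exact: cvg_cst.
  have cs : {for x, continuous (fun z : R * R => rho n *: z)} by apply: cvgZr; exact: cvg_id.
  exact: (@continuous_comp _ _ _ _ (fold a b v) x cs (fold_cont sol Dx)).
have leq y r : eball y r `<=` eball 0 9 ->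
    lap_eq (W n) (fun x => fold_rhs v (rho n *: x)) y r.
  move=> yr; have sD := eball_scaled_sub p0 (fun x xr => inD x (yr x xr)).
  apply: lap_eq_scale => //.
  - by apply: integrableS (fold_integrable a0 b0 sol) => //; exact: measurable_eball.
  - by apply: integrableS (fold_rhs_integrable sol) => //; exact: measurable_eball.
  - exact: (lap_eq_fold a0 b0 sol).
have irhs y r : eball y r `<=` eball 0 9 ->
    mu.-integrable (eball y r) (EFin \o (fun x => fold_rhs v (rho n *: (x : R * R)))).
  move=> yr; have [b1 sb1] := eball_box0 y r.
  apply: (bounded_integrable (measurable_eball _ _) sb1 (C := 1)).
    apply: (measurable_funS (measurable_stretch_preimage (rho n, rho n) mD)).
      by move=> x /yr; exact: (sub n nN).
    apply: (@measurable_fun_stretch R (rho n, rho n) _ (fold_rhs v)) => //.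
    by apply/measurable_EFinP; exact: measurable_int (fold_rhs_integrable sol).
  by move=> x _; have /andP[h1 h2] := fold_rhs_bound v (rho n *: x); rewrite ger0_norm.
(* the mean value inequality turns convergence in mean into uniform smallness *)
have small x : dist2 0 x <= 4 -> W n x <= 1 / 32.
  move=> x4.
  have xs : eball x 1 `<=` eball 0 9.
    move=> z; rewrite /eball/=; move: x4; rewrite /dist2 !subr0 => h1 h2.
    have q1 := sqr_ge0 (x.1 - 2 * (z.1 - x.1)); have q2 := sqr_ge0 (x.2 - 2 * (z.2 - x.2)).
    nra.
  have iWx : mu.-integrable (eball x 1) (EFin \o W n).
    by apply: integrableS (iW n nN) => //; exact: measurable_eball.
  have h1 : W n x <= K / 1 * \int[mu]_(z in eball x 1) W n z.
    apply: sub_mean_value => //.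
    - by apply: cW; apply: xs; exact: eball_center.
    - by move=> z /xs; exact: W0.
    - apply: (lap_eq_ge (leq _ _ xs) (irhs _ _ xs)) => z _.
      by have /andP[] := fold_rhs_bound v (rho n *: z).
  rewrite divr1 in h1.
  have h2 : \int[mu]_(z in eball x 1) W n z <= \int[mu]_(z in eball (0 : R * R) 9) W n z.
    rewrite /Rintegral fine_le//.
    - by apply: integrable_fin_num => //; exact: measurable_eball.
    - by apply: integrable_fin_num => //; exact: iW.
    apply: ge0_subset_integral => //; first exact: measurable_eball.
      exact: measurable_int (iW n nN).
  apply: (le_trans h1); have := ler_wpM2l (ltW K0) (le_trans h2 (ltW hI)).
  have KE (k : R) : 0 < k -> k * (1 / (32 * k)) = 1 / 32 by move=> k0; field; rewrite gt_eqF.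
  by rewrite (KE _ K0).
have r0 : 0 < rho n ^+ 2 / 16 by rewrite divr_gt0.
have [x0 x0r [Dx0 vx0]] := sol_positive_near sol r0.
pose z : R * R := (rho n)^-1 *: x0.
have zE : rho n *: z = x0 by rewrite /z scalerA divff ?scale1r.
have zr : dist2 0 z < 1 / 16.
  by move: x0r; rewrite /eball/= -zE dist2_scale0 -ltr_pdivlMl// => h; apply: (lt_le_trans h); rewrite le_eqVlt; apply/orP; left; apply/eqP; field.
have Wz : 0 < W n z by rewrite /W zE divr_gt0//; exact: (fold_gt0 a0 b0 sol).
have zB x : box z 1 x -> dist2 0 x <= 4 by exact: box_dist2.
have z9 x : dist2 0 x <= 4 -> eball 0 9 x by move=> h; rewrite /eball/=; lra.
have [|||p [r [r00 pr Wp touch]]] := @compact_touching (W n) z (1 / 16) (1 / 32) Wz.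
- by move=> x /zB /z9; exact: cW.
- by move=> x /zB; exact: small.
- by lra.
have pB : box z 1 p by apply: pr; exact: eball_center.
have [d dd0 dW] : exists2 d, 0 < d & eball p d `<=` [set x | 0 < W n x].
  apply: nbhs_eball; have /cvgr_gt /(_ _ Wp) := cW p (z9 _ (zB _ pB)).
  exact.
pose s := Num.min r d.
have s0 : 0 < s by rewrite lt_min r00 dd0.
have sr : s <= r by rewrite ge_min lexx.
have sd : s <= d by rewrite ge_min lexx orbT.
have ps : eball p s `<=` eball 0 9 by move=> x /(eball_sub sr) /pr /zB /z9.
pose g : R * R -> R := quad (W n p + ((z.1 ^+ 2 + z.2 ^+ 2) - dist2 z p) / 16)
   (- z.1 / 8) (- z.2 / 8) (1 / 16) 0 (1 / 16).
have gE x : g x = W n p + 1 / 16 * (dist2 z x - dist2 z p).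
  by rewrite /g /quad /dist2; field.
(* the paraboloid of Laplacian 1/4 would touch a function of Laplacian at
   least 1/2 *)
suff : 2^-1 <= 2 * (1 / 16) + 2 * (1 / 16) :> R by lra.
apply: (@touch_above R (W n) g p s) => //.
- by apply: measurable_funS (mW n nN).
- by apply: cW; apply: z9; exact: zB.
- exact: smooth_quad.
- by move=> x; rewrite lap_quad.
- by move=> x /(eball_sub sr) /touch; rewrite gE.
- by rewrite gE subrr mulr0 addr0.
- apply: (lap_eq_ge (leq _ _ ps) (irhs _ _ ps)) => x xs.
  apply: (fold_rhs_ge sol); first exact: inD (ps _ xs).
  have := dW x (eball_sub sd xs); rewrite /= /W => h.
  by move: h; rewrite pmulr_lgt0// invr_gt0.
Qed.

End Nondegeneracy.

(** * Homogeneous solutions in a half-plane, in an affine chart *)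

Section HalfPlane.
Variable R : realType.
Local Notation plane := (measurableTypeR R * measurableTypeR R)%type.
Local Notation mu := (@leb2 R).
Implicit Types (s t r c d : R) (x y z : R * R).
Variables (k : R) (u : R * R -> R).
Hypotheses (k0 : 0 < k) (cu : continuous u) (u0 : forall x, 0 <= u x).
Hypothesis uh : forall (p : R) x, 0 < p -> u (p *: x) = p ^+ 2 * u x.
Hypothesis ule : forall y r, (forall x, eball y r x -> 0 < x.2) -> lap_le k u y r.
Hypothesis uge : forall y r, (forall x, eball y r x -> 0 < x.2) ->
  (forall x, eball y r x -> 0 < u x) -> lap_ge k u y r.

(** A homogeneous function on the upper half-plane is determined by its
    values on the line of height 1. *)
Definition slice t : R := u (t, 1).

Lemma sliceE x : 0 < x.2 -> u x = x.2 ^+ 2 * slice (x.1 / x.2).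
Proof.
move=> x2; rewrite /slice -uh//; congr u.
rewrite [x]surjective_pairing; congr pair; rewrite /GRing.scale/= /GRing.scale/=.
  by rewrite mulrC divfK// gt_eqF.
by rewrite mulr1.
Qed.

Lemma slice_ge0 t : 0 <= slice t. Proof. exact: u0. Qed.

Lemma continuous_slice : continuous slice.
Proof.
move=> t; have c : {for t, continuous (fun t => (t, 1) : R * R)}.
  by apply: (@continuous_pair2 R R id (cst 1)); [exact: cvg_id|exact: cvg_cst].
exact: (@continuous_comp _ _ _ _ u t c (@cu (t, 1))).
Qed.

Let mu_ (A : set plane) : measurable_fun A u.
Proof. by apply: measurable_funTS; exact: continuous_plane_measurable. Qed.

Let near_pos (f : R * R -> R) y : smooth f -> 0 < f y -> \forall x \near y, 0 < f x.
Proof.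
move=> sf fy; have c : {for y, continuous f} by exact: smooth_continuous.
by have /cvgr_gt /(_ _ fy) := c; apply.
Qed.

Let sector_ball c d t : c < t < d -> exists2 r, 0 < r &
  forall x, eball (t, 1) r x -> 0 < x.2 /\ c < x.1 / x.2 < d.
Proof.
move=> /andP[ct td].
have h1 := @near_pos (quad 0 1 (- c) 0 0 0) (t, 1) (smooth_quad _ _ _ _ _ _).
have h2 := @near_pos (quad 0 (-1) d 0 0 0) (t, 1) (smooth_quad _ _ _ _ _ _).
have h3 := @near_pos (quad 0 0 1 0 0 0) (t, 1) (smooth_quad _ _ _ _ _ _).
have q1 : 0 < quad 0 1 (- c) 0 0 0 (t, 1) by rewrite /quad/=; lra.
have q2 : 0 < quad 0 (-1) d 0 0 0 (t, 1) by rewrite /quad/=; lra.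
have q3 : 0 < quad 0 0 1 0 0 0 (t, 1) :> R by rewrite /quad/=; lra.
have [r r0 H] := nbhs_eball (filterI (filterI (h1 q1) (h2 q2)) (h3 q3)).
exists r => // x /H [[]]; rewrite /quad/= => k1 k2 k3.
have x2 : 0 < x.2 by lra.
by split => //; rewrite ltr_pdivlMr// ltr_pdivrMr//; apply/andP; split; lra.
Qed.

Definition poly2 (A B C : R) t : R := A * t ^+ 2 + B * t + C.

Let quad_poly2 A B C x : 0 < x.2 ->
  quad 0 0 0 A B C x = x.2 ^+ 2 * poly2 A B C (x.1 / x.2).
Proof. by move=> x2; rewrite /quad /poly2; field; rewrite gt_eqF. Qed.

(** In terms of [e = (m, 1)] and [n = (1, - m)], the quadratic form
    [(x . e) ^+ 2 - 2 * (x . n) ^+ 2] on the line of height 1: its Laplacian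
    is negative and it is positive around the direction of [e]. *)
Let barrier (m t : R) : R := poly2 (m ^+ 2 - 2) (6 * m) (1 - 2 * m ^+ 2) t.

Let barrier_gt0 m t : m - 1 / 4 <= t <= m + 1 / 4 -> 0 < barrier m t.
Proof.
move=> /andP[t1 t2]; set e := t - m.
have te : t = m + e by rewrite /e; ring.
have -> : barrier m t = (m ^+ 2 + 1 + m * e) ^+ 2 - 2 * e ^+ 2.
  by rewrite /barrier /poly2 te; ring.
have e1 : - (1 / 4) <= e by rewrite /e; lra.
have e2 : e <= 1 / 4 by rewrite /e; lra.
have me : - ((m ^+ 2 + 1) / 8) <= m * e.
  have q1 := sqr_ge0 (m - 1); have q2 := sqr_ge0 (m + 1); nra.
have m2 := sqr_ge0 m.
have h : 7 / 8 <= m ^+ 2 + 1 + m * e by lra.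
have h2 : (7 / 8) ^+ 2 <= (m ^+ 2 + 1 + m * e) ^+ 2.
  by rewrite ler_pXn2r ?nnegrE//; lra.
have e3 : e ^+ 2 <= 1 / 16 by nra.
by apply: lt_le_trans (lerB h2 (_ : _ <= 2 * (1 / 16))); [|lra]; lra.
Qed.

Let continuous_poly2 A B C : continuous (poly2 A B C).
Proof.
move=> t; rewrite /poly2; apply: cvgD; last exact: cvg_cst.
apply: cvgD; (apply: cvgM; first exact: cvg_cst); last exact: cvg_id.
exact: exprn_continuous.
Qed.

(** The difference with the interpolating polynomial of Laplacian [k] is
    squeezed to 0 by comparison with multiples of a positive quadratic form
    of negative Laplacian. The form is positive on short intervals only. *)
Lemma slice_quadratic c d : c < d -> d - c <= 1 / 2 ->
  (forall t, c < t < d -> 0 < slice t) ->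
  exists A B, forall t, c <= t <= d -> slice t = poly2 A B (k / 2 - A) t.
Proof.
move=> cd dc pos.
have cdn : (c * d + 1) != 0.
  apply/eqP => h; have q := sqr_ge0 (d - c); have q2 := sqr_ge0 (d + c).
  have : (d - c) ^+ 2 <= 1 / 4 by nra.
  nra.
have dcn : d - c != 0 by rewrite subr_eq0 gt_eqF.
(* [poly2 A B (k / 2 - A)] is the trace of a quadratic form of Laplacian [k];
   two parameters are left to match the values at [c] and [d], as the
   directions of [(c, 1)] and [(d, 1)] differ by less than a right angle *)
pose e1 := slice c - k / 2; pose e2 := slice d - k / 2.
pose A := (e2 * c - e1 * d) / ((d - c) * (c * d + 1)).
pose B := ((d ^+ 2 - 1) * e1 - (c ^+ 2 - 1) * e2) / ((d - c) * (c * d + 1)).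
have nn : (d - c) * (c * d + 1) != 0 by rewrite mulf_neq0.
exists A, B.
pose P := poly2 A B (k / 2 - A).
have Pc : P c = slice c.
  rewrite /P /poly2 /A /B.
  have -> : slice c = e1 + k / 2 by rewrite /e1; ring.
  by field; rewrite ?cdn ?dcn.
have Pd : P d = slice d.
  rewrite /P /poly2 /A /B.
  have -> : slice d = e2 + k / 2 by rewrite /e2; ring.
  by field; rewrite ?cdn ?dcn.
pose m := (c + d) / 2.
have Q0 t : c <= t <= d -> 0 < barrier m t.
  by move=> /andP[h1 h2]; apply: barrier_gt0; rewrite /m; apply/andP; split; lra.
(* dividing by a positive function that comes from a quadratic form of
   negative Laplacian makes positive interior maxima and negative interior
   minima impossible *)
pose f t := (slice t - P t) / barrier m t.
have cf : {within `[c, d], continuous f}.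
  apply: continuous_in_subspaceT => t; rewrite inE/= in_itv/= => tcd.
  apply: cvgM.
    by apply: cvgB; [exact: continuous_slice|exact: continuous_poly2].
  by apply: cvgV; [rewrite gt_eqF// Q0|exact: continuous_poly2].
have fc : f c = 0 by rewrite /f Pc subrr mul0r.
have fd : f d = 0 by rewrite /f Pd subrr mul0r.
have main t (l : R) : c < t < d -> l = f t ->
    exists2 r, 0 < r & exists g : R * R -> R, [/\ smooth g, forall x, lap g x = k - l * (2 * m ^+ 2 + 2),
      g (t, 1) = u (t, 1) &
      forall x, eball (t, 1) r x -> [/\ 0 < x.2, 0 < u x, c <= x.1 / x.2 <= d,
        u x - g x = x.2 ^+ 2 * barrier m (x.1 / x.2) * (f (x.1 / x.2) - l) &
        0 < x.2 ^+ 2 * barrier m (x.1 / x.2)]].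
  move=> tcd lE; have [r r0 H] := sector_ball tcd; exists r => //.
  exists (quad 0 0 0 (A + l * (m ^+ 2 - 2)) (B + l * (6 * m)) (k / 2 - A + l * (1 - 2 * m ^+ 2))).
  have gE x : 0 < x.2 -> quad 0 0 0 (A + l * (m ^+ 2 - 2)) (B + l * (6 * m)) (k / 2 - A + l * (1 - 2 * m ^+ 2)) x =
     x.2 ^+ 2 * (P (x.1 / x.2) + l * barrier m (x.1 / x.2)).
    by move=> x2; rewrite quad_poly2// /P /barrier /poly2; ring.
  have tcd' : c <= t <= d by move/andP : tcd => [? ?]; apply/andP; split; exact: ltW.
  split.
  - exact: smooth_quad.
  - by move=> x; rewrite lap_quad; field.
  - rewrite gE//= expr1n mul1r divr1 lE /f divfK; last by rewrite gt_eqF// Q0.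
    by rewrite /slice; ring.
  - move=> x /H [x2 /andP[h1 h2]].
    have h : c <= x.1 / x.2 <= d by apply/andP; split; exact: ltW.
    have q0 := Q0 _ h.
    split => //.
    + by rewrite sliceE// mulr_gt0 ?exprn_gt0//; apply: pos; rewrite h1.
    + rewrite sliceE// gE// /f; field; rewrite gt_eqF//.
    + by rewrite mulr_gt0 ?exprn_gt0.
have m2 : 0 < 2 * m ^+ 2 + 2 by have := sqr_ge0 m; lra.
have up t : c <= t <= d -> f t <= 0.
  move=> tcd; rewrite leNgt; apply/negP => ft.
  have [s scd smax] := EVT_max (ltW cd) cf.
  have fs : 0 < f s by apply: (lt_le_trans ft); apply: smax; rewrite in_itv.
  have scd' : c < s < d.
    move: scd; rewrite in_itv/= => /andP[h1 h2]; apply/andP; split; rewrite lt_neqAle.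
      by rewrite h1 andbT; apply/eqP => h; move: fs; rewrite -h fc ltxx.
    by rewrite h2 andbT; apply/eqP => h; move: fs; rewrite h fd ltxx.
  have [r r0 [g [sg lg gs H]]] := main s _ scd' erefl.
  have : k <= k - f s * (2 * m ^+ 2 + 2).
    apply: (@touch_above R u g (s, 1) r); [exact: r0|exact: mu_|exact: cu|exact: sg|exact: lg| |by rewrite gs| ].
    - move=> x /H [_ _ xcd E q]; rewrite -subr_le0 E pmulr_rle0// subr_le0.
      by apply: smax; rewrite in_itv.
    - by apply: uge => x /H [].
  have : 0 < f s * (2 * m ^+ 2 + 2) by rewrite mulr_gt0.
  lra.
have down t : c <= t <= d -> 0 <= f t.
  move=> tcd; rewrite leNgt; apply/negP => ft.
  have [s scd smin] := EVT_min (ltW cd) cf.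
  have fs : f s < 0 by apply: le_lt_trans ft; apply: smin; rewrite in_itv.
  have scd' : c < s < d.
    move: scd; rewrite in_itv/= => /andP[h1 h2]; apply/andP; split; rewrite lt_neqAle.
      by rewrite h1 andbT; apply/eqP => h; move: fs; rewrite -h fc ltxx.
    by rewrite h2 andbT; apply/eqP => h; move: fs; rewrite h fd ltxx.
  have [r r0 [g [sg lg gs H]]] := main s _ scd' erefl.
  have : k - f s * (2 * m ^+ 2 + 2) <= k.
    apply: (@touch_below R u g (s, 1) r);
      [exact: r0|exact: continuous_eball_integrable|exact: cu|exact: sg|exact: lg| |by rewrite gs| ].
    - move=> x /H [_ _ xcd E q]; rewrite -subr_ge0 E pmulr_rge0// subr_ge0.
      by apply: smin; rewrite in_itv.
    - by apply: ule => x /H [].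
  have : f s * (2 * m ^+ 2 + 2) < 0 by rewrite pmulr_llt0.
  lra.
move=> t tcd; have f0 : f t = 0 by apply/eqP; rewrite eq_le up// down.
have q := Q0 _ tcd; have : f t * barrier m t = 0 by rewrite f0 mul0r.
by rewrite /f divfK ?gt_eqF// => /eqP; rewrite subr_eq0 => /eqP.
Qed.

(** At a free boundary point the slice leaves zero tangentially: a kink of
    positive slope would be touched from below by functions of Laplacian
    greater than [k]. *)
Lemma slice_tangent t0 h A B C : 0 < h -> slice t0 = 0 ->
  (forall t, t0 - h <= t <= t0 -> slice t = poly2 A B C t) -> 2 * A * t0 + B = 0.
Proof.
move=> h0 st0 sP; pose n := - (2 * A * t0 + B).
have P0 : poly2 A B C t0 = 0 by rewrite -sP ?st0//; apply/andP; split; lra.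
have PE t : poly2 A B C t = (t0 - t) * (n + A * (t0 - t)).
  have -> : poly2 A B C t = poly2 A B C t - poly2 A B C t0 by rewrite P0 subr0.
  by rewrite /poly2 /n; ring.
suff : n = 0 by rewrite /n => /eqP; rewrite oppr_eq0 => /eqP.
have n0 : 0 <= n.
  rewrite leNgt; apply/negP => n0.
  pose e := Num.min h (- n / (2 * (`|A| + 1))).
  have A1 : 0 < `|A| + 1 by rewrite ltr_wpDl.
  have e0 : 0 < e by rewrite lt_min h0 divr_gt0 ?mulr_gt0// oppr_gt0.
  have eh : e <= h by rewrite ge_min lexx.
  have en : e * (2 * (`|A| + 1)) <= - n.
    by rewrite -ler_pdivlMr ?mulr_gt0// ge_min lexx orbT.
  have := slice_ge0 (t0 - e); rewrite sP; last by apply/andP; split; lra.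
  rewrite PE (_ : t0 - (t0 - e) = e); last by ring.
  rewrite pmulr_rge0//; have := ler_norm A => hA.
  have : A * e <= `|A| * e by rewrite ler_pM2r.
  nra.
(* near the ray, [g] below is positive only on the side where [u] has slope
   [n], and has half this slope; its Laplacian is at least [2 * k] *)
apply/eqP; rewrite eq_le n0 andbT leNgt; apply/negP => n1.
pose e := Num.min (h / 2) (n / (4 * (k + `|A|))).
have A1 : 0 < k + `|A| by rewrite ltr_wpDr.
have e0 : 0 < e by rewrite lt_min divr_gt0//= divr_gt0// mulr_gt0.
have eh : e <= h / 2 by rewrite ge_min lexx.
have en : e * (4 * (k + `|A|)) <= n.
  by rewrite -ler_pdivlMr ?mulr_gt0// ge_min lexx orbT.
(* [w x] is a multiple of the signed distance of [x] to the free boundary ray *)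
pose w x := t0 * x.2 - x.1.
pose g : R * R -> R := quad 0 (- n / 2) (n / 2 * t0) k (- (2 * k * t0)) (k * t0 ^+ 2).
have gE x : g x = n / 2 * w x + k * w x ^+ 2 by rewrite /g /quad /w; ring.
have [r r0 H] : exists2 r, 0 < r & forall x, eball (t0, 1) r x ->
    [/\ 3 / 4 < x.2, - e < w x & w x < e].
  have sw := smooth_quad 0 (-1) t0 0 0 0.
  have h1 := @near_pos (quad e (-1) t0 0 0 0) (t0, 1) (smooth_quad _ _ _ _ _ _).
  have h2 := @near_pos (quad e 1 (- t0) 0 0 0) (t0, 1) (smooth_quad _ _ _ _ _ _).
  have h3 := @near_pos (quad (- (3 / 4)) 0 1 0 0 0) (t0, 1) (smooth_quad _ _ _ _ _ _).
  have q1 : 0 < quad e (-1) t0 0 0 0 (t0, 1) by rewrite /quad/=; lra.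
  have q2 : 0 < quad e 1 (- t0) 0 0 0 (t0, 1) by rewrite /quad/=; lra.
  have q3 : 0 < quad (- (3 / 4)) 0 1 0 0 0 (t0, 1) :> R by rewrite /quad/=; lra.
  have [r r0 H] := nbhs_eball (filterI (filterI (h1 q1) (h2 q2)) (h3 q3)).
  exists r => // x /H [[]]; rewrite /quad /w /= => k1 k2 k3.
  by split; lra.
have : 2 * k + 2 * (k * t0 ^+ 2) <= k.
  apply: (@touch_below R u g (t0, 1) r);
    [exact: r0|exact: continuous_eball_integrable|exact: cu|exact: smooth_quad|
     by move=> x; rewrite lap_quad; ring| | | ].
  - move=> x /H [x2 w1 w2]; rewrite gE.
    have x20 : 0 < x.2 by lra.
    have hA := ler_norm (- A); rewrite normrN in hA.
    have [wx|wx] := ltP (w x) 0.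
      apply: (@le_trans _ _ 0) => //.
      have -> : n / 2 * w x + k * w x ^+ 2 = w x * (n / 2 + k * w x) by ring.
      have kn := normr_ge0 A.
      have : 0 <= n / 2 + k * w x by nra.
      nra.
    have wE : w x / x.2 = t0 - x.1 / x.2 by rewrite /w; field; rewrite gt_eqF.
    have wx0 : 0 <= w x / x.2 by rewrite divr_ge0// ltW.
    have wxh : w x / x.2 <= h by rewrite ler_pdivrMr//; nra.
    rewrite sliceE// sP; last by apply/andP; split; lra.
    rewrite PE -wE.
    have -> : x.2 ^+ 2 * (w x / x.2 * (n + A * (w x / x.2))) = w x * (n * x.2 + A * w x).
      by field; rewrite gt_eqF.
    have -> : n / 2 * w x + k * w x ^+ 2 = w x * (n / 2 + k * w x) by ring.
    apply: ler_wpM2l => //.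
    have q1 : (k + `|A|) * w x <= n / 4 by nra.
    have q2 : - A * w x <= `|A| * w x by apply: ler_wpM2r.
    have q3 : n / 4 <= n * (x.2 - 1 / 2) by nra.
    nra.
  - by rewrite gE /w /= mulr1 subrr expr0n /= !mulr0 addr0 -/(slice t0) st0.
  - by apply: ule => x /H [x2 _ _]; lra.
have := sqr_ge0 t0; have : 0 <= k * t0 ^+ 2 by rewrite mulr_ge0 ?sqr_ge0// ltW.
move: k0; lra.
Qed.

(** The trace on the line of height 1 of [k / 2] times the squared distance
    to a line through the origin. *)
Definition ramp2 t0 t : R := k / (2 * (1 + t0 ^+ 2)) * (t0 - t) ^+ 2.

Let ramp2_gt0 t0 t : t < t0 -> 0 < ramp2 t0 t.
Proof.
move=> tt; have t2 := sqr_ge0 t0.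
by rewrite /ramp2 mulr_gt0 ?exprn_gt0 ?subr_gt0// divr_gt0//; lra.
Qed.

Let ramp2E t0 t : ramp2 t0 t = poly2 (k / (2 * (1 + t0 ^+ 2))) (- (2 * t0 * (k / (2 * (1 + t0 ^+ 2)))))
   (t0 ^+ 2 * (k / (2 * (1 + t0 ^+ 2)))) t.
Proof. by rewrite /ramp2 /poly2; ring. Qed.

Let poly2_eq (A B C A' B' C' s h : R) : h != 0 ->
  poly2 A B C s = poly2 A' B' C' s -> poly2 A B C (s + h) = poly2 A' B' C' (s + h) ->
  poly2 A B C (s + 2 * h) = poly2 A' B' C' (s + 2 * h) ->
  forall t, poly2 A B C t = poly2 A' B' C' t.
Proof.
move=> h0 e1 e2 e3 t.
have hh : 2 * h ^+ 2 != 0 by rewrite mulf_neq0// ?pnatr_eq0// expf_neq0.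
have EA : A = A'.
  apply: (mulIf hh).
  have : poly2 A B C s - 2 * poly2 A B C (s + h) + poly2 A B C (s + 2 * h) =
    poly2 A' B' C' s - 2 * poly2 A' B' C' (s + h) + poly2 A' B' C' (s + 2 * h).
    by rewrite e1 e2 e3.
  by rewrite /poly2; lra.
have EB : B = B'.
  apply: (mulIf h0); move: e1 e2; rewrite /poly2 EA; lra.
move: e1; rewrite /poly2 EA EB; lra.
Qed.

Let slice_continuous_eq t (f : R -> R) : {for t, continuous f} ->
  (forall e, 0 < e -> exists2 s, t < s < t + e & slice s = f s) -> slice t = f t.
Proof.
move=> cf H; apply/eqP; rewrite -subr_eq0; apply/negPn/negP => h.
have cd : {for t, continuous (fun s => slice s - f s)}.
  by apply: cvgB => //; exact: continuous_slice.
have n0 : 0 < `|slice t - f t| by rewrite normr_gt0.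
have /cvgrPdist_lt /(_ _ n0) /nbhs_ballP[e /= e0 He] := cd.
have [s /andP[s1 s2] E] := H e e0.
have := He s; rewrite /ball/= E subrr subr0 ltxx => h'.
by have : false by apply: h'; rewrite ltr_norml; apply/andP; split; lra.
Qed.

Let slice_pos_near t : 0 < slice t -> exists2 e, 0 < e & forall s, t - e < s < t + e -> 0 < slice s.
Proof.
move=> st; have c : {for t, continuous slice} by exact: continuous_slice.
have /cvgr_gt /(_ _ st) /nbhs_ballP[e /= e0 He] := c.
exists e => // s /andP[s1 s2]; apply: He; rewrite /ball/= ltr_norml.
by apply/andP; split; lra.
Qed.

(** Tangency at the right endpoint of a component leaves a single quadratic
    polynomial. It has no other zero, so that positivity, and with it the
    formula, propagates to the left without end. *)
Lemma slice_component t1 ts : (forall t, t1 <= t -> slice t = 0) -> 0 < slice ts ->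
  exists2 t0, ts < t0 & forall t, t <= t0 -> slice t = ramp2 t0 t.
Proof.
move=> z1 pts.
pose Z := [set t | ts <= t /\ slice t = 0].
have tst1 : ts < t1 by rewrite ltNge; apply/negP => /z1 h; move: pts; rewrite h ltxx.
have Z1 : Z t1 by split; [exact: ltW|exact: z1].
have infZ : has_inf Z by split; [exists t1|exists ts => t []].
pose t0 := inf Z.
have t0le t : Z t -> t0 <= t by move=> Zt; apply: ge_inf => //; exists ts => q [].
have t0ge : ts <= t0 by apply: lb_le_inf; [exists t1|move=> t []].
have st0 : slice t0 = 0.
  apply/eqP/negPn/negP => h.
  have p : 0 < slice t0 by rewrite lt_neqAle eq_sym h slice_ge0.
  have [e e0 He] := slice_pos_near p.
  have [q Zq qe] := inf_adherent e0 infZ.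
  have := He q; have := t0le _ Zq => h1 h2; case: Zq => _ sq.
  by have := h2 ltac:(by apply/andP; split; move: qe; rewrite -/t0; lra); rewrite sq ltxx.
have tst0 : ts < t0.
  by rewrite lt_neqAle t0ge andbT; apply/eqP => h; move: pts; rewrite h st0 ltxx.
have pos t : ts <= t < t0 -> 0 < slice t.
  move=> /andP[h1 h2]; rewrite lt_neqAle eq_sym slice_ge0 andbT; apply/eqP => h.
  by move: h2; rewrite ltNge t0le.
pose h := Num.min (1 / 2) (t0 - ts).
have h0 : 0 < h by rewrite lt_min; apply/andP; split; lra.
have h2 : h <= 1 / 2 by rewrite ge_min lexx.
have hts : h <= t0 - ts by rewrite ge_min lexx orbT.
have [A [B sAB]] : exists A B, forall t, t0 - h <= t <= t0 -> slice t = poly2 A B (k / 2 - A) t.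
  apply: slice_quadratic; [lra|lra|move=> t /andP[q1 q2]].
  by apply: pos; apply/andP; split; lra.
have tg := slice_tangent h0 st0 sAB.
have t2 := sqr_ge0 t0.
have t21 : 1 + t0 ^+ 2 != 0 by rewrite gt_eqF//; lra.
have AE : A = k / (2 * (1 + t0 ^+ 2)).
  have : poly2 A B (k / 2 - A) t0 = 0 by rewrite -sAB ?st0//; apply/andP; split; lra.
  have BE : B = - (2 * A * t0) by lra.
  rewrite /poly2 BE => E.
  have : A * (1 + t0 ^+ 2) = k / 2 by move: E; rewrite expr2; lra.
  move=> E'; have -> : A = (A * (1 + t0 ^+ 2)) / (1 + t0 ^+ 2) by rewrite mulfK.
  by rewrite E'; field.
have near0 t : t0 - h <= t <= t0 -> slice t = ramp2 t0 t.
  move=> /sAB ->; rewrite /ramp2 -AE.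
  have P0 : poly2 A B (k / 2 - A) t0 = 0 by rewrite -sAB ?st0//; apply/andP; split; lra.
  have BE : B = - (2 * A * t0) by lra.
  move: P0; rewrite /poly2 BE; nra.
exists t0 => // t tt0; apply/eqP/negPn/negP => bad.
(* [g] is the last point where the formula fails; it holds at [g], hence the
   slice is positive around [g], and the quadratic polynomial there coincides
   with the one on the right *)
pose S := [set s | s <= t0 /\ slice s != ramp2 t0 s].
have St : S t by [].
have Sub : ubound S (t0 - h).
  move=> s [s1 s2]; rewrite leNgt; apply/negP => s3; move/negP : s2; apply.
  by apply/eqP; apply: near0; apply/andP; split; lra.
have supS : has_sup S by split; [exists t|exists (t0 - h)].
pose g := sup S.
have gle : g <= t0 - h by apply: ge_sup => //; exists t.
have gub s : S s -> s <= g by move=> Ss; apply: ub_le_sup => //; exists (t0 - h).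
have right s : g < s <= t0 -> slice s = ramp2 t0 s.
  move=> /andP[s1 s2]; apply/eqP/negPn/negP => s3.
  by have := gub s (conj s2 s3); lra.
have cr : continuous (ramp2 t0).
  move=> s; have /funext -> := ramp2E t0.
  exact: continuous_poly2.
have sg : slice g = ramp2 t0 g.
  apply: slice_continuous_eq => [|e e0]; first exact: cr.
  pose q := Num.min (e / 2) (h / 2).
  have q0 : 0 < q by rewrite lt_min; apply/andP; split; lra.
  have q1 : q <= e / 2 by rewrite ge_min lexx.
  have q2 : q <= h / 2 by rewrite ge_min lexx orbT.
  exists (g + q); first by apply/andP; split; lra.
  by apply: right; apply/andP; split; lra.
have gmin s : ubound S s -> g <= s by move=> us; apply: ge_sup => //; exists t.
clearbody g h.
have pg : 0 < slice g by rewrite sg; apply: ramp2_gt0; lra.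
have [e e0 He] := slice_pos_near pg.
pose q := Num.min (1 / 4) (Num.min e h).
have q0 : 0 < q by rewrite lt_min; apply/andP; split; [lra|rewrite lt_min e0].
have q1 : q <= 1 / 4 by rewrite ge_min lexx.
have q2 : q <= e by rewrite 2!ge_min lexx !orbT.
have q3 : q <= h by rewrite 2!ge_min lexx !orbT.
clearbody q.
have [A' [B' sAB']] : exists A B, forall t, g - q <= t <= g + q -> slice t = poly2 A B (k / 2 - A) t.
  apply: slice_quadratic; [lra|lra|move=> s /andP[p1 p2]].
  by apply: He; apply/andP; split; lra.
have agree s : g < s <= g + q -> poly2 A' B' (k / 2 - A') s = ramp2 t0 s.
  move=> /andP[p1 p2]; rewrite -sAB'; last by apply/andP; split; lra.
  by apply: right; apply/andP; split; lra.
have q4 : q / 4 != 0 by rewrite gt_eqF//; lra.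
have all s : poly2 A' B' (k / 2 - A') s = ramp2 t0 s.
  rewrite ramp2E; apply: (poly2_eq (s := g + q / 4) q4); rewrite -ramp2E; apply: agree;
    by apply/andP; split; lra.
have left : ubound S (g - q).
  move=> s Ss; rewrite leNgt; apply/negP => s3; have sgs := gub s Ss.
  case: Ss => _ /negP; apply; apply/eqP; rewrite sAB' ?all//.
  by apply/andP; split; lra.
have := gmin _ left; lra.
Qed.

(** Every point of positivity lies in a half-line unbounded to the left on
    which the formula of [slice_component] holds. Two such half-lines are
    nested, and the formula vanishes at the endpoint, so there is only one. *)
Lemma slice_classification t1 : (forall t, t1 <= t -> slice t = 0) ->
  (forall t, slice t = 0) \/
  exists t0, forall t, slice t = if t <= t0 then ramp2 t0 t else 0.
Proof.
move=> z1; have [|h] := pselect (forall t, slice t = 0); first by left.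
right; have [ts /eqP hts] : exists ts, slice ts <> 0 by exact/existsNP.
have pts : 0 < slice ts by rewrite lt_neqAle eq_sym hts slice_ge0.
have [t0 tst0 H] := slice_component z1 pts.
exists t0 => t; case: leP => [|tt]; first exact: H.
apply/eqP/negPn/negP => ht.
have pt : 0 < slice t by rewrite lt_neqAle eq_sym ht slice_ge0.
have [t0' tt0' H'] := slice_component z1 pt.
have e1 := H t0 (lexx _); have lt0 : t0 < t0' by lra.
have := ramp2_gt0 lt0; rewrite -H' ?e1; last exact: ltW.
by rewrite /ramp2 subrr expr0n mulr0 ltxx.
Qed.

End HalfPlane.

(** * Homogeneous solutions in a half-plane, in polar form *)

Section Wedge.
Variable R : realType.
Local Notation plane := (measurableTypeR R * measurableTypeR R)%type.
Local Notation mu := (@leb2 R).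
Implicit Types (s t r c d : R) (x y z : R * R).

Lemma polar_upper x : 0 <= x.2 -> exists r t,
  [/\ 0 <= r, 0 <= t <= pi & x = (r * cos t, r * sin t)].
Proof.
move=> x2; pose q := x.1 ^+ 2 + x.2 ^+ 2.
have s1 := sqr_ge0 x.1; have s2 := sqr_ge0 x.2.
have [q0|q0] := eqVneq q 0.
  have z1 : x.1 = 0 by apply/eqP; rewrite -sqrf_eq0; apply/eqP; move: q0; rewrite /q; lra.
  have z2 : x.2 = 0 by apply/eqP; rewrite -sqrf_eq0; apply/eqP; move: q0; rewrite /q; lra.
  exists 0, 0; split; rewrite ?lexx ?pi_ge0// !mul0r.
  by rewrite [x]surjective_pairing z1 z2.
have qp : 0 < q by rewrite lt_neqAle eq_sym q0 /q; lra.
pose r := Num.sqrt q.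
have r0 : 0 < r by rewrite sqrtr_gt0.
have rr : r ^+ 2 = q by rewrite sqr_sqrtr// ltW.
have rn : r != 0 by rewrite gt_eqF.
have x1r : - 1 <= x.1 / r <= 1.
  rewrite -ler_norml normrM (ger0_norm (_ : 0 <= r^-1)) ?invr_ge0 ?(ltW r0)//.
  rewrite ler_pdivrMr// mul1r -(@ler_pXn2r _ 2) ?nnegrE ?(ltW r0)// rr.
  by rewrite real_normK ?num_real// /q; lra.
exists r, (acos (x.1 / r)); have [h1 h2] := acos_def x1r.
split => //; first exact: ltW.
rewrite h2 sin_acos// [LHS]surjective_pairing; congr pair; first by rewrite mulrC divfK.
have -> : 1 - (x.1 / r) ^+ 2 = (x.2 / r) ^+ 2.
  rewrite !expr_div_n rr /q; field; exact: q0.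
by rewrite sqrtr_sqr ger0_norm ?divr_ge0// ?(ltW r0)// mulrC divfK.
Qed.

(** A continuous function that vanishes on the open half-plane vanishes on
    its closure. *)
Lemma upper_closure (f g : R * R -> R) : continuous f -> continuous g ->
  (forall x, 0 < x.2 -> f x = g x) -> forall x, 0 <= x.2 -> f x = g x.
Proof.
move=> cf cg fg x; rewrite le_eqVlt => /predU1P[x2|]; last exact: fg.
apply/eqP; rewrite -subr_eq0; apply/negPn/negP => h.
have cd : {for x, continuous (fun z => f z - g z)} by apply: cvgB; [exact: cf|exact: cg].
have n0 : 0 < `|f x - g x| by rewrite normr_gt0.
have /cvgrPdist_lt /(_ _ n0) /nbhs_eball[r r0 H] := cd.
pose e := Num.min 1 (r / 2).
have e0 : 0 < e by rewrite lt_min ltr01 divr_gt0.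
have e1 : e <= 1 by rewrite ge_min lexx.
have e2 : e <= r / 2 by rewrite ge_min lexx orbT.
have /H : eball x r (x.1, e) by rewrite /eball/= /dist2/= -x2; nra.
by rewrite /= (fg (x.1, e))// subrr subr0 ltxx.
Qed.

(** The squared distance to the half-plane on the right of the line at angle
    [pi - t], times [c]. *)
Definition wedge (c t : R) x : R := c * Num.max 0 (- (x.1 * sin t + x.2 * cos t)) ^+ 2.

Lemma continuous_wedge c t : continuous (wedge c t).
Proof.
move=> x; rewrite /wedge; apply: cvgM; first exact: cvg_cst.
have cm : {for x, continuous ((cst 0) \max (fun x => - (x.1 * sin t + x.2 * cos t)))}.
  apply: continuous_max; first exact: cvg_cst.
  apply: cvgN; apply: cvgD; (apply: cvgM; last exact: cvg_cst).
    exact: cvg_fst.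
  exact: cvg_snd.
rewrite (_ : (fun x0 : R * R => _) = (fun z => (((cst 0) \max (fun x => - (x.1 * sin t + x.2 * cos t))) z) * (((cst 0) \max (fun x => - (x.1 * sin t + x.2 * cos t))) z))).
  by apply: cvgM; exact: cm.
by apply/funext => z; rewrite expr2.
Qed.

(** Passage from the slope of the free boundary line in the affine chart to
    its angle. *)
Lemma cot_angle t0 : exists2 t, 0 < t < pi &
  [/\ 0 < sin t, t0 * sin t = - cos t & sin t ^+ 2 = (1 + t0 ^+ 2)^-1].
Proof.
have [r [t [r0 /andP[t1 t2] E]]] := @polar_upper (- t0, 1) ler01.
case: E => E1 E2.
have st : sin t != 0 by apply/eqP => h; move: E2; rewrite h mulr0 => /eqP; rewrite oner_eq0.
have st0 : 0 < sin t by rewrite lt_neqAle eq_sym st sin_ge0_pi// t1.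
exists t.
  rewrite !lt_neqAle t1 t2 !andbT; apply/andP; split.
    by apply/eqP => h; move: st; rewrite -h sin0 eqxx.
  by apply/eqP => h; move: st; rewrite h sinpi eqxx.
have ct : t0 * sin t = - cos t.
  by apply: oppr_inj; rewrite -mulNr E1 opprK mulrAC -E2 mul1r.
split => //.
apply: (mulIf (_ : 1 + t0 ^+ 2 != 0)).
  by have := sqr_ge0 t0 => h; rewrite gt_eqF//; lra.
rewrite mulVf; last by have := sqr_ge0 t0 => h; rewrite gt_eqF//; lra.
have := cos2Dsin2 t; rewrite -(sqrrN (cos t)) -ct; lra.
Qed.

(** The classification in the affine chart, extended to the boundary rays by
    continuity. The parameter [t1] only says that [u] vanishes near the ray
    of direction [(1, 0)]. *)
Lemma half_plane_solution k (u : R * R -> R) t1 : 0 < k -> continuous u ->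
  (forall x, 0 <= u x) ->
  (forall (p : R) x, 0 < p -> u (p *: x) = p ^+ 2 * u x) ->
  (forall y r, (forall x, eball y r x -> 0 < x.2) -> lap_le k u y r) ->
  (forall y r, (forall x, eball y r x -> 0 < x.2) ->
     (forall x, eball y r x -> 0 < u x) -> lap_ge k u y r) ->
  0 < t1 < pi ->
  (forall x, 0 < x.2 -> 0 <= x.1 * sin t1 + x.2 * cos t1 -> u x = 0) ->
  (forall x, 0 <= x.2 -> u x = 0) \/
  exists2 t, 0 < t < pi & forall x, 0 <= x.2 -> u x = wedge (k / 2) t x.
Proof.
move=> k0 cu u0 uh ule uge t1p uz.
have st1 : 0 < sin t1 by exact: sin_gt0_pi.
have sz t : - cos t1 / sin t1 <= t -> slice u t = 0.
  by rewrite ler_pdivrMr// => h; apply: uz => /=; [exact: ltr01|lra].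
have [z|[t0 H]] := slice_classification k0 cu u0 uh ule uge sz.
  left; apply: upper_closure => //; first by move=> x; exact: cvg_cst.
  by move=> x x2; rewrite (sliceE uh)// z mulr0.
right; have [t tp [st ct s2]] := cot_angle t0; exists t => //.
apply: upper_closure => //; first exact: continuous_wedge.
move=> x x2; rewrite (sliceE uh)// H /wedge.
have xE : x.1 = (x.1 / x.2) * x.2 by rewrite divfK// gt_eqF.
set q := x.1 / x.2 in xE *.
have E : - (x.1 * sin t + x.2 * cos t) = x.2 * sin t * (t0 - q).
  have -> : cos t = - (t0 * sin t) by rewrite ct opprK.
  by rewrite xE; ring.
rewrite E; case: leP => hq.
- rewrite max_r; last by rewrite mulr_ge0 ?subr_ge0// ltW// mulr_gt0.
  rewrite /ramp2 invfM -s2; ring.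
- rewrite max_l; last by rewrite pmulr_rle0 ?mulr_gt0// subr_le0 ltW.
  by rewrite expr0n /= !mulr0.
Qed.

End Wedge.

(** * The transmission conditions on the interface *)

Section Interface.
Variable R : realType.
Local Notation plane := (measurableTypeR R * measurableTypeR R)%type.
Local Notation mu := (@leb2 R).
Implicit Types (s t r c d : R) (x y z : R * R).

(** A convex (concave) kink along the axis would be touched from below
    (above) by polynomials of too large (small) Laplacian: near the point
    [(-1, 0)] the kink dominates [x.2 ^+ 2]. *)
Lemma no_kink (w : R * R -> R) A C S L r : continuous w -> 0 < r ->
  2 * A + 2 * C = L ->
  (forall x, eball (-1, 0) r x -> w x = A * x.1 ^+ 2 + C * x.2 ^+ 2 + S * x.1 * `|x.2|) ->
  (forall s, s <= r -> lap_le L w (-1, 0) s) ->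
  (forall s, s <= r -> lap_ge L w (-1, 0) s) -> S = 0.
Proof.
move=> cw r0 LE wE wle wge; apply/eqP/negPn/negP => S0.
have nS : 0 < `|S| by rewrite normr_gt0.
(* within distance [q] of [(-1, 0)] the kink [S * x.1 * |x.2|] is at least
   [x.2 ^+ 2] in absolute value *)
pose q := Num.min (1 / 4) (`|S| / 2).
have q0 : 0 < q by rewrite lt_min; apply/andP; split; lra.
have q1 : q <= 1 / 4 by rewrite ge_min lexx.
have q2 : q <= `|S| / 2 by rewrite ge_min lexx orbT.
pose s := Num.min r (q ^+ 2).
have s0 : 0 < s by rewrite lt_min r0 exprn_gt0.
have sr : s <= r by rewrite ge_min lexx.
have sq : s <= q ^+ 2 by rewrite ge_min lexx orbT.
have near x : eball (-1, 0) s x ->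
    w x = A * x.1 ^+ 2 + C * x.2 ^+ 2 + S * x.1 * `|x.2| /\ x.2 ^+ 2 <= `|S| * - x.1 * `|x.2|.
  move=> xs; split; first by apply: wE; move: xs; rewrite /eball/= => h; exact: lt_le_trans sr.
  have d : dist2 (-1, 0) x < q ^+ 2 by apply: lt_le_trans sq; exact: xs.
  rewrite /dist2/= in d.
  have p1 := sqr_ge0 (x.1 - -1); have p2 := sqr_ge0 (x.2 - 0).
  have h1 : `|x.1 - -1| < q.
    by rewrite -(@ltr_pXn2r _ 2) ?nnegrE// ?(ltW q0)// real_normK ?num_real//; lra.
  have h2 : `|x.2| < q.
    by rewrite -(@ltr_pXn2r _ 2) ?nnegrE// ?(ltW q0)// real_normK ?num_real//;
      move: d p1; rewrite subr0; lra.
  have x1 : 1 / 2 <= - x.1 by move: h1; rewrite ltr_norml => /andP[? ?]; lra.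
  rewrite -(real_normK (num_real x.2)) expr2 ler_wpM2r//.
  nra.
have y0 : `|S| * - -1 * `|0 : R| = 0 by rewrite normr0 mulr0.
have wy : w (-1, 0) = A.
  have [-> _] := near _ (eball_center (-1, 0) s0).
  by rewrite /= normr0 mulr0 sqrrN expr1n expr0n /= mulr0 mulr1 !addr0.
have [Sp|Sn] := ltP 0 S.
- have : L <= L - 2.
    apply: (@touch_above R w (quad 0 0 0 A 0 (C - 1)) (-1, 0) s).
    + exact: s0.
    + by apply: measurable_funTS; exact: continuous_plane_measurable.
    + exact: cw.
    + exact: smooth_quad.
    + by move=> x; rewrite lap_quad; lra.
    + by move=> x /near[-> ]; rewrite (gtr0_norm Sp) /quad; nra.
    + by rewrite wy /quad/=; ring.
    + exact: wge.
  lra.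
- have Sn' : S < 0 by rewrite lt_neqAle S0.
  have : L + 2 <= L.
    apply: (@touch_below R w (quad 0 0 0 A 0 (C + 1)) (-1, 0) s).
    + exact: s0.
    + exact: continuous_eball_integrable.
    + exact: cw.
    + exact: smooth_quad.
    + by move=> x; rewrite lap_quad; lra.
    + by move=> x /near[-> ]; rewrite (ltr0_norm Sn') /quad; nra.
    + by rewrite wy /quad/=; ring.
    + exact: wle.
  lra.
Qed.

(** The first equation says that the squared sines are [a * l] and [b * l];
    the square of the second one then gives [(a + b) * l = 1]. Hence the two
    squared sines add up to 1, the two angles differ by a right angle, and
    the sign in the second equation tells in which order. *)
Lemma angles_of_transmission (a b t1 t2 : R) : 0 < a -> 0 < b -> a != b ->
  0 < t1 < pi -> 0 < t2 < pi ->
  sin t1 ^+ 2 / a = sin t2 ^+ 2 / b ->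
  sin t1 * cos t1 + sin t2 * cos t2 = 0 ->
  ((t1 < pi / 2 /\ t2 = t1 + pi / 2) \/ (pi / 2 < t1 /\ t2 = t1 - pi / 2)) /\
  cos (2 * t1) = (b - a) / (b + a).
Proof.
move=> a0 b0 ab t1p t2p.
have := cos2Dsin2 t1; have := cos2Dsin2 t2.
have := sin_gt0_pi t1p; have := sin_gt0_pi t2p.
have c2E : cos (2 * t1) = 2 * cos t1 ^+ 2 - 1 by rewrite mulr_natl cos_mulr2n -mulr_natl.
have e1 := @cosDpihalf R t1; have e2 := @cosBpihalf R t1.
have pp := @pi_gt0 R.
rewrite c2E; move: e1 e2.
set s1 := sin t1; set s2 := sin t2; set c1 := cos t1; set c2 := cos t2.
move=> e1 e2 s20 s10 u2 u1 E1 E2.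
pose l := s1 ^+ 2 / a.
have s1E : s1 ^+ 2 = a * l by rewrite /l; field; rewrite gt_eqF.
have s2E : s2 ^+ 2 = b * l by rewrite /l E1; field; rewrite gt_eqF.
have l0 : 0 < l by rewrite divr_gt0// exprn_gt0.
have E3 : (s1 * c1) ^+ 2 = (s2 * c2) ^+ 2.
  by rewrite -sqrrN; congr (_ ^+ 2); lra.
have c1E : c1 ^+ 2 = 1 - a * l by lra.
have c2E' : c2 ^+ 2 = 1 - b * l by lra.
have E4 : l * ((a - b) * (1 - (a + b) * l)) = 0.
  rewrite !exprMn c1E c2E' s1E s2E in E3; lra.
have E5 : (a + b) * l = 1.
  move/eqP: E4; rewrite mulf_eq0 gt_eqF//= mulf_eq0 subr_eq0 (negbTE ab)/=.
  by rewrite subr_eq0 => /eqP.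
have lE : l = (a + b)^-1.
  by apply: (mulfI (_ : a + b != 0)); rewrite ?E5 ?divff// gt_eqF// addr_gt0.
split; last by rewrite c1E lE; field; rewrite gt_eqF// addr_gt0.
have s2c1 : s2 ^+ 2 = c1 ^+ 2 by rewrite c1E s2E; lra.
have /andP[t10 t1pi] := t1p; have /andP[t20 t2pi] := t2p.
have c1n : c1 != 0 by rewrite -sqrf_eq0 -s2c1 sqrf_eq0 gt_eqF.
have [c10|c10] := ltP 0 c1.
- have s2c : s2 = c1.
    by apply/eqP; rewrite -(eqrXn2 (n := 2)) ?s2c1// ltW.
  have c2s : c2 = - s1.
    by apply: (mulfI (_ : s2 != 0)); rewrite ?gt_eqF//; move: E2; rewrite s2c; lra.
  have tl : t1 < pi / 2.
    rewrite ltNge; apply/negP => h; move: c10; rewrite ltNge => /negP; apply.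
    rewrite /c1 -[t1](subrK (pi / 2)) cosDpihalf oppr_le0; apply: sin_ge0_pi.
    by clear - h t1pi pp; apply/andP; split; lra.
  left; split => //; apply: (@cos_inj R); rewrite ?in_itv/=.
  + by clear - t20 t2pi; apply/andP; split; lra.
  + by clear - t10 t1pi tl pp; apply/andP; split; lra.
  + by rewrite e1 -/c2 c2s.
- have c1l : c1 < 0 by rewrite lt_neqAle c1n.
  have s2c : s2 = - c1.
    by apply/eqP; rewrite -(eqrXn2 (n := 2)) ?sqrrN ?s2c1// ?ltW// oppr_gt0.
  have c2s : c2 = s1.
    by apply: (mulfI (_ : s2 != 0)); rewrite ?gt_eqF//; move: E2; rewrite s2c; lra.
  have tl : pi / 2 < t1.
    rewrite ltNge; apply/negP => h; move: c1l; rewrite ltNge => /negP; apply.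
    by apply: cos_ge0_pihalf; clear - h t10 pp; apply/andP; split; lra.
  right; split => //; apply: (@cos_inj R); rewrite ?in_itv/=.
  + by clear - t20 t2pi; apply/andP; split; lra.
  + by clear - t10 t1pi tl pp; apply/andP; split; lra.
  + by rewrite e2 -/c2 c2s.
Qed.

Lemma sin_sqr_double t : sin t ^+ 2 = (1 - cos (2 * t)) / 2.
Proof. by rewrite mulr_natl cos_mulr2n sin2cos2; field. Qed.

Lemma sin_ge0E t : 0 < t < pi *+ 2 -> (0 <= sin t) = (t <= pi).
Proof.
move=> /andP[t0 t2]; apply/idP/idP => [|tp]; last by apply: sin_ge0_pi; rewrite tp ltW.
apply: contraTT; rewrite -!ltNge => tp; rewrite -[t](subrK pi) sinDpi oppr_lt0.
by apply: sin_gt0_pi; apply/andP; split; move: t2; rewrite mulr2n; lra.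
Qed.

End Interface.

(** * The profile of the blow-up *)

Section Assembly.
Variable R : realType.
Local Notation plane := (measurableTypeR R * measurableTypeR R)%type.
Local Notation mu := (@leb2 R).
Implicit Types (s t r c d : R) (x y z : R * R).

Lemma flip_polar r t : flip (r * cos t, r * sin t) = (r * cos (2 * pi - t), r * sin (2 * pi - t)).
Proof.
have p2 : 2 * pi = pi *+ 2 :> R by rewrite mulr_natl.
rewrite /flip/= p2 cosB sinB cos2pi sin2pi; congr pair; ring.
Qed.

Lemma polar x : exists r t,
  [/\ 0 <= r, 0 <= t <= 2 * pi & x = (r * cos t, r * sin t)].
Proof.
have p0 := @pi_ge0 R.
have [x2|x2] := leP 0 x.2.
  have [r [t [r0 /andP[t0 t1] ->]]] := polar_upper x2.
  by exists r, t; split => //; apply/andP; split; lra.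
have [|r [t [r0 /andP[t0 t1] E]]] := @polar_upper R (flip x).
  by rewrite /= oppr_ge0 ltW.
exists r, (2 * pi - t); split => //; first by apply/andP; split; lra.
by rewrite -flip_polar -E flipK.
Qed.

(** The condition on [x] says that the angle of [x] is at most [pi - t1]. *)
Lemma zero_sector (u : R * R -> R) (G : R -> R) t1 :
  (forall r t, 0 <= r -> 0 <= t <= pi -> u (r * cos t, r * sin t) = r ^+ 2 * G t) ->
  0 < t1 < pi -> (forall t, 0 <= t <= pi - t1 -> G t = 0) ->
  forall x, 0 < x.2 -> 0 <= x.1 * sin t1 + x.2 * cos t1 -> u x = 0.
Proof.
move=> uG /andP[t10 t1p] G0 x x2; have [r [t [r0 /andP[t0 tp] E]]] := polar_upper (ltW x2).
rewrite E /= in x2 *.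
have rp : 0 < r by rewrite lt_neqAle r0 andbT; apply/eqP => h; move: x2; rewrite -h mul0r ltxx.
rewrite (_ : _ + _ = r * sin (t + t1)); last by rewrite sinD; ring.
rewrite pmulr_rge0// sin_ge0E; last by apply/andP; split; rewrite ?mulr2n; lra.
by move=> h; rewrite uG ?t0// G0 ?mulr0//; apply/andP; split; lra.
Qed.

(** The squared sines of the two wedges, written with the double angle. *)
Lemma wedge_profile (a b t1 t2 : R) (g : R -> R) :
  0 < a -> 0 < b -> 0 < t1 < pi -> 0 < t2 < pi ->
  (forall t, 0 <= t <= pi -> g t = (4 * a)^-1 * Num.max 0 (- sin (t + t1)) ^+ 2) ->
  (forall t, pi <= t <= 2 * pi -> g t = (4 * b)^-1 * Num.max 0 (sin (t - t2)) ^+ 2) ->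
  (forall t, 0 <= t <= 2 * pi ->
     (g t = 0 <-> 0 <= t <= pi - t1 \/ pi + t2 <= t <= 2 * pi)) /\
  [/\ forall t, pi - t1 <= t <= pi -> g t = (8 * a)^-1 *
        (1 - cos (2 * t1) * cos (2 * t) + sin (2 * t1) * sin (2 * t)),
      forall t, pi <= t <= pi + t2 -> g t = (8 * b)^-1 *
        (1 - cos (2 * t2) * cos (2 * t) - sin (2 * t2) * sin (2 * t)) &
      forall t, 0 <= t <= 2 * pi -> ~ (pi - t1 <= t <= pi + t2) -> g t = 0].
Proof.
move=> a0 b0 /andP[t10 t1pi] /andP[t20 t2pi] gup glow.
have p0 := @pi_gt0 R.
have gup1 t : 0 <= t <= pi - t1 -> g t = 0.
  move=> /andP[h1 h2]; rewrite gup; last by apply/andP; split; lra.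
  rewrite max_l ?expr0n ?mulr0// oppr_le0; apply: sin_ge0_pi; apply/andP; split; lra.
have glow1 t : pi + t2 <= t <= 2 * pi -> g t = 0.
  move=> /andP[h1 h2]; rewrite glow; last by apply/andP; split; lra.
  rewrite max_l ?expr0n ?mulr0// -[t - t2](subrK pi) sinDpi oppr_le0.
  by apply: sin_ge0_pi; apply/andP; split; lra.
have gup2 t : pi - t1 < t <= pi -> 0 < - sin (t + t1).
  move=> /andP[h1 h2]; rewrite oppr_gt0 ltNge sin_ge0E -?ltNge; first lra.
  by rewrite mulr2n; apply/andP; split; lra.
have glow2 t : pi <= t < pi + t2 -> 0 < sin (t - t2).
  by move=> /andP[h1 h2]; apply: sin_gt0_pi; apply/andP; split; lra.
split.
- move=> t /andP[h0 h2]; split; last by case; [exact: gup1|exact: glow1].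
  move=> gt0; have [tp|tp] := leP t pi.
    have [h|h] := leP t (pi - t1); first by left; rewrite h0.
    have q := gup2 t ltac:(by rewrite h tp).
    have : 0 < g t.
      rewrite gup ?h0// max_r ?(ltW q)// mulr_gt0 ?exprn_gt0// invr_gt0.
      exact: mulr_gt0.
    by rewrite gt0 ltxx.
  have [h|h] := leP (pi + t2) t; first by right; rewrite h2.
  have q := glow2 t ltac:(by rewrite h (ltW tp)).
  have : 0 < g t.
    rewrite glow ?h2 ?(ltW tp)// max_r ?(ltW q)// mulr_gt0 ?exprn_gt0// invr_gt0.
    exact: mulr_gt0.
  by rewrite gt0 ltxx.
split => //.
- move=> t /andP[h1 h2]; rewrite gup; last by apply/andP; split; lra.
  have s0 : 0 <= - sin (t + t1).
    move: h1; rewrite le_eqVlt => /predU1P[<-|h1]; last by apply/ltW/gup2; rewrite h1.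
    by rewrite subrK sinpi oppr0.
  rewrite max_r// sqrrN sin_sqr_double mulrDr cosD.
  by set C := cos _; field; rewrite gt_eqF.
- move=> t /andP[h1 h2]; rewrite glow; last by apply/andP; split; lra.
  have s0 : 0 <= sin (t - t2) by apply: sin_ge0_pi; apply/andP; split; lra.
  rewrite max_r// sin_sqr_double mulrBr cosB.
  by set C := cos _; field; rewrite gt_eqF.
- move=> t /andP[h0 h2] n; have [h|h] := leP t (pi - t1); first by apply: gup1; rewrite h0.
  apply: glow1; rewrite h2 andbT leNgt; apply/negP => h'.
  by apply: n; apply/andP; split; exact: ltW.
Qed.

Variables (a b : R) (v v0 : R * R -> R) (rho : nat -> R).
Hypotheses (a0 : 0 < a) (b0 : 0 < b) (sol : obstacle_solution a b v).
Hypotheses (rho0 : forall n, 0 < rho n) (crho : rho @ \oo --> (0 : R)).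
Hypothesis cvv : {ae mu, forall x : plane, v (rho n *: (x : R * R)) / rho n ^+ 2 @[n --> \oo] --> v0 x}.
Hypothesis cv0 : continuous v0.
Hypothesis hom : forall (p : R) x, 0 < p -> v0 (p *: x) = p ^+ 2 * v0 x.

Let cu : continuous (fun x => v0 (flip x)).
Proof. by move=> x; apply: continuous_comp; [exact: continuous_flip|exact: cv0]. Qed.

(** The classification applies on each side of the interface. If one of the
    two sides vanished, so would the other, because their values on the axis
    agree; this contradicts nondegeneracy. *)
Lemma blowup_wedges t1 t2 : 0 < t1 < pi -> 0 < t2 < pi ->
  (forall x, 0 < x.2 -> 0 <= x.1 * sin t1 + x.2 * cos t1 -> v0 x = 0) ->
  (forall x, 0 < x.2 -> 0 <= x.1 * sin t2 + x.2 * cos t2 -> v0 (flip x) = 0) ->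
  exists s1 s2, [/\ 0 < s1 < pi, 0 < s2 < pi,
    forall x, 0 <= x.2 -> v0 x = wedge (4 * a)^-1 s1 x &
    forall x, 0 <= x.2 -> v0 (flip x) = wedge (4 * b)^-1 s2 x].
Proof.
move=> t1p t2p z1 z2.
have vge0 x : 0 <= v0 x by exact: (@blowup_ge0 R a b v v0 rho sol rho0 crho cvv cv0).
have k1 : 0 < a^-1 * 2^-1 by rewrite mulr_gt0 ?invr_gt0.
have k2 : 0 < b^-1 * 2^-1 by rewrite mulr_gt0 ?invr_gt0.
have hom2 (p : R) x : 0 < p -> v0 (flip (p *: x)) = p ^+ 2 * v0 (flip x).
  move=> p0; rewrite -hom//; congr v0.
  by rewrite /flip; congr pair; rewrite /GRing.scale/= /GRing.scale/= ?mulrN.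
have ek1 : a^-1 * 2^-1 / 2 = (4 * a)^-1 by field; rewrite gt_eqF.
have ek2 : b^-1 * 2^-1 / 2 = (4 * b)^-1 by field; rewrite gt_eqF.
have U := half_plane_solution k1 cv0 vge0 hom
  (fun y r => @blowup_upper R a b v v0 rho a0 b0 sol rho0 crho cvv cv0 y r)
  (fun y r => @blowup_upper_ge R a b v v0 rho a0 b0 sol rho0 crho cvv cv0 y r) t1p z1.
have V := half_plane_solution k2 cu (fun x => vge0 (flip x)) hom2
  (fun y r => @blowup_lower R a b v v0 rho a0 b0 sol rho0 crho cvv cv0 y r)
  (fun y r => @blowup_lower_ge R a b v v0 rho a0 b0 sol rho0 crho cvv cv0 y r) t2p z2.
rewrite ek1 in U; rewrite ek2 in V.
have f1 : flip (-1, 0) = (-1, 0) :> R * R by rewrite /flip/= oppr0.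
have wp c t : 0 < c -> 0 < t < pi -> 0 < wedge c t (-1, 0).
  move=> c0 tp; have st := sin_gt0_pi tp.
  by rewrite /wedge/= mul0r addr0 mulN1r opprK max_r ?(ltW st)// mulr_gt0 ?exprn_gt0.
have i1 : 0 < (4 * a)^-1 by rewrite invr_gt0 mulr_gt0.
have i2 : 0 < (4 * b)^-1 by rewrite invr_gt0 mulr_gt0.
case: U => [U|[s1 s1p U]]; case: V => [V|[s2 s2p V]].
- exfalso; apply: (@blowup_nonzero R a b v v0 rho a0 b0 sol rho0 crho cvv) => x.
  have [x2|x2] := leP 0 x.2; first exact: U.
  by rewrite -(flipK x) V// /= oppr_ge0 ltW.
- by have := wp _ _ i2 s2p; rewrite -V//= f1 U//= ltxx.
- by have := wp _ _ i1 s1p; rewrite -U//= -f1 V//= ltxx.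
- by exists s1, s2.
Qed.

(** Continuity gives the first equation. For the second one, near [(-1, 0)]
    the function [fold a b v0] is a quadratic polynomial in [x.1] and
    [|x.2|], whose mixed coefficient must vanish by [no_kink]. *)
Lemma blowup_transmission s1 s2 : 0 < s1 < pi -> 0 < s2 < pi ->
  (forall x, 0 <= x.2 -> v0 x = wedge (4 * a)^-1 s1 x) ->
  (forall x, 0 <= x.2 -> v0 (flip x) = wedge (4 * b)^-1 s2 x) ->
  sin s1 ^+ 2 / a = sin s2 ^+ 2 / b /\ sin s1 * cos s1 + sin s2 * cos s2 = 0.
Proof.
move=> s1p s2p U V.
have st1 := sin_gt0_pi s1p; have st2 := sin_gt0_pi s2p.
have wE c t x : 0 <= - (x.1 * sin t + x.2 * cos t) ->
    wedge c t x = c * (x.1 * sin t + x.2 * cos t) ^+ 2.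
  by move=> h; rewrite /wedge max_r// sqrrN.
have w1 c t : 0 < t < pi -> wedge c t (-1, 0) = c * sin t ^+ 2.
  move=> tp; have st := sin_gt0_pi tp.
  by rewrite wE/= mul0r addr0 mulN1r ?opprK ?(ltW st)// sqrrN.
split.
  have := U (-1, 0) (lexx _); rewrite w1// => e1.
  have := V (-1, 0) (lexx _); rewrite w1// /flip/= oppr0 e1 => e2.
  have -> : sin s1 ^+ 2 / a = 4 * ((4 * a)^-1 * sin s1 ^+ 2) by field; rewrite gt_eqF.
  by rewrite e2; field; rewrite gt_eqF.
pose S := (sin s1 * cos s1 + sin s2 * cos s2) / 2.
suff : S = 0 by rewrite /S; lra.
pose l t x := x.1 * sin t + `|x.2| * cos t.
have cl t : {for (-1, 0), continuous (fun x => - l t x)}.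
  apply: cvgN; apply: cvgD; (apply: cvgM; last exact: cvg_cst); first exact: cvg_fst.
  by apply: cvg_norm; exact: cvg_snd.
have lp t : 0 < t < pi -> 0 < - l t (-1, 0).
  by move=> tp; rewrite /l/= normr0 mul0r addr0 mulN1r opprK sin_gt0_pi.
have n1 : \forall x \near ((-1, 0) : R * R), 0 < - l s1 x.
  by have /cvgr_gt /(_ _ (lp _ s1p)) := cl s1; apply.
have n2 : \forall x \near ((-1, 0) : R * R), 0 < - l s2 x.
  by have /cvgr_gt /(_ _ (lp _ s2p)) := cl s2; apply.
have [r r0 H] := nbhs_eball (filterI n1 n2).
pose ab x : R * R := (x.1, `|x.2|).
have abc x : (x = ab x /\ flip x = flip (ab x)) \/ (x = flip (ab x) /\ flip x = ab x).
  have [x2|x2] := leP 0 x.2; [left|right].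
    by rewrite /ab ger0_norm// -surjective_pairing.
  by rewrite /ab ltr0_norm// -/(flip x) flipK.
have pos x : eball (-1, 0) r x -> 0 < v0 x /\ 0 < v0 (flip x).
  move=> /H[/= h1 h2].
  have p1 : 0 < v0 (ab x).
    rewrite U//= wE; last exact: ltW.
    by rewrite -sqrrN mulr_gt0 ?exprn_gt0// invr_gt0 mulr_gt0.
  have p2 : 0 < v0 (flip (ab x)).
    rewrite V//= wE; last exact: ltW.
    by rewrite -sqrrN mulr_gt0 ?exprn_gt0// invr_gt0 mulr_gt0.
  by case: (abc x) => -[e1 e2]; rewrite e2 [in v0 x]e1.
apply: (@no_kink R (fold a b v0) ((sin s1 ^+ 2 + sin s2 ^+ 2) / 4)
  ((cos s1 ^+ 2 + cos s2 ^+ 2) / 4) S 1 r).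
- exact: continuous_fold0.
- exact: r0.
- by have := cos2Dsin2 s1; have := cos2Dsin2 s2; lra.
- move=> x /H[/= h1 h2].
  have -> : fold a b v0 x = a * v0 (ab x) + b * v0 (flip (ab x)) by [].
  rewrite U//= V//= !wE; [|exact: ltW|exact: ltW].
  rewrite /= -(real_normK (num_real x.2)) /S; field.
  by rewrite !gt_eqF.
- by move=> s _; exact: (@blowup_fold R a b v v0 rho a0 b0 sol rho0 crho cvv cv0).
- move=> s sr; apply: (@blowup_fold_ge R a b v v0 rho a0 b0 sol rho0 crho cvv cv0).
  by move=> x xs; apply: pos; apply: lt_le_trans sr; exact: xs.
Qed.

End Assembly.

Unset Implicit Arguments.
Theorem lemma5p1 (R : realType) (lambda Lambda alpha beta : R)
  (hlambda : 0 < lambda)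
  (halpha : lambda <= alpha <= Lambda)
  (hbeta : lambda <= beta <= Lambda)
  (hneq : alpha != beta)
  (v0 : R * R -> R) (g : R -> R)
  (hblowup : blowup_at_origin alpha beta v0)
  (hpolar : forall r theta : R, 0 <= r -> 0 <= theta <= 2 * pi ->
     v0 (r * cos theta, r * sin theta) = r ^+ 2 * g theta)
  (hzero : exists theta1 theta2 : R,
     [/\ 0 < theta1 < pi,
         0 < theta2 < pi &
         forall theta : R,
           0 <= theta <= pi - theta1 \/ pi + theta2 <= theta <= 2 * pi ->
           g theta = 0]) :
  exists theta1 theta2 : R,
    [/\ 0 < theta1 < pi,
        0 < theta2 < pi,
        forall theta : R, 0 <= theta <= 2 * pi ->
          (g theta = 0 <->
           0 <= theta <= pi - theta1 \/ pi + theta2 <= theta <= 2 * pi) &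
        [/\ forall theta : R, pi - theta1 <= theta <= pi ->
              g theta = (8 * alpha)^-1 *
                (1 - cos (2 * theta1) * cos (2 * theta)
                   + sin (2 * theta1) * sin (2 * theta)),
            forall theta : R, pi <= theta <= pi + theta2 ->
              g theta = (8 * beta)^-1 *
                (1 - cos (2 * theta2) * cos (2 * theta)
                   - sin (2 * theta2) * sin (2 * theta)),
            forall theta : R, 0 <= theta <= 2 * pi ->
              ~ (pi - theta1 <= theta <= pi + theta2) -> g theta = 0,
            (theta1 < pi / 2 /\ theta2 = theta1 + pi / 2) \/
            (pi / 2 < theta1 /\ theta2 = theta1 - pi / 2) &
            cos (2 * theta1) = (beta - alpha) / (beta + alpha)]].
Proof.
have a0 : 0 < alpha by move/andP: halpha => [h _]; exact: lt_le_trans h.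
have b0 : 0 < beta by move/andP: hbeta => [h _]; exact: lt_le_trans h.
have [cv0 [v [rho [sol rho0 crho cvv]]]] := hblowup.
have p0 := @pi_gt0 R.
have hom (p : R) (x : R * R) : 0 < p -> v0 (p *: x) = p ^+ 2 * v0 x.
  move=> pp; have [r [t [r0 tp ->]]] := polar x.
  rewrite hpolar// mulrA -exprMn -hpolar//; last by rewrite mulr_ge0// ltW.
  by congr v0; congr pair; rewrite /GRing.scale/= /GRing.scale/= mulrA.
have gU r t : 0 <= r -> 0 <= t <= pi -> v0 (r * cos t, r * sin t) = r ^+ 2 * g t.
  by move=> r0 /andP[t0 tp]; apply: hpolar => //; apply/andP; split; lra.
have gV r t : 0 <= r -> 0 <= t <= pi ->
    v0 (flip (r * cos t, r * sin t)) = r ^+ 2 * g (2 * pi - t).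
  move=> r0 /andP[t0 tp]; rewrite flip_polar; apply: hpolar => //.
  by apply/andP; split; lra.
have [z1 [z2 [z1p z2p gz]]] := hzero.
have gz2 t : 0 <= t <= pi - z2 -> g (2 * pi - t) = 0.
  by move=> /andP[h1 h2]; apply: gz; right; apply/andP; split; lra.
have Z1 := @zero_sector R v0 g z1 gU z1p (fun t h => gz t (or_introl h)).
have Z2 := @zero_sector R (fun x => v0 (flip x)) (fun t => g (2 * pi - t)) z2 gV z2p gz2.
have [t1 [t2 [t1p t2p U V]]] := @blowup_wedges R alpha beta v v0 rho a0 b0 sol rho0 crho cvv cv0 hom z1 z2 z1p z2p Z1 Z2.
have [E1 E2] := @blowup_transmission R alpha beta v v0 rho a0 b0 sol rho0 crho cvv cv0 t1 t2 t1p t2p U V.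
have [A1 A2] := angles_of_transmission a0 b0 hneq t1p t2p E1 E2.
have gup t : 0 <= t <= pi -> g t = (4 * alpha)^-1 * Num.max 0 (- sin (t + t1)) ^+ 2.
  move=> tp; have := gU 1 t ler01 tp; rewrite !mul1r expr1n mul1r => <-.
  rewrite U/=; last exact: sin_ge0_pi.
  by rewrite /wedge/= (_ : _ + _ = sin (t + t1))//= sinD addrC.
have glow t : pi <= t <= 2 * pi -> g t = (4 * beta)^-1 * Num.max 0 (sin (t - t2)) ^+ 2.
  move=> /andP[h1 h2]; have tp : 0 <= 2 * pi - t <= pi by apply/andP; split; lra.
  have := gV 1 _ ler01 tp; rewrite !mul1r expr1n mul1r opprB addrCA subrr addr0 => <-.
  rewrite V/=; last exact: sin_ge0_pi.
  rewrite /wedge/= sinB.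
  have := flip_polar 1 (2 * pi - t); rewrite opprB addrCA subrr addr0 /flip/= !mul1r.
  case=> -> e; rewrite -[sin (2 * pi - t)]opprK e; congr (_ * Num.max 0 _ ^+ 2); ring.
have [P1 [P2 P3 P4]] := wedge_profile a0 b0 t1p t2p gup glow.
by exists t1, t2.
Qed.
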